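(* Let $\mathcal{A} \subseteq \mathcal{F}$ be a field of subsets of $\mathbb{N}$ and $p \in \{0\} \cup [1,\infty)$. Define $\lambda(\mathcal{A}) := \xi^{-1}(\sigma[\mathcal{A}])$. Then the following claims hold. 1. $\lambda(\mathcal{A}) \subseteq \mathcal{F}$. 2. $\mathcal{L}_p(\lambda(\mathcal{A}))$ is complete. 3. $\mathcal{L}_p(\mathcal{A})$ is isometrically isomorphic to a dense subspace of $\mathcal{L}_p(\lambda(\mathcal{A}))$, with the isomorphism mapping $[f]_{L_p(\mathcal{A})} \mapsto [f]_{L_p(\lambda(\mathcal{A}))}$. 4. The following statements are logically equivalent (statement (d) being considered only when $p\in[1,\infty)$): (a) $\mathcal{L}_p(\mathcal{A})$ is complete, (b) $\mathcal{L}_p(\lambda(\mathcal{A})) \cong \mathcal{L}_p(\mathcal{A})$ with isomorphism $[f]_{L_p(\mathcal{A})} \mapsto [f]_{L_p(\lambda(\mathcal{A}))}$, (c) $\overline{\lambda(\mathcal{A})} = \alpha(\overline{\mathcal{A}} \cup \mathcal{N})$, and (d) $\mathcal{K}_p(\alpha(\mathcal{A} \cup \mathcal{N}))$ is complete and $\overline{\alpha(\mathcal{A} \cup \mathcal{N})} = \alpha(\overline{\mathcal{A}} \cup \mathcal{N})$. Moreover, if any of 4(a)–(d) holds, then $\mathcal{L}_p(\mathcal{A}) \cong \mathcal{L}_p(\alpha(\mathcal{A} \cup \mathcal{N})) \cong \mathcal{K}_p(\alpha(\mathcal{A} \cup \mathcal{N}))$ (the last isomorphism being asserted only when $p\in[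1,\infty)$).
   Context: $\mathbb{N} = \{1,2,3,\ldots\}$. For $f:\mathbb{N}\to\mathbb{R}$, $\nu_N(f) := \frac{1}{N}\sum_{n=1}^N f(n)$, $\nu^+(f) := \limsup_{N\to\infty}\nu_N(f)$, and $\nu(f) := \lim_{N\to\infty}\nu_N(f)$ when the limit exists; $\nu(A) := \nu(I_A)$ for $A\subseteq\mathbb{N}$ with indicator $I_A$. $\mathcal{F}$ is the collection of all $A\subseteq\mathbb{N}$ for which $\nu(A)$ exists, and $\mathcal{N} := \{A\in\mathcal{F}:\nu(A)=0\}$, an ideal of $\mathcal{P}(\mathbb{N})$. $\xi(A):=[A]$ is the class of $A$ in the Boolean quotient $\mathcal{P}(\mathbb{N})/\mathcal{N}$ (under $A\sim B\iff A\triangle B\in\mathcal{N}$), and $[\mathcal{C}] := \{[A]:A\in\mathcal{C}\}$. $\alpha(\mathcal{C})$ is the smallest field of subsets of $\mathbb{N}$ containing $\mathcal{C}$; if $\mathcal{A}\subseteq\mathcal{F}$ is a field then $\alpha(\mathcal{A}\cup\mathcal{N})$ is a field contained in $\mathcal{F}$. A subset $\mathcal{M}$ of a Boolean algebra $\mathcal{B}$ is a monotone class if every non-decreasing sequence in $\mathcal{M}$ has an upper bound belonging to $\mathcal{M}$ that is a least upper bound in $\mathcal{B}$, and every non-increasing sequence in $\mathcal{M}$ has a lower bound belonging to $\mathcal{M}$ that is a greatest lower bound in $\mathcal{B}$. $[\mathcal{F}]$ is a monotone class in $\mathcal{P}(\mathbb{N})/\mathcal{N}$. For a field $\mathcal{A}\subseteq\mathcal{F}$,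 $\sigma[\mathcal{A}]$ is the smallest monotone class in $\mathcal{P}(\mathbb{N})/\mathcal{N}$ containing $[\mathcal{A}]$; equivalently, the smallest subalgebra containing $[\mathcal{A}]$ and containing suprema (taken in $\mathcal{P}(\mathbb{N})/\mathcal{N}$) of all its countable subsets. For any field $\mathcal{A}\subseteq\mathcal{F}$ ($\nu$ is finitely additive on it): $\overline{\mathcal{A}} := \{A\subseteq\mathbb{N} : \forall\epsilon>0\ \exists B,C\in\mathcal{A}$ with $B\subseteq A\subseteq C$ and $\nu(C\setminus B)<\epsilon\}$ (Peano–Jordan completion); $\nu^*(A) := \inf\{\nu(B) : B\in\mathcal{A}, A\subseteq B\}$; $f=g$ a.e. (w.r.t. $\mathcal{A}$) means $\nu^*(\{|f-g|>\epsilon\})=0$ for all $\epsilon>0$. A simple function is a finite sum $\sum_k c_k I_{A_k}$ with $c_k\in\mathbb{R}$ and $\{A_k\}\subseteq\mathcal{A}$ a finite partition of $\mathbb{N}$; its integral is $\sum_k c_k\nu(A_k)$. $f_n\to f$ hazily if $\nu^*(\{|f_n-f|>\epsilon\})\to 0$ for every $\epsilon>0$. $L_0(\mathcal{A})$ is the set of $T_1$-measurable functions $\mathbb{N}\to\mathbb{R}$, i.e. hazy limits of sequences of simple functions, with pseudometric $d(f,g)=\inf_{\epsilon>0}\{\epsilon+\nu^*(|f-g|>\epsilon)\}$ (which metrizes hazy convergence). $f$ is integrable if there are simple $f_n\to f$ hazily with $\int|f_n-f_m|\,d\nu\to 0$ as $n,m\to\infty$; then $\int f\,d\nu := \lim_n\int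 f_n\,d\nu$. For $p\in[1,\infty)$, $L_p(\mathcal{A})$ is the set of $T_1$-measurable $f$ with $|f|^p$ integrable, with pseudonorm $(\int|f|^p d\nu)^{1/p}$. $\mathcal{L}_p(\mathcal{A})$ is the quotient of $L_p(\mathcal{A})$ by equality a.e. (a normed space for $p\geq1$, a metric space for $p=0$), and $[f]_{L_p(\mathcal{A})}$ is the class of $f$. For $p\in[1,\infty)$, $K_p(\mathcal{A})$ is the set of all $h:\mathbb{N}\to\mathbb{R}$ such that (i) there is a countable $C\subset\mathbb{R}$ with $h^{-1}(y,\infty)\in\overline{\mathcal{A}}$ for all $y\in\mathbb{R}\setminus C$; and (ii) for all $\epsilon>0$ there is $y\in(0,\infty)$ with $\nu^+(g I_{g^{-1}(y^p,\infty)})<\epsilon$, where $g:=|h|^p$. It is a vector space with pseudonorm $(\nu(|h|^p))^{1/p}$, and $\mathcal{K}_p(\mathcal{A})$ is its quotient by equality a.e., a normed space. $\cong$ denotes isometric isomorphism. *)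

(* Defs.v *)
From HB Require Import structures.
From mathcomp Require Import all_boot all_order all_algebra.
From mathcomp Require Import generic_quotient.
From mathcomp Require Import all_classical all_reals all_analysis.

Set Implicit Arguments.
Unset Strict Implicit.
Unset Printing Implicit Defensive.

Import Order.TTheory GRing.Theory Num.Theory.
Import numFieldNormedType.Exports.

Local Open Scope classical_set_scope.
Local Open Scope ring_scope.

Notation posnat := {n : nat | (0 < n)%N}.

Definition pos_succ (k : nat) : posnat := exist _ k.+1 (ltn0Sn k).

Section Density.
Variable R : realType.
Implicit Types (f : posnat -> R) (A B : set posnat).

(* The average over {1, ..., N}; the junk value at N = 0 does not affect the
   limits below. *)
Definition nuN (N : nat) f : R := N%:R^-1 * \sum_(k < N) f (pos_succ k).

(* Meaningful only when the limit exists. *)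
Definition nu f : R := limn (fun N => nuN N f).

Definition nu_sup f : \bar R := limn_esup (fun N => (nuN N f)%:E).

Definition nu_set A : R := nu \1_A.

Definition densF : set (set posnat) := [set A | cvgn (fun N => nuN N \1_A)].

Definition nullN : set (set posnat) := [set A | densF A /\ nu_set A = 0].

Lemma nullNP A : nullN A <-> (fun N => nuN N \1_A) @ \oo --> (0 : R).
Proof.
split=> [[cA A0]|A0]; first by rewrite -A0.
by split; [apply/cvg_ex; exists 0|apply/cvg_lim].
Qed.

Lemma nuN_ge0 N A : 0 <= nuN N \1_A.
Proof. by rewrite mulr_ge0// ?invr_ge0// sumr_ge0. Qed.

Lemma nullN0 : nullN set0.
Proof.
apply/nullNP; rewrite [X in X @ _ --> _](_ : _ = cst 0); first exact: cvg_cst.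
by apply/funext => N; rewrite /nuN big1 ?mulr0// => k _; rewrite indic0.
Qed.

Lemma nullNS A B : A `<=` B -> nullN B -> nullN A.
Proof.
move=> AB /nullNP B0; apply/nullNP.
apply: (squeeze_cvgr _ (cvg_cst 0) B0); near=> N; rewrite nuN_ge0/=.
rewrite ler_wpM2l// ?invr_ge0// ler_sum// => k _.
rewrite !indicE ler_nat; case: (pos_succ k \in A) / idP => // kA.
by rewrite mem_set//; apply: AB; exact: set_mem.
Unshelve. all: by end_near. Qed.

Lemma nullNU A B : nullN A -> nullN B -> nullN (A `|` B).
Proof.
move=> /nullNP A0 /nullNP B0; apply/nullNP.
have AB0 : (fun N => nuN N \1_A + nuN N \1_B) @ \oo --> (0 : R).
  by rewrite -[X in _ --> X]addr0; exact: cvgD.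
apply: (squeeze_cvgr _ (cvg_cst 0) AB0); near=> N; rewrite nuN_ge0/=.
rewrite -mulrDr ler_wpM2l// ?invr_ge0// -big_split/= ler_sum// => k _.
rewrite !indicE in_setU -natrD ler_nat.
by case: (_ \in A); case: (_ \in B).
Unshelve. all: by end_near. Qed.

End Density.
Arguments nu_set : clear implicits.
Arguments densF : clear implicits.
Arguments nullN : clear implicits.

Section DensityAlgebra.
Variable R : realType.
Implicit Types A B C : set posnat.
Local Notation nullN := (nullN R).

Definition null_eq A B := `[< nullN (A `+` B) >].

Let null_eq_refl : reflexive null_eq.
Proof. by move=> A; apply/asboolP; rewrite setYK; exact: nullN0. Qed.

Let null_eq_sym : symmetric null_eq.
Proof. by move=> A B; rewrite /null_eq setYC. Qed.

Let null_eq_trans : transitive null_eq.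
Proof.
move=> B A C /asboolP AB /asboolP BC; apply/asboolP.
apply: nullNS (nullNU AB BC) => x; rewrite !setY_def /=.
by have [Bx|Bx] := pselect (B x); tauto.
Qed.

Canonical null_eq_equiv :=
  EquivRel null_eq null_eq_refl null_eq_sym null_eq_trans.

Local Open Scope quotient_scope.

(* The Boolean algebra P(N)/N. *)
Definition densAlg : Type := {eq_quot null_eq}.
HB.instance Definition _ := Choice.on densAlg.
HB.instance Definition _ := EqQuotient.on densAlg.

Definition xi A : densAlg := \pi_densAlg A.

Implicit Types a b c : densAlg.

Lemma xiP A B : xi A = xi B <-> nullN (A `+` B).
Proof.
split=> [/eqP|AB]; first by rewrite /xi eqmodE => /asboolP.
by apply/eqP; rewrite /xi eqmodE; exact/asboolP.
Qed.

Lemma repr_xi A : nullN (repr (xi A) `+` A).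
Proof. by apply/xiP; rewrite /xi reprK. Qed.

Lemma densAlg_ind (P : densAlg -> Prop) : (forall A, P (xi A)) -> forall a, P a.
Proof. by move=> PA a; rewrite -[a]reprK; exact: PA. Qed.

Definition dmeet a b := xi (repr a `&` repr b).
Definition djoin a b := xi (repr a `|` repr b).
Definition dcompl a := xi (~` repr a).
Definition dle a b := `[< nullN (repr a `\` repr b) >].
Definition dlt a b := (b != a) && dle a b.

Lemma dmeetE A B : dmeet (xi A) (xi B) = xi (A `&` B).
Proof.
apply/xiP; apply: nullNS (nullNU (repr_xi A) (repr_xi B)) => x.
rewrite !setY_def /=; have [] := pselect (A x); have [] := pselect (B x);
have [] := pselect (repr (xi A) x); have [] := pselect (repr (xi B) x); tauto.
Qed.

Lemma djoinE A B : djoin (xi A) (xi B) = xi (A `|` B).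
Proof.
apply/xiP; apply: nullNS (nullNU (repr_xi A) (repr_xi B)) => x.
rewrite !setY_def /=; have [] := pselect (A x); have [] := pselect (B x);
have [] := pselect (repr (xi A) x); have [] := pselect (repr (xi B) x); tauto.
Qed.

Lemma dcomplE A : dcompl (xi A) = xi (~` A).
Proof.
apply/xiP; apply: nullNS (repr_xi A) => x.
rewrite !setY_def /=; have [] := pselect (A x);
have [] := pselect (repr (xi A) x); tauto.
Qed.

Let dle_def a b : dle a b = (dmeet a b == a).
Proof.
rewrite -{3}[a]reprK; apply/asboolP/eqP => [ab|/xiP].
  by apply/xiP; apply: nullNS ab => x; rewrite setY_def /=; tauto.
by apply: nullNS => x; rewrite setY_def /=; tauto.
Qed.

Let dlt_def a b : dlt a b = (b != a) && dle a b. Proof. by []. Qed.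

Let dmeetC : commutative dmeet.
Proof. by move=> a b; rewrite /dmeet setIC. Qed.

Let djoinC : commutative djoin.
Proof. by move=> a b; rewrite /djoin setUC. Qed.

Let dmeetA : associative dmeet.
Proof.
elim/densAlg_ind=> A; elim/densAlg_ind=> B; elim/densAlg_ind=> C.
by rewrite !dmeetE setIA.
Qed.

Let djoinA : associative djoin.
Proof.
elim/densAlg_ind=> A; elim/densAlg_ind=> B; elim/densAlg_ind=> C.
by rewrite !djoinE setUA.
Qed.

Let djoinKI b a : dmeet a (djoin a b) = a.
Proof.
elim/densAlg_ind: a => A; elim/densAlg_ind: b => B.
by rewrite djoinE dmeetE setUC setKU.
Qed.

Let dmeetKU b a : djoin a (dmeet a b) = a.
Proof.
elim/densAlg_ind: a => A; elim/densAlg_ind: b => B.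
by rewrite dmeetE djoinE setIC setKI.
Qed.

Let dmeetUl : left_distributive dmeet djoin.
Proof.
elim/densAlg_ind=> A; elim/densAlg_ind=> B; elim/densAlg_ind=> C.
by rewrite djoinE !dmeetE djoinE setIUl.
Qed.

Let dmeetxx : idempotent_op dmeet.
Proof. by elim/densAlg_ind=> A; rewrite dmeetE setIid. Qed.

Fact densAlg_display : Order.disp_t. Proof. by []. Qed.

HB.instance Definition _ :=
  Order.isMeetJoinDistrLattice.Build densAlg_display densAlg
    dle_def dlt_def dmeetC djoinC dmeetA djoinA djoinKI dmeetKU dmeetUl dmeetxx.

Let dle0x a : (xi set0 <= a)%O.
Proof.
by rewrite leEmeet; elim/densAlg_ind: a => A; apply/eqP/etrans;
   [exact: dmeetE|rewrite set0I].
Qed.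

Let dlex1 a : (a <= xi setT)%O.
Proof.
by rewrite leEmeet; elim/densAlg_ind: a => A; apply/eqP/etrans;
   [exact: dmeetE|rewrite setIT].
Qed.

HB.instance Definition _ := Order.hasBottom.Build densAlg_display densAlg dle0x.
HB.instance Definition _ := Order.hasTop.Build densAlg_display densAlg dlex1.

Let djoinxC a : (a `|` dcompl a = \top)%O.
Proof.
elim/densAlg_ind: a => A; rewrite dcomplE.
by apply: etrans; [exact: djoinE|rewrite setUv].
Qed.

Let dmeetxC a : (a `&` dcompl a = \bot)%O.
Proof.
elim/densAlg_ind: a => A; rewrite dcomplE.
by apply: etrans; [exact: dmeetE|rewrite setICr].
Qed.

HB.instance Definition _ :=
  Order.TBDistrLattice_hasComplement.Build densAlg_display densAlg
    djoinxC dmeetxC.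

Lemma xi_le A B : (xi A <= xi B)%O <-> nullN (A `\` B).
Proof.
rewrite leEmeet; split=> [/eqP h|AB].
  have /xiP : xi (A `&` B) = xi A by rewrite -dmeetE; exact: h.
  by apply: nullNS => x; rewrite setY_def /=; tauto.
apply/eqP; apply: etrans; first exact: dmeetE.
by apply/xiP; apply: nullNS AB => x; rewrite setY_def /=; tauto.
Qed.

End DensityAlgebra.
Arguments xi : clear implicits.

Definition monotone_class (d : Order.disp_t) (B : ctbDistrLatticeType d)
    (M : set B) : Prop :=
  (forall u : nat -> B, nondecreasing_seq u -> (forall n, M (u n)) ->
     exists2 s, M s & supremums (range u) s) /\
  (forall u : nat -> B, nonincreasing_seq u -> (forall n, M (u n)) ->
     exists2 s, M s & infimums (range u) s).

Definition set_field (T : Type) (C : set (set T)) : Prop :=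
  [/\ C set0, setC_closed C & setU_closed C].

Definition field_gen (T : Type) (C : set (set T)) : set (set T) :=
  smallest (@set_field T) C.

Definition sigma_cls (R : realType) (A : set (set posnat)) : set (densAlg R) :=
  smallest (@monotone_class _ (densAlg R)) (xi R @` A).

Definition lambda (R : realType) (A : set (set posnat)) : set (set posnat) :=
  xi R @^-1` @sigma_cls R A.
Arguments lambda : clear implicits.

Section Integration.
Variables (R : realType) (A : set (set posnat)).
Implicit Types (f g h : posnat -> R) (E : set posnat) (p eps y : R).

Definition PJ_completion : set (set posnat) :=
  [set E | forall eps, 0 < eps -> exists B C : set posnat,
     [/\ A B, A C, B `<=` E, E `<=` C & nu_set R (C `\` B) < eps]].

Definition nu_out E : R := inf [set nu_set R B | B in [set B | A B /\ E `<=` B]].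

Definition eq_ae f g : Prop :=
  forall eps, 0 < eps -> nu_out [set n | eps < `|f n - g n|] = 0.

Definition simple_repr f (n : nat) (c : 'I_n -> R) (F : 'I_n -> set posnat) :=
  [/\ forall k, A (F k), partition [set: 'I_n] F [set: posnat]
    & f = fun x => \sum_(k < n) c k * \1_(F k) x].

Definition simple f : Prop := exists n c F, @simple_repr f n c F.

(* The value does not depend on the representation of f. *)
Definition simple_int f : R :=
  get [set I : R | exists n c F, @simple_repr f n c F /\
         I = \sum_(k < n) c k * nu_set R (F k)].

Definition hazily (u : nat -> posnat -> R) f : Prop :=
  forall eps, 0 < eps ->
    (fun n => nu_out [set k | eps < `|u n k - f k|]) @ \oo --> (0 : R).

Definition T1_measurable f : Prop :=
  exists2 u : nat -> posnat -> R, (forall n, simple (u n)) & hazily u f.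

Definition determining (u : nat -> posnat -> R) f : Prop :=
  [/\ forall n, simple (u n), hazily u f
    & forall eps, 0 < eps -> exists M : nat, forall n m,
        (M <= n)%N -> (M <= m)%N ->
        `|simple_int (fun k => `|u n k - u m k|)| < eps].

Definition fa_integrable f : Prop := exists u, determining u f.

(* The limit exists and is the same for all determining sequences of f. *)
Definition fa_integral f : R :=
  get [set I : R | exists2 u, determining u f &
         (fun n => simple_int (u n)) @ \oo --> I].

Definition L0_dist f g : R :=
  inf [set eps + nu_out [set n | eps < `|f n - g n|] | eps in [set eps | 0 < eps]].

Definition abs_pow p f : posnat -> R := fun n => `|f n| `^ p.

Definition Kp p : set (posnat -> R) := [set h |
  (exists2 C : set R, countable C &
     forall y, ~ C y -> PJ_completion (h @^-1` `]y, +oo[)) /\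
  (forall eps, 0 < eps -> exists2 y, 0 < y &
     let g := abs_pow p h in
     (nu_sup (fun n => (g n * \1_(g @^-1` `](y `^ p)%R, +oo[) n)%R) < eps%:E)%E)].

End Integration.
Arguments PJ_completion : clear implicits.

(* Function spaces on N carrying a pseudometric and an equivalence relation.
   The points of the quotient are literally the equivalence classes; addition,
   scaling and distance of classes are computed on representatives ("get c" is
   an element of c when c is nonempty). *)
Record fspace (R : realType) := FSpace {
  fcar : set (posnat -> R);
  feqv : (posnat -> R) -> (posnat -> R) -> Prop;
  fdist : (posnat -> R) -> (posnat -> R) -> R }.

Section Quotient.
Variable R : realType.
Implicit Types (X Y : fspace R) (f g : posnat -> R) (c : set (posnat -> R)).

Definition fclass X f : set (posnat -> R) := [set g | fcar X g /\ feqv X f g].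

Definition fquot X : set (set (posnat -> R)) := fclass X @` fcar X.

Definition qadd X c1 c2 := fclass X (get c1 + get c2).
Definition qscale X (a : R) c := fclass X (a *: get c).
Definition qdist X c1 c2 : R := fdist X (get c1) (get c2).

Definition qcomplete X : Prop :=
  forall u : nat -> set (posnat -> R), (forall n, fquot X (u n)) ->
    (forall eps : R, 0 < eps -> exists M : nat, forall n m,
       (M <= n)%N -> (M <= m)%N -> qdist X (u n) (u m) < eps) ->
    exists2 c, fquot X c & (fun n => qdist X (u n) c) @ \oo --> (0 : R).

Definition qsubspace X (D : set (set (posnat -> R))) : Prop :=
  [/\ D `<=` fquot X, D (fclass X 0),
      forall c1 c2, D c1 -> D c2 -> D (qadd X c1 c2)
    & forall a c, D c -> D (qscale X a c)].

Definition qdense X (D : set (set (posnat -> R))) : Prop :=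
  forall c, fquot X c -> forall eps : R, 0 < eps ->
    exists2 c', D c' & qdist X c c' < eps.

Definition isometric_iso X Y (D : set (set (posnat -> R)))
    (Phi : set (posnat -> R) -> set (posnat -> R)) : Prop :=
  [/\ set_bij (fquot X) D Phi,
      forall c1 c2, fquot X c1 -> fquot X c2 ->
        Phi (qadd X c1 c2) = qadd Y (Phi c1) (Phi c2),
      forall a c, fquot X c -> Phi (qscale X a c) = qscale Y a (Phi c)
    & forall c1 c2, fquot X c1 -> fquot X c2 ->
        qdist Y (Phi c1) (Phi c2) = qdist X c1 c2].

Definition isometric X Y : Prop := exists Phi, isometric_iso X Y (fquot Y) Phi.

(* The map [f]_X |-> [f]_Y. *)
Definition canonical_map X Y (Phi : set (posnat -> R) -> set (posnat -> R)) :=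
  forall f, fcar X f -> Phi (fclass X f) = fclass Y f.

End Quotient.

Section Spaces.
Variables (R : realType) (A : set (set posnat)) (p : R).

(* Intended for p = 0 or 1 <= p. *)
Definition Lp_space : fspace R :=
  if p == 0 then FSpace (@T1_measurable R A) (eq_ae A) (L0_dist A)
  else FSpace [set f | T1_measurable A f /\ fa_integrable A (abs_pow p f)]
         (eq_ae A) (fun f g => fa_integral A (abs_pow p (f - g)) `^ p^-1).

(* Intended for 1 <= p. *)
Definition Kp_space : fspace R :=
  FSpace (Kp A p) (eq_ae A) (fun f g => nu (abs_pow p (f - g)) `^ p^-1).

End Spaces.

(* Main.v *)
Require Import Defs.
From mathcomp Require Import all_boot all_order all_algebra finmap ring lra.
From mathcomp Require Import all_classical all_reals all_analysis.

Set Implicit Arguments.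
Unset Strict Implicit.
Unset Printing Implicit Defensive.

Import Order.TTheory GRing.Theory Num.Theory.
Import numFieldNormedType.Exports.

Local Open Scope classical_set_scope.
Local Open Scope ring_scope.

(** The plan is to remove the field of sets from every notion in sight.  The
    basic relation is [umean_le f c]: the averages of [f] over initial segments
    have upper limit at most [c]; for indicators it becomes [dens_le E c], a
    bound on the upper density of [E].

    A function is measurable for a field [A] when, off a set of [A] of small
    density, it is close to a simple function ([fmeas], lemma [T1P]).  For such
    functions the outer density computed with sets of [A] agrees, up to an
    arbitrarily small change of the level, with upper density ([nu_out_fmeas]),
    and integrals of nonnegative functions are the least bounds of the upper
    means of all truncations ([fa_integralP]).  Hence equality almost everywhere
    and the distance of [L_p] are expressed by the one relation [pnorm_le],
    whatever the field is, and [L_p] is [fmeas] together with finiteness of that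
    pseudonorm ([fcar_LpP]).  All the spaces of the theorem, the [K_p] included,
    become sets of functions under one common pseudometric, and a question on
    quotients becomes a question on representatives ([represents]).

    Completeness has one source, [block_gluing]: from a sequence of functions
    with summable increments one builds the function that follows the [j]-th
    term on the [j]-th of a sequence of ever longer blocks; the increments that
    it accumulates keep a small upper mean.  So the space of all functions is
    complete under the Ky Fan metric of upper density ([kyfan_cauchy_cvg]).
    Applied to indicators this computes suprema and infima of monotone sequences
    modulo null sets, and [lambdaE] follows: [lambda R A] is the closure
    [dens_cl R A] of [A] under small upper density of the symmetric difference.
    This closure consists of sets with a density, which is the first claim.  It
    absorbs the exceptional sets of a limit ([kyfan_fmeas_dens_cl]), so that
    measurability over it passes to limits; with a Fatou argument for the
    truncated norms ([pnorm_le_fatou]) this gives completeness of [L_p] over the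
    closure.  Truncations of simple functions give the density of [L_p(A)].

    A dense subspace is complete if and only if it represents every class of the
    complete space.  If it represents the indicator of [E], then a level set of
    the representative lies in the Peano-Jordan completion of [A] and differs
    from [E] by a null set ([represents_sets]).  Conversely, if the sets of the
    closure differ from sets of the completion by null sets, then the supports
    of the jumps of an approximating sequence can be covered by small sets of
    [A] up to null sets of [A]; dropping the jumps there makes the sequence
    converge uniformly off small sets of [A] ([sets_represent]).  This is the
    equivalence of (a), (b) and (c).

    A function belongs to [K_p] exactly when it is measurable and its upper
    tails are uniformly small in upper mean ([KpP]); the countable set of
    excluded levels is the set of jumps of a monotone function.  If the field
    contains the null sets, a second gluing, of truncations at slowly growing
    levels, turns any element of [L_p] into an equivalent element of [K_p]
    ([Lp_represents_Kp]).  So (d) is the criterion for the field generated by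
    [A] and the null sets, whose closure is that of [A] itself. *)

(** * Upper means *)

Section UpperMean.
Variable R : realType.
Implicit Types (f g h : posnat -> R) (c d e : R) (E F : set posnat).

Lemma ler_nuN N f g : (forall k, f k <= g k) -> nuN N f <= nuN N g.
Proof.
by move=> fg; rewrite /nuN ler_wpM2l ?invr_ge0// ler_sum.
Qed.

Lemma nuND N f g : nuN N (fun k => f k + g k) = nuN N f + nuN N g.
Proof. by rewrite /nuN big_split mulrDr. Qed.

Lemma nuNZ N c f : nuN N (fun k => c * f k) = c * nuN N f.
Proof. by rewrite /nuN -mulr_sumr; ring. Qed.

Lemma nuN_sum N (I : Type) (r : seq I) (P : pred I) (F : I -> posnat -> R) :
  nuN N (fun k => \sum_(i <- r | P i) F i k) = \sum_(i <- r | P i) nuN N (F i).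
Proof. by rewrite /nuN exchange_big mulr_sumr. Qed.

Lemma nuN_cst N c : (0 < N)%N -> nuN N (fun=> c) = c.
Proof.
move=> N0; rewrite /nuN sumr_const card_ord -[c *+ N]mulr_natl mulrA mulVf ?mul1r//.
by rewrite pnatr_eq0 -lt0n.
Qed.

Lemma nuN_ge0_fun N f : (forall k, 0 <= f k) -> 0 <= nuN N f.
Proof. by move=> f0; rewrite mulr_ge0 ?invr_ge0// sumr_ge0. Qed.

(** The upper limit of the averages, as a relation to its bounds: this needs
    no finiteness and no existence of a limit. *)
Definition umean_le f c : Prop :=
  forall e, 0 < e -> \forall N \near \oo, nuN N f <= c + e.

Lemma umean_le_trans f g c d :
  (forall k, f k <= g k) -> c <= d -> umean_le g c -> umean_le f d.
Proof.
move=> fg cd gc e /gc; apply: filterS => N gN.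
by rewrite (le_trans (ler_nuN N fg))// (le_trans gN)// lerD2r.
Qed.

Lemma umean_le_closed f c :
  (forall e, 0 < e -> umean_le f (c + e)) -> umean_le f c.
Proof.
move=> fc e e0; have e20 : 0 < e / 2 by rewrite divr_gt0.
by have := fc _ e20 _ e20; rewrite -addrA -splitr.
Qed.

Lemma umean_leD f g c d : umean_le f c -> umean_le g d ->
  umean_le (fun k => f k + g k) (c + d).
Proof.
move=> fc gd e e0; have e20 : 0 < e / 2 by rewrite divr_gt0.
near=> N; rewrite nuND [e in _ <= _ + e]splitr addrACA lerD//; near: N.
  exact: fc.
exact: gd.
Unshelve. all: by end_near. Qed.

Lemma umean_leZ f c a : 0 <= a -> umean_le f c ->
  umean_le (fun k => a * f k) (a * c).
Proof.
move=> a0 fc e e0; have ea0 : 0 < e / (a + 1) by rewrite divr_gt0// ltr_wpDl.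
near=> N; rewrite nuNZ.
have : nuN N f <= c + e / (a + 1) by near: N; exact: fc.
move=> /(ler_wpM2l a0)/le_trans; apply; rewrite mulrDr lerD2l.
rewrite mulrCA ger_pMr// ler_pdivrMr ?mul1r ?lerDl// ltr_wpDl//.
Unshelve. all: by end_near. Qed.

Lemma umean_le_cst c : umean_le (fun=> c) c.
Proof.
by move=> e e0; near=> N; rewrite nuN_cst ?lerDl ?(ltW e0)//; near: N; exists 1%N.
Unshelve. all: by end_near. Qed.

Lemma umean_le_ge0 f c : (forall k, 0 <= f k) -> umean_le f c -> 0 <= c.
Proof.
move=> f0 fc; apply/ler_addgt0Pr => e e0.
near \oo => N; apply: le_trans (nuN_ge0_fun N f0) _.
by near: N; exact: fc.
Unshelve. all: by end_near. Qed.

(** Finitely many terms contribute a fixed sum, which is divided by the length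
    of the segment. *)
Lemma umean_le_fin K f :
  (forall k, (K <= val k)%N -> f k <= 0) -> umean_le f 0.
Proof.
move=> fK e e0.
pose S := \sum_(k < K) `|f (pos_succ k)|.
have S0 : 0 <= S by exact: sumr_ge0.
near=> N; rewrite add0r /nuN.
have N0 : (0 < N)%N by near: N; exists 1%N.
rewrite mulrC ler_pdivrMr ?ltr0n//.
apply: (@le_trans _ _ S).
  have KN : (K <= N)%N by near: N; exists K.
  rewrite /S (big_ord_widen _ (fun k => `|f (pos_succ k)|) KN).
  rewrite [leLHS](bigID (fun k : 'I_N => (k < K)%N))/=.
  rewrite -[leRHS]addr0 lerD//.
    by apply: ler_sum => k _; exact: ler_norm.
  by apply: sumr_le0 => k; rewrite -leqNgt => Kk; apply: fK => /=; exact: leqW.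
rewrite -ler_pdivrMl// mulrC; near: N; exact: nbhs_infty_ger.
Unshelve. all: by end_near. Qed.

(** Finitely many points do not affect an upper mean, so a comparison is
    needed only far out. *)
Lemma umean_le_tail K f g c :
  (forall k, (K <= val k)%N -> f k <= g k) -> umean_le g c -> umean_le f c.
Proof.
move=> fg gc; have fg0 : umean_le (fun k => f k - g k) 0.
  by apply: (@umean_le_fin K) => k Kk; rewrite subr_le0 fg.
have := umean_leD fg0 gc; rewrite add0r.
by apply: umean_le_trans => // k; rewrite subrK.
Qed.

Lemma umean_cvg f l : (fun N => nuN N f) @ \oo --> l -> umean_le f l.
Proof.
move=> fl e e0; near=> N; rewrite -lerBlDl (le_trans (ler_norm _))// distrC ltW//.
near: N; exact: cvgr_dist_lt.
Unshelve. all: by end_near. Qed.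

Lemma cvg_le_umean f l c : (fun N => nuN N f) @ \oo --> l ->
  umean_le f c -> l <= c.
Proof.
move=> fl fc; apply/ler_addgt0Pr => e e0.
by apply: (cvgr_to_le fl); exact: fc.
Qed.

Lemma umean_leP f l c : (fun N => nuN N f) @ \oo --> l ->
  umean_le f c <-> l <= c.
Proof.
move=> fl; split; first exact: cvg_le_umean.
by move=> lc; apply: umean_le_trans (umean_cvg fl).
Qed.

Lemma nuE f l : (fun N => nuN N f) @ \oo --> l -> nu f = l.
Proof. exact: cvg_lim. Qed.

Lemma cvgn_nuP f c : cvgn (fun N => nuN N f) -> umean_le f c <-> nu f <= c.
Proof. exact: umean_leP. Qed.

(** Upper and lower limits of the averages of [f] and of [g] differ by at most
    the error, so the averages of [f] form a Cauchy sequence. *)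
Lemma cvgn_nu_closed f :
  (forall e, 0 < e -> exists2 g, cvgn (fun N => nuN N g)
     & umean_le (fun k => `|f k - g k|) e) ->
  cvgn (fun N => nuN N f).
Proof.
move=> fg; apply/cauchy_cvgP/cauchy_exP => e e0; rewrite /cauchy_ex /=.
have e40 : 0 < e / 4 by rewrite divr_gt0.
have [g gc fge] := fg _ e40.
exists (nu g); near=> N; rewrite /ball/=.
have gN : `|nu g - nuN N g| < e / 4 by near: N; exact: cvgr_dist_lt.
have fgN : `|nuN N g - nuN N f| <= e / 4 + e / 4.
  apply: (@le_trans _ _ (nuN N (fun k => `|f k - g k|))); last first.
    by near: N; exact: fge.
  rewrite /nuN -mulrBr -sumrB normrM ger0_norm ?invr_ge0// ler_wpM2l ?invr_ge0//.
  by apply: le_trans (ler_norm_sum _ _ _) _; apply: ler_sum => k _; rewrite distrC.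
rewrite -[nu g](subrK (nuN N g)) -addrA (le_lt_trans (ler_normD _ _))//.
by lra.
Unshelve. all: by end_near. Qed.

Lemma cvg_nuD f g a b : (fun N => nuN N f) @ \oo --> a ->
  (fun N => nuN N g) @ \oo --> b ->
  (fun N => nuN N (fun k => f k + g k)) @ \oo --> a + b.
Proof.
by move=> fa gb; under eq_fun do rewrite nuND; exact: cvgD.
Qed.

Lemma cvg_nuZ f a c : (fun N => nuN N f) @ \oo --> a ->
  (fun N => nuN N (fun k => c * f k)) @ \oo --> c * a.
Proof.
by move=> fa; under eq_fun do rewrite nuNZ; exact: cvgM (cvg_cst c) fa.
Qed.

Lemma cvg_nu_sum (n : nat) (F : 'I_n -> posnat -> R) (a : 'I_n -> R) :
  (forall i, (fun N => nuN N (F i)) @ \oo --> a i) ->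
  (fun N => nuN N (fun k => \sum_i F i k)) @ \oo --> \sum_i a i.
Proof.
move=> Fa; under eq_fun do rewrite nuN_sum.
have -> : (fun N => \sum_i nuN N (F i)) = \sum_i (fun N => nuN N (F i)).
  by apply/funext => N; rewrite fct_sumE.
elim/big_ind2 : _ => [|f a' g b fa gb|i _]; last exact: Fa.
  exact: cvg_cst.
exact: cvgD.
Qed.

End UpperMean.

(** * Upper density *)

Section Densities.
Variable R : realType.
Implicit Types (f g h : posnat -> R) (c d e : R) (E F : set posnat).

Lemma indic_ge0 E k : 0 <= \1_E k :> R.
Proof. by rewrite indicE ler0n. Qed.

Lemma indic_le1 E k : \1_E k <= 1 :> R.
Proof. by rewrite indicE lern1 leq_b1. Qed.

Lemma indic_sub E F k : (E k -> F k) -> \1_E k <= \1_F k :> R.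
Proof.
move=> EF; rewrite !indicE ler_nat; case: (asboolP (E k)) => [Ek|Ek].
  by rewrite !mem_set//; exact: EF.
by rewrite memNset.
Qed.

Definition dens_le E c : Prop := umean_le (\1_E : posnat -> R) c.

Lemma dens_le_sub E F c d : E `<=` F -> c <= d -> dens_le F c -> dens_le E d.
Proof. by move=> EF; apply: umean_le_trans => k; apply: indic_sub; exact: EF. Qed.

Lemma dens_leW E c d : c <= d -> dens_le E c -> dens_le E d.
Proof. exact: dens_le_sub. Qed.

Lemma indicU_le E F k : \1_(E `|` F) k <= \1_E k + \1_F k :> R.
Proof.
by rewrite !indicE in_setU -natrD ler_nat; case: (_ \in E); case: (_ \in F).
Qed.

Lemma dens_leU E F c d : dens_le E c -> dens_le F d -> dens_le (E `|` F) (c + d).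
Proof.
move=> Ec Fd; have := umean_leD Ec Fd; apply: umean_le_trans => // k.
exact: indicU_le.
Qed.

Lemma dens_le1 E : dens_le E 1.
Proof.
by apply: umean_le_trans (umean_le_cst 1) => // k; exact: indic_le1.
Qed.

Lemma dens_le_ge0 E c : dens_le E c -> 0 <= c.
Proof. by apply: umean_le_ge0 => k; exact: indic_ge0. Qed.

Lemma dens_le_eq0 E : (forall e, 0 < e -> dens_le E e) -> dens_le E 0.
Proof. by move=> E0; apply: umean_le_closed => e; rewrite add0r; exact: E0. Qed.

Lemma null_dens E : nullN R E <-> dens_le E 0.
Proof.
rewrite nullNP; split; first exact: umean_cvg.
move=> E0; apply/cvgrPdist_le => e e0; near=> N.
rewrite sub0r normrN ger0_norm ?nuN_ge0// -[e]add0r.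
by near: N; exact: E0.
Unshelve. all: by end_near. Qed.

Lemma dens_leP E c : densF R E -> dens_le E c <-> nu_set R E <= c.
Proof. exact: cvgn_nuP. Qed.

Lemma nu_set_ge0 E : densF R E -> 0 <= nu_set R E.
Proof. by move=> EF; apply: (@dens_le_ge0 E); exact/dens_leP. Qed.

Lemma umean_le_split f a K E d : 0 <= a -> 0 <= K ->
  (forall k, ~ E k -> f k <= a) -> (forall k, E k -> f k <= K) ->
  dens_le E d -> umean_le f (a + K * d).
Proof.
move=> a0 K0 fa fK Ed.
have := umean_leD (umean_le_cst a) (umean_leZ K0 Ed).
apply: umean_le_trans => // k; rewrite indicE; case: (asboolP (E k)) => Ek.
  by rewrite mem_set// mulr1 (le_trans (fK _ Ek))// lerDr.
by rewrite memNset// mulr0 addr0 fa.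
Qed.

Lemma dens_le_markov f c t : (forall k, 0 <= f k) -> 0 < t -> umean_le f c ->
  dens_le [set k | t < f k] (c / t).
Proof.
move=> f0 t0 fc; have ti : 0 <= t^-1 by rewrite invr_ge0 ltW.
have := umean_leZ ti fc; rewrite mulrC; apply: umean_le_trans => // k.
rewrite indicE; case: (asboolP (t < f k)) => tf.
  by rewrite mem_set// mulrC ler_pdivlMr// mul1r ltW.
by rewrite memNset// mulr_ge0.
Qed.

(** Equality to zero almost everywhere, with upper density in the place of an
    outer charge. *)
Definition negl h : Prop := forall e, 0 < e -> dens_le [set k | e < `|h k|] 0.

(** The metric of Ky Fan, which metrizes convergence in measure, with upper
    density in the place of the measure. *)
Definition kyfan e f g : Prop := dens_le [set k | e < `|f k - g k|] e.

Lemma kyfanW d e f g : d <= e -> kyfan d f g -> kyfan e f g.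
Proof.
by move=> de; apply: dens_le_sub => // k /=; exact: le_lt_trans.
Qed.

Lemma kyfan_sym e f g : kyfan e f g -> kyfan e g f.
Proof. by apply: dens_le_sub => // k /=; rewrite distrC. Qed.

Lemma ltr_distD_split (x y z a b : R) : a + b < `|x - z| ->
  a < `|x - y| \/ b < `|y - z|.
Proof.
move=> ab; have [|xy] := ltP a `|x - y|; [by left|right].
have : `|x - z| <= `|x - y| + `|y - z| by rewrite -[x - z](subrKA y) ler_normD.
by lra.
Qed.

(** If the sum of two distances exceeds [a + b], one of them exceeds its
    share. *)
Lemma kyfan_trans a b f g h : kyfan a f g -> kyfan b g h ->
  kyfan (a + b) f h.
Proof.
move=> fg gh; apply: dens_le_sub (dens_leU fg gh) => // k /= /ltr_distD_split.
exact.
Qed.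

Definition kyfan_cvg (u : nat -> posnat -> R) f : Prop :=
  forall e, 0 < e -> exists M : nat, forall n, (M <= n)%N -> kyfan e (u n) f.

Definition kyfan_cauchy (u : nat -> posnat -> R) : Prop :=
  forall e, 0 < e -> exists M : nat, forall n m, (M <= n)%N -> (M <= m)%N ->
    kyfan e (u n) (u m).

Lemma kyfan_negl f g : (forall e, 0 < e -> kyfan e f g) ->
  negl (fun k => f k - g k).
Proof.
move=> fg e e0; apply: dens_le_eq0 => d d0.
have : 0 < Num.min d e by rewrite lt_min d0.
move=> /fg; apply: dens_le_sub => [k/=|]; last by rewrite ge_min lexx.
by apply: le_lt_trans; rewrite ge_min lexx orbT.
Qed.

End Densities.

(** * Gluing along blocks *)

Section Gluing.
Variable R : realType.
Implicit Types (f g h : posnat -> R) (c d e : R) (E F : set posnat).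

Lemma eq_nuN N f g : (forall k, (val k <= N)%N -> f k = g k) ->
  nuN N f = nuN N g.
Proof.
move=> fg; rewrite /nuN; congr (_ * _); apply: eq_bigr => k _.
by apply: fg => /=; exact: ltn_ord.
Qed.

Lemma sum_geometric_half_le (m n : nat) :
  \sum_(m <= j < n) (2^-1 : R) ^+ j <= 2 * 2^-1 ^+ m.
Proof.
have [nm|mn] := leqP n m; first by rewrite big_geq// mulr_ge0// exprn_ge0.
suff -> : \sum_(m <= j < n) (2^-1 : R) ^+ j = 2 * 2^-1 ^+ m - 2 * 2^-1 ^+ n.
  by rewrite gerBl mulr_ge0.
rewrite -[RHS]opprB -(telescope_sumr (fun j => 2 * 2^-1 ^+ j)) ?(ltnW mn)// -sumrN.
by apply: eq_bigr => j _; rewrite exprS; field.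
Qed.

Lemma exists_half_pow_le c e : 0 < e -> exists m : nat, c * 2^-1 ^+ m <= e.
Proof.
move=> e0; have [c0|c0] := leP c 0.
  by exists 0%N; rewrite expr0 mulr1 (le_trans c0)// ltW.
have h1 : `|2^-1 : R| < 1 by rewrite ger0_norm// invf_lt1// ltr1n.
have /cvgrPdist_le/(_ _ (divr_gt0 e0 c0)) := cvg_expr h1.
case=> m _ /(_ m (leqnn m)); rewrite /= sub0r normrN ger0_norm ?exprn_ge0 ?invr_ge0//.
by move=> mc; exists m; rewrite mulrC -ler_pdivlMr.
Qed.

(** The index [i k] is the first [j] below [k] for which the average of [w j]
    over some initial segment reaching at least to [k] is still large, and [k]
    if there is none. Every [w j] that has been started before the end of a
    segment therefore has a small average over that segment, and the geometric
    series adds these averages up. *)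
Lemma block_gluing (w : nat -> posnat -> R) :
  (forall j k, 0 <= w j k) -> (forall j, umean_le (w j) (2^-1 ^+ j)) ->
  exists i : posnat -> nat,
    (forall m, exists K, forall k, (K <= val k)%N -> (m <= i k)%N) /\
    (forall m, umean_le (fun k => \sum_(m <= j < i k) w j k) (4 * 2^-1 ^+ m)).
Proof.
move=> w0 wj.
pose good j (k : nat) := `[< forall N, (k <= N)%N ->
  nuN N (w j) <= 2 * 2^-1 ^+ j >].
pose i (k : posnat) := find (fun j => ~~ good j (val k)) (iota 0 (val k)).
have ik k : (i k <= val k)%N.
  by rewrite (leq_trans (find_size _ _))// size_iota.
have igood j k : (j < i k)%N -> good j (val k).
  move=> jk; have := before_find 0%N jk => /negbFE.
  by rewrite nth_iota// (leq_trans jk).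
exists i; split=> m.
  have [K gK] : exists K, forall j, (j < m)%N -> good j K.
    elim: m => [|m [K gK]]; first by exists 0%N.
    have h0 : 0 < (2^-1 : R) ^+ m by rewrite exprn_gt0// invr_gt0.
    have [K' _ gK'] := wj m _ h0.
    exists (maxn K K') => j; rewrite ltnS leq_eqVlt => /predU1P[->|jm].
      apply/asboolP => N; rewrite geq_max => /andP[_ KN].
      by rewrite mulr_natl mulr2n; exact: gK'.
    apply/asboolP => N; rewrite geq_max => /andP[KN _].
    by have /asboolP := gK _ jm; exact.
  exists (maxn K m) => k; rewrite geq_max => /andP[Kk mk].
  rewrite leqNgt; apply/negP => ikm.
  have ik' : (i k < val k)%N by exact: leq_trans mk.
  have : has (fun j => ~~ good j (val k)) (iota 0 (val k)).
    by rewrite has_find size_iota.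
  move=> /(nth_find 0%N); rewrite -/(i k) nth_iota// add0n => /negP; apply.
  apply/asboolP => N kN; have /asboolP := gK _ ikm; apply.
  exact: leq_trans kN.
move=> e e0; near=> N.
pose v j k := if (j < i k)%N then w j k else 0.
have -> : nuN N (fun k => \sum_(m <= j < i k) w j k) =
    \sum_(m <= j < N) nuN N (v j).
  rewrite -nuN_sum; apply: eq_nuN => k kN.
  rewrite (big_nat_widen _ _ N) ?(leq_trans (ik k))// big_mkcond.
  by apply: eq_bigr.
have : \sum_(m <= j < N) nuN N (v j) <= \sum_(m <= j < N) 2 * 2^-1 ^+ j.
  apply: ler_sum => j _.
  have [[k [kN jk]]|nk] := pselect (exists k, (val k <= N)%N /\ (j < i k)%N).
    have /asboolP/(_ N kN) := igood _ _ jk; apply: le_trans.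
    by apply: ler_nuN => k'; rewrite /v; case: ifPn.
  rewrite (@eq_nuN _ _ (fun=> 0)) /nuN ?big1 ?mulr0 ?mulr_ge0 ?exprn_ge0 ?invr_ge0//.
  by move=> k kN; rewrite /v; case: ifPn => // jk; exfalso; apply: nk; exists k.
move=> /le_trans; apply; rewrite -mulr_sumr.
have := sum_geometric_half_le m N.
move=> /(@ler_wpM2l _ 2 _); lra.
Unshelve. all: by end_near. Qed.
End Gluing.

(** * Completeness for upper density *)

Section HazyCompleteness.
Variable R : realType.
Implicit Types (f g h : posnat -> R) (c d e : R) (E F : set posnat).
Implicit Types u : nat -> posnat -> R.

Lemma dist_gt_chain (s : nat -> posnat -> R) (m n : nat) k : (m <= n)%N ->
  2 * 2^-1 ^+ m < `|s m k - s n k| ->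
  exists2 j, (m <= j < n)%N & 2^-1 ^+ j < `|s j k - s j.+1 k|.
Proof.
move=> mn h; apply: contrapT => nD; move: h; apply/negP; rewrite -leNgt.
have -> : s m k - s n k = \sum_(m <= j < n) (s j k - s j.+1 k).
  rewrite -[LHS]opprB -(telescope_sumr (fun j => s j k)) // -sumrN.
  by apply: eq_bigr => j _; rewrite opprB.
apply: le_trans (ler_norm_sum _ _ _) _.
apply: le_trans _ (sum_geometric_half_le _ m n).
rewrite big_nat_cond [leRHS]big_nat_cond; apply: ler_sum => j /andP[mj _].
by rewrite leNgt; apply/negP => Dj; apply: nD; exists j.
Qed.

(** The limit follows the term of index [i k] at [k]; it is far from [u m]
    only where one of the intermediate jumps is large, and [block_gluing]
    bounds the upper density of these places. *)
Lemma kyfan_cauchy_fast u :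
  (forall j, kyfan (2^-1 ^+ j) (u j) (u j.+1)) ->
  exists f, forall m, kyfan (4 * 2^-1 ^+ m) (u m) f.
Proof.
move=> uj.
pose D j := [set k | 2^-1 ^+ j < `|u j k - u j.+1 k|].
have D0 j k : 0 <= \1_(D j) k :> R by exact: indic_ge0.
have [i [ioo isum]] := block_gluing D0 uj.
exists (fun k => u (i k) k) => m; have [K Kk] := ioo m.
apply: (@umean_le_tail _ K) (isum m) => k /Kk mi.
rewrite [leLHS]indicE; case: (asboolP (4 * 2^-1 ^+ m < `|u m k - u (i k) k|)); last first.
  by move=> h; rewrite memNset// sumr_ge0// => j _; exact: indic_ge0.
move=> h; rewrite mem_set//=.
have [|j /andP[mj ji] Dj] := @dist_gt_chain u m (i k) k mi.
  by apply: le_lt_trans h; rewrite ler_wpM2r ?exprn_ge0// ler_nat.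
rewrite (big_rem j) ?mem_index_iota ?mj//= indicE mem_set// lerDl.
by rewrite sumr_ge0// => l _; exact: indic_ge0.
Qed.

(** A Cauchy sequence has a fast subsequence, and converges where that one
    does. *)
Lemma kyfan_cauchy_cvg u : kyfan_cauchy u -> exists f, kyfan_cvg u f.
Proof.
move=> uc.
have /choice[M MP] : forall j, exists M : nat, forall n m, (M <= n)%N ->
    (M <= m)%N -> kyfan (2^-1 ^+ j) (u n) (u m).
  by move=> j; apply: uc; rewrite exprn_gt0.
(* The maximum makes the chosen indices nondecreasing. *)
pose phi j := \max_(l < j.+1) M l.
have Mphi j : (M j <= phi j)%N by exact: (leq_bigmax (@ord_max j)).
have phiS j : (phi j <= phi j.+1)%N by rewrite {2}/phi big_ord_recr leq_maxl.
have [f fP] : exists f, forall m, kyfan (4 * 2^-1 ^+ m) (u (phi m)) f.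
  apply: (@kyfan_cauchy_fast (fun j => u (phi j))) => j.
  by apply: MP => //; exact: leq_trans (phiS j).
exists f => e e0; have [m me] := exists_half_pow_le 5 e0.
exists (phi m) => n mn; apply: kyfanW me _.
rewrite [5](_ : _ = 1 + 4); last by ring.
rewrite mulrDl mul1r; apply: kyfan_trans (fP m).
by apply: MP => //; exact: leq_trans mn.
Qed.

Lemma in_setY E F k : (k \in E `+` F) = (k \in E) (+) (k \in F).
Proof. by rewrite setY_def in_setU !in_setD; case: (k \in E); case: (k \in F). Qed.

Lemma indic_dist E F k : `|\1_E k - \1_F k| = \1_(E `+` F) k :> R.
Proof.
rewrite !indicE in_setY; case: (k \in E); case: (k \in F) => /=;
by rewrite ?subrr ?subr0 ?sub0r ?normrN ?normr0 ?normr1.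
Qed.

Lemma kyfan_indic E F e : dens_le (E `+` F) e -> kyfan e \1_E \1_F.
Proof.
move=> EF; have e0 := dens_le_ge0 EF; apply: dens_le_sub EF => // k /=.
rewrite indic_dist indicE; case: (boolP (k \in _)) => [/set_mem//|_].
by rewrite ltNge e0.
Qed.

(** Convergence for the pseudometric given by the upper density of symmetric
    differences. *)
Definition dens_cvg (E : nat -> set posnat) F : Prop :=
  forall e : R, 0 < e -> exists M : nat, forall n, (M <= n)%N -> dens_le (E n `+` F) e.

(** Indicators of a Cauchy sequence of sets converge to a function, which is
    close to an indicator; a level set of it is the limit. *)
Lemma dens_cauchy_cvg (E : nat -> set posnat) :
  (forall e : R, 0 < e -> exists M : nat, forall n m, (M <= n)%N -> (M <= m)%N ->
     dens_le (E n `+` E m) e) -> exists F, dens_cvg E F.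
Proof.
move=> Ec; have [e e0|f fP] := @kyfan_cauchy_cvg (fun n => \1_(E n)).
  have [M MP] := Ec _ e0; exists M => n m Mn Mm.
  by apply: kyfan_indic; exact: MP.
exists [set k | 2^-1 < f k] => e e0.
have q0 : 0 < Num.min e 4^-1 by rewrite lt_min e0/= invr_gt0.
have [M MP] := fP _ q0; exists M => n /MP.
apply: dens_le_sub => [k|]; last by rewrite ge_min lexx.
rewrite setY_def /= => h.
apply: (@le_lt_trans _ _ 4^-1); first by rewrite ge_min lexx orbT.
case: h => [[Ek /negP]|[fk Ek]].
  rewrite -leNgt indicE mem_set//= => fk.
  by rewrite (lt_le_trans _ (ler_norm _))//; lra.
by rewrite indicE memNset//= sub0r normrN (lt_le_trans _ (ler_norm _))//; lra.
Qed.

Lemma dens_cvg_lb (E : nat -> set posnat) F B n : dens_cvg E F ->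
  (forall m, (n <= m)%N -> dens_le (B `\` E m) (0 : R)) -> dens_le (B `\` F) (0 : R).
Proof.
move=> EF BE; apply: dens_le_eq0 => e /EF[M MP].
have := dens_leU (BE _ (leq_maxl n M)) (MP _ (leq_maxr n M)); rewrite add0r.
apply: dens_le_sub => // k; rewrite setY_def /=.
by have := pselect (E (maxn n M) k); tauto.
Qed.

Lemma dens_cvg_ub (E : nat -> set posnat) F B n : dens_cvg E F ->
  (forall m, (n <= m)%N -> dens_le (E m `\` B) (0 : R)) -> dens_le (F `\` B) (0 : R).
Proof.
move=> EF BE; apply: dens_le_eq0 => e /EF[M MP].
have := dens_leU (BE _ (leq_maxl n M)) (MP _ (leq_maxr n M)); rewrite add0r.
apply: dens_le_sub => // k; rewrite setY_def /=.
by have := pselect (E (maxn n M) k); tauto.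
Qed.

Lemma xi_dens_le E F : (xi R E <= xi R F)%O <-> dens_le (E `\` F) (0 : R).
Proof. by rewrite xi_le null_dens. Qed.

(** Upper bounds in the quotient algebra are stable under limits in upper
    density, in both directions: the limit is above the terms and below every
    upper bound. *)
Lemma dens_cvg_supremums (E : nat -> set posnat) F :
  nondecreasing_seq (fun n => xi R (E n)) -> dens_cvg E F ->
  supremums (range (fun n => xi R (E n))) (xi R F).
Proof.
move=> Ei EF; split=> [_ [n _ <-]|].
  by apply/xi_dens_le; apply: (dens_cvg_lb (n := n) EF) => m /Ei/xi_dens_le.
elim/densAlg_ind => B ubB; apply/xi_dens_le; apply: (dens_cvg_ub (n := 0) EF) => m _.
by apply/xi_dens_le; apply: ubB; exists m.
Qed.

Lemma dens_cvg_infimums (E : nat -> set posnat) F :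
  nonincreasing_seq (fun n => xi R (E n)) -> dens_cvg E F ->
  infimums (range (fun n => xi R (E n))) (xi R F).
Proof.
move=> Ei EF; split=> [_ [n _ <-]|].
  by apply/xi_dens_le; apply: (dens_cvg_ub (n := n) EF) => m /Ei/xi_dens_le.
elim/densAlg_ind => B ubB; apply/xi_dens_le; apply: (dens_cvg_lb (n := 0) EF) => m _.
by apply/xi_dens_le; apply: ubB; exists m.
Qed.

(** Existence of the two densities makes upper density additive here. *)
Lemma dens_le_diff E F : densF R E -> densF R F -> dens_le (E `\` F) (0 : R) ->
  dens_le (F `\` E) (nu_set R F - nu_set R E).
Proof.
move=> EF FF EF0.
have hE : (fun N => nuN N (fun k => (-1) * \1_E k)) @ \oo --> -1 * nu_set R E.
  exact: cvg_nuZ.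
have := umean_leD (umean_leD (umean_cvg FF) (umean_cvg hE)) EF0.
rewrite mulN1r addr0; apply: umean_le_trans => // k; rewrite mulN1r.
by rewrite !indicE !in_setD; case: (k \in E); case: (k \in F) => /=; lra.
Qed.

(** The densities increase and are bounded, hence are Cauchy, and they measure
    the distances of the sets. *)
Lemma nondecreasing_dens_cvg (E : nat -> set posnat) :
  (forall n, densF R (E n)) -> nondecreasing_seq (fun n => xi R (E n)) ->
  exists F, dens_cvg E F.
Proof.
move=> EF Ei; have Emn n m : (n <= m)%N -> dens_le (E n `\` E m) (0 : R).
  by move=> /Ei/xi_dens_le.
have nuE n m : (n <= m)%N -> nu_set R (E n) <= nu_set R (E m).
  move=> nm; rewrite -subr_ge0.
  exact: dens_le_ge0 (dens_le_diff (EF n) (EF m) (Emn _ _ nm)).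
have cE : cvgn (fun n => nu_set R (E n)).
  apply: nondecreasing_is_cvgn => //; exists 1 => _ [n _ <-].
  by apply/dens_leP => //; exact: dens_le1.
apply: dens_cauchy_cvg => e e0.
have /cvgrPdist_le/(_ _ e0)[M _ MP] := cE.
have key n m : (M <= n)%N -> (n <= m)%N -> dens_le (E n `+` E m) e.
  move=> Mn nm; have := dens_leU (Emn _ _ nm) (dens_le_diff (EF n) (EF m) (Emn _ _ nm)).
  rewrite add0r; apply: dens_le_sub => [k|]; first by rewrite setY_def.
  have /= := MP _ Mn; apply: le_trans.
  rewrite (le_trans _ (ler_norm _))// lerD2r.
  by apply: (@nondecreasing_cvgn_le _ (fun n => nu_set R (E n))).
exists M => n m Mn Mm; have /orP[nm|mn] := leq_total n m; first exact: key.
by rewrite setYC; exact: key.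
Qed.

Lemma setYCC E F : ~` E `+` ~` F = E `+` F.
Proof.
apply/seteqP; split=> k; rewrite !setY_def /=; have := pselect (E k);
  have := pselect (F k); tauto.
Qed.

Lemma nonincreasing_dens_cvg (E : nat -> set posnat) :
  (forall n, densF R (E n)) -> (forall n, densF R (~` E n)) ->
  nonincreasing_seq (fun n => xi R (E n)) ->
  exists F, dens_cvg E F.
Proof.
move=> EF ECF Ei; have [//|n m nm|F FP] := @nondecreasing_dens_cvg (fun n => ~` E n).
  apply/xi_dens_le; have /xi_dens_le := Ei _ _ nm.
  by apply: dens_le_sub => // k /= [+ /contrapT].
by exists (~` F) => e /FP[M MP]; exists M => n /MP; rewrite -setYCC setCK.
Qed.

End HazyCompleteness.

(** * The density closure of a field of sets *)

Section DensityClosure.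
Variable R : realType.
Implicit Types (c d e : R) (A : set (set posnat)) (E F : set posnat).

(** The topological closure of a field for the pseudometric of upper density.
    It is identified with [lambda R A] in [lambdaE]. *)
Definition dens_cl A : set (set posnat) :=
  [set E | forall e : R, 0 < e -> exists2 B, A B & dens_le (E `+` B) e].

Lemma sub_dens_cl A : A `<=` dens_cl A.
Proof.
move=> E AE e e0; exists E; rewrite // setYK; apply: dens_leW (ltW e0) _.
exact/null_dens/nullN0.
Qed.

Lemma setY_triangle E F B : E `+` B `<=` (E `+` F) `|` (F `+` B).
Proof. move=> k; rewrite !setY_def /=; have := pselect (F k); tauto. Qed.

Lemma dens_cl_approx A E : (forall e : R, 0 < e -> exists2 B, dens_cl A B &
  dens_le (E `+` B) e) -> dens_cl A E.
Proof.
move=> EB e e0; have e20 : 0 < e / 2 by rewrite divr_gt0.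
have [B BA EBe] := EB _ e20; have [C CA BCe] := BA _ e20; exists C => //.
rewrite [e]splitr; apply: dens_le_sub (dens_leU EBe BCe) => //.
exact: setY_triangle.
Qed.

Lemma dens_cl_null A E F : dens_le (E `+` F) (0 : R) -> dens_cl A F -> dens_cl A E.
Proof.
move=> EF FA; apply: dens_cl_approx => e e0; exists F => //.
exact: dens_leW (ltW e0) EF.
Qed.

Lemma dens_cl_dens_cvg A (E : nat -> set posnat) F :
  (forall n, dens_cl A (E n)) -> dens_cvg R E F -> dens_cl A F.
Proof.
move=> EA EF; apply: dens_cl_approx => e /EF[M /(_ M (leqnn M)) EMF].
by exists (E M) => //; rewrite setYC.
Qed.

Lemma dens_cl_densF A : A `<=` densF R -> dens_cl A `<=` densF R.
Proof.
move=> AF E EA; apply: cvgn_nu_closed => e /EA[B /AF BF EB].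
exists \1_B => //; apply: umean_le_trans EB => // k.
by rewrite indic_dist.
Qed.

Lemma dens_cl_field A : set_field A -> set_field (dens_cl A).
Proof.
move=> [A0 AC AU]; split; first exact: sub_dens_cl.
  by move=> E EA e /EA[B /AC AB EB]; exists (~` B); rewrite // setYCC.
move=> E F EA FA e e0; have e20 : 0 < e / 2 by rewrite divr_gt0.
have [B AB EB] := EA _ e20; have [C CA FC] := FA _ e20.
exists (B `|` C); first exact: AU.
rewrite [e]splitr; apply: dens_le_sub (dens_leU EB FC) => // k.
rewrite !setY_def /=; have := pselect (E k); have := pselect (F k).
have := pselect (B k); have := pselect (C k); tauto.
Qed.

(** Monotone sequences of sets with a density converge in upper density, and
    the limit is their supremum or infimum. *)
Lemma dens_cl_xi_monotone A : set_field A -> A `<=` densF R ->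
  monotone_class (xi R @` dens_cl A).
Proof.
move=> fA AF.
have [c0 cC cU] := dens_cl_field fA; have clF := dens_cl_densF AF.
have lift (u : nat -> densAlg R) : (forall n, (xi R @` dens_cl A) (u n)) ->
    exists2 E : nat -> set posnat, (forall n, dens_cl A (E n)) &
      u = fun n => xi R (E n).
  move=> uA; have /choice[E EP] : forall n, exists E, dens_cl A E /\ xi R E = u n.
    by move=> n; have [E EA <-] := uA n; exists E.
  exists E => [n|]; first by have [] := EP n.
  by apply/funext => n; have [_ <-] := EP n.
split=> u ui /lift[E EA uE].
  have [n|n m nm|F EF] := @nondecreasing_dens_cvg R E.
  - exact/clF/EA.
  - by have := ui _ _ nm; rewrite uE.
  exists (xi R F); first by exists F => //; exact: dens_cl_dens_cvg EF.
  by rewrite uE; apply: dens_cvg_supremums EF; rewrite -uE.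
have [n|n|n m nm|F EF] := @nonincreasing_dens_cvg R E.
- exact/clF/EA.
- exact/clF/cC/EA.
- by have := ui _ _ nm; rewrite uE.
exists (xi R F); first by exists F => //; exact: dens_cl_dens_cvg EF.
by rewrite uE; apply: dens_cvg_infimums EF; rewrite -uE.
Qed.

Lemma supremums_uniq (d : Order.disp_t) (T : porderType d) (S : set T) a b :
  supremums S a -> supremums S b -> a = b.
Proof.
by move=> [ua la] [ub lb]; apply/eqP; rewrite eq_le la//= lb.
Qed.

Lemma infimums_uniq (d : Order.disp_t) (T : porderType d) (S : set T) a b :
  infimums S a -> infimums S b -> a = b.
Proof.
by move=> [ua la] [ub lb]; apply/eqP; rewrite eq_le lb//= la.
Qed.

(** A set [E] of the closure is the upper limit of a sequence of sets of [A]
    at summable distances: it is the infimum of the suprema of the tails, each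
    of them the supremum of an increasing sequence of finite unions. So every
    monotone class that contains the classes of [A] contains the class of [E]. *)
Lemma lambdaE A : set_field A -> A `<=` densF R -> lambda R A = dens_cl A.
Proof.
move=> fA AF; apply/seteqP; split=> E.
  move=> /(_ (xi R @` dens_cl A))[].
    split; first exact: dens_cl_xi_monotone.
    by apply: image_subset; exact: sub_dens_cl.
  by move=> F FA /xiP/null_dens FE; apply: dens_cl_null FA; rewrite setYC.
move=> EA M [[Msup Minf] AM].
have [c0 cC cU] := dens_cl_field fA; have clF := dens_cl_densF AF.
have [A0 AC AU] := fA.
have /choice[B BP] : forall n, exists B, A B /\ dens_le (E `+` B) ((2^-1 : R) ^+ n).
  by move=> n; have [|B AB EB] := EA (2^-1 ^+ n); [rewrite exprn_gt0|exists B].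
pose D n k := \bigcup_(j in [set j | (n <= j <= n + k)%N]) B j.
have DS n k : D n k.+1 = D n k `|` B (n + k.+1)%N.
  apply/seteqP; split=> x.
    move=> [j /= /andP[nj]]; rewrite leq_eqVlt => /predU1P[->|jk]; first by right.
    by move=> Bj; left; exists j => //=; rewrite nj -ltnS -addnS.
  move=> [[j /= /andP[nj jk] Bj]|Bx].
    by exists j => //=; rewrite nj (leq_trans jk)// leq_add2l.
  by exists (n + k.+1)%N => //=; rewrite leq_addr leqnn.
have D0 n : D n 0%N = B n.
  apply/seteqP; split=> x; last by move=> Bx; exists n; rewrite //= addn0 leqnn.
  by move=> [j /=]; rewrite addn0 -eqn_leq => /eqP <-.
have DA n k : A (D n k).
  elim: k => [|k IH]; first by rewrite D0; have [] := BP n.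
  by rewrite DS; apply: AU => //; have [] := BP (n + k.+1)%N.
have DE n k : dens_le (D n k `+` E) (2 * (2^-1 : R) ^+ n).
  suff : dens_le (D n k `+` E) (\sum_(n <= j < (n + k).+1) (2^-1 : R) ^+ j).
    by apply: dens_leW; exact: sum_geometric_half_le.
  elim: k => [|k IH].
    by rewrite D0 addn0 big_nat1 setYC; have [] := BP n.
  rewrite addnS big_nat_recr ?leqW ?leq_addr//= DS.
  have [_ EB] := BP (n + k.+1)%N; rewrite addnS in EB.
  apply: dens_le_sub (dens_leU IH EB) => // x.
  rewrite addnS !setY_def /=; have := pselect (E x); have := pselect (D n k x).
  by have := pselect (B (n + k).+1 x); tauto.
have Dmono n : nondecreasing_seq (fun k => xi R (D n k)).
  apply/nondecreasing_seqP => k; apply/xi_dens_le.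
  rewrite DS (_ : _ `\` _ = set0); first exact/null_dens/nullN0.
  by apply/seteqP; split=> x //= [Dx nDx]; apply: nDx; left.
have /choice[S SP] : forall n, exists S, [/\ M (xi R S),
    supremums (range (fun k => xi R (D n k))) (xi R S) &
    dens_le (S `+` E) (3 * (2^-1 : R) ^+ n)].
  move=> n; have [S DS'] := nondecreasing_dens_cvg (fun k => AF _ (DA n k)) (Dmono n).
  have sS := dens_cvg_supremums (Dmono n) DS'.
  exists S; split => //.
    have [|s Ms /supremums_uniq/(_ sS) <- //] := Msup _ (Dmono n).
    by move=> k; apply: AM; exists (D n k).
  have n0 : 0 < (2^-1 : R) ^+ n by rewrite exprn_gt0.
  have [k /(_ k (leqnn k)) DSk] := DS' _ n0.
  rewrite setYC in DSk.
  rewrite [3](_ : _ = 1 + 2); last by ring.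
  rewrite mulrDl mul1r; apply: dens_le_sub (dens_leU DSk (DE n k)) => //.
  exact: setY_triangle.
have SE : dens_cvg R S E.
  move=> e e0; have [m me] := exists_half_pow_le 3 e0; exists m => n mn.
  have [_ _] := SP n; apply: dens_leW; apply: le_trans me.
  by rewrite ler_wpM2l// ler_wiXn2l// ?invr_ge0// invf_le1// ler1n.
have Smono : nonincreasing_seq (fun n => xi R (S n)).
  apply/nonincreasing_seqP => n; have [_ [_ ls] _] := SP n.+1; apply: ls.
  move=> _ [k _ <-]; have [_ [us _] _] := SP n.
  apply: le_trans (us _ (imageP _ (I : setT k.+1))).
  apply/xi_dens_le; rewrite (_ : _ `\` _ = set0); first exact/null_dens/nullN0.
  apply/seteqP; split=> x //= [[j /= /andP[nj jk] Bj]]; apply; exists j => //=.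
  by rewrite (ltnW nj) addnS -addSn.
have [|t Mt /infimums_uniq/(_ (dens_cvg_infimums Smono SE)) <- //] := Minf _ Smono.
by move=> n; have [] := SP n.
Qed.

End DensityClosure.

(** * Completions of fields of sets *)

Section SetFields.
Variable T : Type.
Implicit Types (C : set (set T)) (E F : set T).

Lemma field_setI C E F : set_field C -> C E -> C F -> C (E `&` F).
Proof.
by move=> [_ CC CU] CE CF; rewrite -[_ `&` _]setCK setCI; apply/CC/CU; exact: CC.
Qed.

Lemma field_setT C : set_field C -> C setT.
Proof. by move=> [C0 CC _]; rewrite -setC0; exact: CC. Qed.

Lemma field_setD C E F : set_field C -> C E -> C F -> C (E `\` F).
Proof.
by move=> fC CE CF; rewrite setDE; apply: field_setI => //; have [_ CC _] := fC; exact: CC.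
Qed.

Lemma field_bigcup C (I : choiceType) (D : set I) (E : I -> set T) :
  set_field C -> finite_set D -> (forall i, D i -> C (E i)) ->
  C (\bigcup_(i in D) E i).
Proof.
move=> [C0 _ CU] /finite_fsetP[X ->] CE; rewrite bigcup_fset.
rewrite big_seq; elim/big_ind : _ => // i Xi; exact: CE.
Qed.

End SetFields.

Section Completions.
Variable R : realType.
Implicit Types (c d e : R) (A C : set (set posnat)) (E F : set posnat).

(** The bound on the density of the difference may be weak and stated with
    upper density, because the difference lies in the field. *)
Lemma PJ_completionP C E : set_field C -> C `<=` densF R ->
  PJ_completion R C E <-> forall e : R, 0 < e -> exists B D : set posnat,
    [/\ C B, C D, B `<=` E, E `<=` D & dens_le (D `\` B) e].
Proof.
move=> fC CF; split=> PE e e0.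
  have [B [D [CB CD BE ED DB]]] := PE e e0; exists B, D; split => //.
  by apply/dens_leP; [apply: CF; exact: field_setD|exact: ltW].
have e20 : 0 < e / 2 by rewrite divr_gt0.
have [B [D [CB CD BE ED DB]]] := PE _ e20; exists B, D; split => //.
have /dens_leP := DB; move=> /(_ (CF _ (field_setD fC CD CB))) /le_lt_trans; apply.
by rewrite ltr_pdivrMr// ltr_pMr// ltr1n.
Qed.

Lemma sub_PJ_completion C : set_field C -> C `<=` densF R ->
  C `<=` PJ_completion R C.
Proof.
move=> fC CF E CE; apply/PJ_completionP => // e e0; exists E, E; split => //.
by rewrite setDv; apply: (dens_leW (ltW e0)); exact/null_dens/nullN0.
Qed.

Lemma PJ_completionS C D : C `<=` D ->
  PJ_completion R C `<=` PJ_completion R D.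
Proof.
move=> CD E CE e e0; have [B1 [B2 [CB1 CB2 ? ? ?]]] := CE e e0.
by exists B1, B2; split => //; exact: CD.
Qed.

Lemma PJ_completion_field C : set_field C -> C `<=` densF R ->
  set_field (PJ_completion R C).
Proof.
move=> fC CF; have [C0 CC CU] := fC; split.
- exact: sub_PJ_completion.
- move=> E /(PJ_completionP _ fC CF) EP; apply/PJ_completionP => // e e0.
  have [B [D [CB CD BE ED DB]]] := EP e e0; exists (~` D), (~` B).
  split; [exact: CC|exact: CC|exact: subsetC|exact: subsetC|].
  by apply: dens_le_sub DB => // k /= [nBk /contrapT Dk].
- move=> E F /(PJ_completionP _ fC CF) EP /(PJ_completionP _ fC CF) FP.
  apply/PJ_completionP => // e e0; have e20 : 0 < e / 2 by rewrite divr_gt0.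
  have [B1 [D1 [CB1 CD1 BE1 ED1 DB1]]] := EP _ e20.
  have [B2 [D2 [CB2 CD2 BE2 ED2 DB2]]] := FP _ e20.
  exists (B1 `|` B2), (D1 `|` D2).
  split; [exact: CU|exact: CU|exact: setUSS|exact: setUSS|].
  rewrite [e]splitr; apply: dens_le_sub (dens_leU DB1 DB2) => // k /=; tauto.
Qed.

Lemma PJ_completion_sub_dens_cl C : set_field C -> C `<=` densF R ->
  PJ_completion R C `<=` dens_cl R C.
Proof.
move=> fC CF E /(PJ_completionP _ fC CF) EP e /EP[B [D [CB CD BE ED DB]]].
exists B => //; apply: dens_le_sub DB => // k; rewrite setY_def /= => -[[/ED//]|].
by move=> [/BE].
Qed.

(** A closed class of sets has nothing left to complete: the approximation
    from inside is an approximation in upper density. *)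
Lemma PJ_completion_dens_cl A : set_field A -> A `<=` densF R ->
  PJ_completion R (dens_cl R A) = dens_cl R A.
Proof.
move=> fA AF; have fcl := @dens_cl_field R _ fA; have clF := dens_cl_densF AF.
apply/seteqP; split; last exact: sub_PJ_completion.
by move=> E /(PJ_completion_sub_dens_cl fcl clF) h; exact: dens_cl_approx.
Qed.

(** For a field [C] this is the field generated by [C] and the null sets, see
    [field_gen_null]. *)
Definition null_mod C : set (set posnat) :=
  [set E | exists2 B, C B & dens_le (E `+` B) (0 : R)].

Lemma sub_null_mod C : C `<=` null_mod C.
Proof. by move=> E CE; exists E; rewrite // setYK; exact/null_dens/nullN0. Qed.

Lemma null_mod_field C : set_field C -> set_field (null_mod C).
Proof.
move=> [C0 CC CU]; split; first exact: sub_null_mod.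
  by move=> E [B CB EB]; exists (~` B); [exact: CC|rewrite setYCC].
move=> E F [B CB EB] [D CD FD]; exists (B `|` D); first exact: CU.
have := dens_leU EB FD; rewrite addr0; apply: dens_le_sub => // k.
rewrite !setY_def /=; have := pselect (E k); have := pselect (F k).
have := pselect (B k); have := pselect (D k); tauto.
Qed.

Lemma field_gen_null C : set_field C -> field_gen (C `|` nullN R) = null_mod C.
Proof.
move=> fC; apply/seteqP; split=> E.
  apply; split; first exact: null_mod_field.
  move=> F [|/null_dens F0]; first exact: sub_null_mod.
  by exists set0; [have [] := fC|rewrite setY0].
move=> [B CB EB] M [fM CNM]; have [_ _ MU] := fM.
have -> : E = (B `\` (B `\` E)) `|` (E `\` B).
  apply/seteqP; split=> k /=; have := pselect (E k); have := pselect (B k); tauto.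
apply: MU; [apply: field_setD => //|]; apply: CNM; first by left.
  by right; apply/null_dens; apply: dens_le_sub EB => // k; rewrite setY_def; right.
by right; apply/null_dens; apply: dens_le_sub EB => // k; rewrite setY_def; left.
Qed.

Lemma null_mod_sub_dens_cl C : null_mod C `<=` dens_cl R C.
Proof.
by move=> E [B /(@sub_dens_cl R) CB EB]; exact: dens_cl_null CB.
Qed.

Lemma dens_clS C D : C `<=` D -> dens_cl R C `<=` dens_cl R D.
Proof. by move=> CD E EC e /EC[B /CD DB EB]; exists B. Qed.

Lemma dens_cl_null_mod C : dens_cl R (null_mod C) = dens_cl R C.
Proof.
apply/seteqP; split; last exact/dens_clS/sub_null_mod.
move=> E EC; apply: dens_cl_approx => e /EC[B BC EB]; exists B => //.
exact: null_mod_sub_dens_cl.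
Qed.

(** The completion is a field containing the null sets, so it is generated by
    itself and the null sets. *)
Lemma PJ_completion_null C : set_field C -> C `<=` densF R -> nullN R `<=` C ->
  null_mod (PJ_completion R C) = PJ_completion R C.
Proof.
move=> fC CF NC; apply/seteqP; split; last exact: sub_null_mod.
have [_ _ PU] := PJ_completion_field fC CF.
have sub := sub_PJ_completion fC CF.
move=> E EC; suff : field_gen (PJ_completion R C `|` nullN R) E.
  apply; split; first exact: PJ_completion_field.
  by move=> F [//|/NC/sub].
by rewrite field_gen_null//; exact: PJ_completion_field.
Qed.

End Completions.

(** * Simple functions and outer density *)

Section SimpleFunctions.
Variables (R : realType) (A : set (set posnat)).
Hypotheses (fA : set_field A) (AF : A `<=` densF R).
Implicit Types (f g h s : posnat -> R) (c d e : R) (E F : set posnat).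

(** Simple functions without a chosen partition: finitely many values, and
    every level set in the field. This form is visibly stable under pointwise
    operations. *)
Definition fsimple s : Prop :=
  finite_set (range s) /\ forall S : set R, A (s @^-1` S).

Lemma indic_trivIset n (F : 'I_n -> set posnat) (a : 'I_n -> R) k x :
  trivIset [set: 'I_n] F -> F k x -> \sum_(i < n) a i * \1_(F i) x = a k.
Proof.
move=> tF Fkx; rewrite (bigD1 k)//= indicE mem_set// mulr1 big1 ?addr0// => i ik.
rewrite indicE memNset ?mulr0// => Fix; move/eqP: ik; apply.
by apply: tF => //; exists x.
Qed.

Lemma simpleP f : simple A f <-> fsimple f.
Proof.
split=> [[n [c [F [AFk [covF tF _] ->]]]]|[/finite_fsetP[X rX] fS]].
  have fE x : exists2 k, F k x & \sum_(i < n) c i * \1_(F i) x = c k.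
    have : [set: posnat] x by [].
    by rewrite -covF => -[k _ Fkx]; exists k; rewrite // (indic_trivIset c tF Fkx).
  split.
    apply: (@sub_finite_set _ _ (range c)) => [_ [x _ <-]|].
      by have [k _ ->] := fE x; exists k.
    by apply: finite_image; exact: finite_finset.
  move=> S; rewrite (_ : _ @^-1` _ = \bigcup_(k in [set k | S (c k)]) F k).
    by apply: field_bigcup => //; exact: finite_finset.
  apply/seteqP; split=> x /=; have [k Fkx fx] := fE x.
    by rewrite fx => Sx; exists k.
  by move=> [l /= Sl Flx]; rewrite (indic_trivIset c tF Flx).
have rXP y : (exists x, f x = y) <-> y \in X.
  have : range f y <-> [set` X] y by rewrite rX.
  move=> [h1 h2]; split=> [[x fx]|yX]; first by apply: h1; exists x.
  by have [x _ <-] := h2 yX; exists x.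
pose n := size X; pose c (k : 'I_n) : R := nth 0 X k.
pose F k := f @^-1` [set c k].
have Xk y : y \in X -> exists k, c k = y.
  by move=> yX; rewrite -index_mem in yX; exists (Ordinal yX); rewrite /c/= nth_index// -index_mem.
have tF : trivIset [set: 'I_n] F.
  move=> i j _ _ [x [Fi Fj]].
  have /eqP : c i = c j by rewrite -(Fi : f x = c i) -(Fj : f x = c j).
  by rewrite nth_uniq// ?fset_uniq// => /eqP ij; exact: val_inj.
exists n, c, F; split => [k||]; first exact: fS.
  split => //; last first.
    move=> k _; have /rXP[x fx] : c k \in X by rewrite /c mem_nth.
    by exists x.
  apply/seteqP; split=> x _ //; have [|k ck] := Xk (f x); first by apply/rXP; exists x.
  by exists k.
apply/funext => x; have [|k ck] := Xk (f x); first by apply/rXP; exists x.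
by rewrite (@indic_trivIset _ _ _ k).
Qed.

Lemma fsimple_cst c : fsimple (fun=> c).
Proof.
split=> [|S].
  by apply: (@sub_finite_set _ _ [set c]) => // _ [x _ <-].
have [Sc|Sc] := pselect (S c).
  have -> : (fun=> c) @^-1` S = [set: posnat] by apply/seteqP; split.
  exact: field_setT.
have -> : (fun=> c) @^-1` S = @set0 posnat by apply/seteqP; split.
by have [] := fA.
Qed.

Lemma fsimple_comp2 (phi : R -> R -> R) f g : fsimple f -> fsimple g ->
  fsimple (fun k => phi (f k) (g k)).
Proof.
move=> [ff fS] [fg gS]; split=> [|S].
  apply: (@sub_finite_set _ _ [set phi x.1 x.2 | x in range f `*` range g]).
    by move=> _ [k _ <-]; exists (f k, g k).
  by apply: finite_image; exact: finite_setX.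
rewrite (_ : _ @^-1` _ = \bigcup_(x in (range f `*` range g) `&` [set x | S (phi x.1 x.2)])
    (f @^-1` [set x.1] `&` g @^-1` [set x.2])).
  apply: field_bigcup => //; first by apply: finite_setIl; exact: finite_setX.
  by move=> x _; exact: field_setI.
apply/seteqP; split=> k /=; first by move=> Sk; exists (f k, g k).
by move=> [[x y] /= [_ Sxy] [-> ->]].
Qed.

Lemma fsimple_comp (phi : R -> R) f : fsimple f -> fsimple (fun k => phi (f k)).
Proof. by move=> sf; exact: (@fsimple_comp2 (fun x _ => phi x) f f). Qed.

Lemma fsimple_indic E : A E -> fsimple \1_E.
Proof.
move=> AE; split=> [|S].
  apply: (@sub_finite_set _ _ [set 0; 1]) => [_ [x _ <-]|]; last exact: finite_set2.
  by rewrite indicE; case: (_ \in _); [right|left].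
rewrite preimage_indic; have [A0 AC _] := fA.
by do 2 case: ifPn => _ //; [exact: field_setT|exact: AC].
Qed.

Lemma fsimple_bounded f : fsimple f -> exists2 K, 0 <= K & forall k, `|f k| <= K.
Proof.
move=> [/finite_fsetP[X rX] _]; exists (\sum_(y <- X) `|y|); first exact: sumr_ge0.
move=> k; have : [set` X] (f k) by rewrite -rX; exists k.
move=> /= fX; rewrite (big_rem (f k))//= lerDl; exact: sumr_ge0.
Qed.

Lemma simple_repr_nu f n (c : 'I_n -> R) (F : 'I_n -> set posnat) :
  simple_repr A f c F ->
  (fun N => nuN N f) @ \oo --> \sum_(k < n) c k * nu_set R (F k).
Proof.
move=> [AFk _ ->].
apply: (@cvg_nu_sum _ _ (fun k x => c k * \1_(F k) x)) => k.
by apply: cvg_nuZ; exact: AF (AFk k).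
Qed.

Lemma fsimple_cvgn f : fsimple f -> cvgn (fun N => nuN N f).
Proof.
by move=> /simpleP[n [c [F /simple_repr_nu]]]; exact: cvgP.
Qed.

(** The averages of a simple function converge to the integral computed from
    any of its representations, so the choice made in the definition is
    harmless. *)
Lemma simple_intE f : fsimple f -> simple_int A f = nu f.
Proof.
move=> /simpleP[n [c [F fF]]]; rewrite /simple_int.
set S := (X in get X).
have : S (get S) by apply: getPex; exists (\sum_(k < n) c k * nu_set R (F k)), n, c, F.
by move=> [n' [c' [F' [fF' ->]]]]; apply/esym/nuE; exact: simple_repr_nu fF'.
Qed.

End SimpleFunctions.

Section OuterDensity.
Variables (R : realType) (A : set (set posnat)).
Hypotheses (fA : set_field A) (AF : A `<=` densF R).
Implicit Types (f g h s : posnat -> R) (c d e : R) (E F : set posnat).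

Lemma nu_out_ge0 E : 0 <= nu_out R A E.
Proof.
apply: lb_le_inf.
  by exists (nu_set R setT), setT => //; split => //; exact: field_setT.
by move=> _ [B [AB _] <-]; apply: nu_set_ge0; exact: AF.
Qed.

Lemma nu_outP E c : nu_out R A E < c <->
  exists B, [/\ A B, E `<=` B & nu_set R B < c].
Proof.
split=> [/inf_lt[]|[B [AB EB Bc]]].
- by exists (nu_set R setT), setT => //; split => //; exact: field_setT.
- by move=> _ [B [AB EB] <-] Bc; exists B.
- apply: le_lt_trans Bc; apply: ge_inf; last by exists B.
  by exists 0 => _ [D [AD _] <-]; apply: nu_set_ge0; exact: AF.
Qed.

Lemma nu_out_le E c : (forall e : R, 0 < e -> exists B,
  [/\ A B, E `<=` B & dens_le B (c + e)]) -> nu_out R A E <= c.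
Proof.
move=> EB; apply/ler_addgt0Pr => e e0; have e20 : 0 < e / 2 by rewrite divr_gt0.
have [B [AB EB' Be]] := EB _ e20; apply/ltW/nu_outP; exists B; split => //.
have /dens_leP := Be; move=> /(_ (AF AB)) /le_lt_trans; apply.
by rewrite ltrD2l ltr_pdivrMr// ltr_pMr// ltr1n.
Qed.

Lemma nu_out_dens_le E c : nu_out R A E <= c -> dens_le E c.
Proof.
move=> Ec; apply: umean_le_closed => e e0.
have /nu_outP[B [AB EB Bc]] : nu_out R A E < c + e.
  by rewrite (le_lt_trans Ec)// ltrDl.
apply: (@dens_le_sub _ _ B _ (c + e)) => //; apply/dens_leP; [exact: AF|exact: ltW].
Qed.

(** Measurability as approximation off small sets of the field; it replaces
    hazy limits of sequences. *)
Definition fmeas f : Prop := forall e, 0 < e -> exists s C,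
  [/\ fsimple A s, A C, dens_le C e & forall k, ~ C k -> `|f k - s k| <= e].

Lemma T1P f : T1_measurable A f <-> fmeas f.
Proof.
split=> [[u us uf] e e0|fapx].
  have /cvgrPdist_lt/(_ _ e0)[n _ /(_ n (leqnn n))] := uf e e0.
  rewrite /= sub0r normrN ger0_norm ?nu_out_ge0// => /nu_outP[B [AB sB Be]].
  exists (u n), B; split => //; first exact/simpleP.
    by apply/dens_leP; [exact: AF|exact: ltW].
  by move=> k nBk; rewrite leNgt distrC; apply/negP => h; apply: nBk; exact: sB.
have /choice[u uP] : forall n : nat, exists s, fsimple A s /\ exists C,
    [/\ A C, dens_le C (n.+1%:R^-1 : R) &
     forall k, ~ C k -> `|f k - s k| <= n.+1%:R^-1].
  move=> n; have [|s [C [ss AC Ce fs]]] := fapx n.+1%:R^-1; first by rewrite invr_gt0.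
  by exists s; split => //; exists C.
exists u => [n|]; first by apply/simpleP => //; have [] := uP n.
move=> e e0; apply/cvgrPdist_le => d d0; near=> n.
rewrite sub0r normrN ger0_norm ?nu_out_ge0//.
have nd : n.+1%:R^-1 <= d.
  by apply: ltW; near: n; exact: (near_infty_natSinv_lt (PosNum d0)).
have ne : n.+1%:R^-1 <= e.
  by apply: ltW; near: n; exact: (near_infty_natSinv_lt (PosNum e0)).
have [_ [C [AC Cn fs]]] := uP n; apply: nu_out_le => e' e'0.
exists C; split => //; last by apply: dens_leW Cn; rewrite (le_trans nd)// lerDl ltW.
move=> k /=; rewrite distrC => ek; apply: contrapT => /fs; apply/negP.
by rewrite -ltNge (le_lt_trans ne).
Unshelve. all: by end_near. Qed.

(** A covering set of the field is a level set of an approximating simple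
    function together with the exceptional set. The level is lowered from [b]
    to [a] to make room for the error. *)
Lemma nu_out_fmeas h a b c : a < b -> fmeas h ->
  dens_le [set k | a < `|h k|] c -> nu_out R A [set k | b < `|h k|] <= c.
Proof.
move=> ab happ hc; apply: nu_out_le => e e0.
have d0 : 0 < Num.min e ((b - a) / 2) by rewrite lt_min e0 divr_gt0// subr_gt0.
have [s [C [[_ sS] AC Ce hs]]] := happ _ d0.
have CU : forall E F, A E -> A F -> A (E `|` F) by case: fA.
have hs' k : ~ C k -> `|h k - s k| <= (b - a) / 2.
  by move=> /hs /le_trans; apply; rewrite ge_min lexx orbT.
exists (s @^-1` [set x | (a + b) / 2 < `|x|] `|` C); split => [|k /= bh|].
- exact: CU.
- have [|/hs' hk] := pselect (C k); [by right|left].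
  have : `|h k| <= `|h k - s k| + `|s k| by rewrite -[h k in leLHS](subrK (s k)) ler_normD.
  by lra.
- have Ce' : dens_le C e by apply: dens_leW Ce; rewrite ge_min lexx.
  apply: dens_le_sub (dens_leU hc Ce') => // k /= [sk|]; last by right.
  have [|/hs' hk] := pselect (C k); [by right|left].
  have : `|s k| <= `|h k - s k| + `|h k|.
    by rewrite distrC -[s k in leLHS](subrK (h k)) ler_normD.
  by lra.
Qed.

End OuterDensity.

(** * Inequalities for powers *)

Section Powers.
Variables (R : realType) (p : R).
Hypothesis p1 : 1 <= p.
Implicit Types a b c d e r s t x y : R.

Let p0 : 0 < p. Proof. exact: lt_le_trans p1. Qed.
Let p_neq0 : p != 0. Proof. by rewrite gt_eqF. Qed.

Lemma ler_powR_base x y : 0 <= x -> x <= y -> x `^ p <= y `^ p.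
Proof.
by move=> x0 xy; apply: ge0_ler_powR; rewrite ?nnegrE ?(ltW p0)// (le_trans x0).
Qed.

Lemma ltr_powR_base x y : 0 <= x -> x < y -> x `^ p < y `^ p.
Proof.
by move=> x0 xy; apply: gt0_ltr_powR; rewrite ?nnegrE// (le_trans x0)// ltW.
Qed.

Lemma powR_root x : 0 <= x -> (x `^ p^-1) `^ p = x.
Proof. by move=> x0; rewrite -powRrM mulVf// powRr1. Qed.

Lemma root_powR x : 0 <= x -> (x `^ p) `^ p^-1 = x.
Proof. by move=> x0; rewrite -powRrM mulfV// powRr1. Qed.

Lemma root_le_powR x r : 0 <= x -> 0 <= r -> x `^ p^-1 <= r <-> x <= r `^ p.
Proof.
move=> x0 r0; split=> h.
  by rewrite -[x]powR_root// ler_powR_base// powR_ge0.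
rewrite -[r]root_powR//; apply: ge0_ler_powR; rewrite ?nnegrE ?powR_ge0//.
by rewrite invr_ge0 ltW.
Qed.

(** Convexity of the power function in the form used for the inequality of
    Minkowski: the right side is the convex combination, with weights [t] and
    [1 - t], of the powers of [a / t] and [b / (1 - t)]. *)
Lemma powR_split a b t : 0 <= a -> 0 <= b -> 0 < t -> t < 1 ->
  (a + b) `^ p <= t * (a / t) `^ p + (1 - t) * (b / (1 - t)) `^ p.
Proof.
move=> a0 b0 t0 t1; have t'0 : 0 < 1 - t by rewrite subr_gt0.
have tI : 0 <= t <= 1 by rewrite !ltW.
have := @convex_powR R p p1 (Itv01 (ltW t0) (ltW t1)) (a / t) (b / (1 - t)).
rewrite !inE/= !in_itv/= !andbT !divr_ge0 ?(ltW t0) ?(ltW t'0)//.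
move=> /(_ isT isT).
rewrite [X in X `^ p <= _ -> _](_ : _ = t * (a / t) + (1 - t) * (b / (1 - t)))//.
by rewrite mulrC divfK ?gt_eqF// mulrC divfK ?gt_eqF.
Qed.

(** One factor of each power is kept, and the remaining exponent is
    nonnegative. *)
Lemma powR_superadd a b : 0 <= a -> 0 <= b -> a `^ p + b `^ p <= (a + b) `^ p.
Proof.
move=> a0 b0; have q0 : 0 <= p - 1 by rewrite subr_ge0.
rewrite -!(mulr_powRB1 _ p0) ?addr_ge0// mulrDl.
by apply: lerD; apply: ler_wpM2l => //; apply: ge0_ler_powR => //;
  rewrite ?nnegrE ?addr_ge0 ?lerDl ?lerDr.
Qed.

Lemma bernoulli_le (n : nat) t : 0 <= t -> t <= 1 -> 1 - n%:R * (1 - t) <= t ^+ n.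
Proof.
move=> t0 t1; elim: n => [|n IH]; first by rewrite mul0r subr0 expr0.
have tn : t ^+ n <= 1 by rewrite exprn_ile1.
have : (1 - t) * t ^+ n <= 1 - t by rewrite ler_piMr// subr_ge0.
by rewrite exprS -natr1; lra.
Qed.

(** For an integer [n] above [p], the inequality of Bernoulli bounds the power
    of a ratio [t] in the unit interval from below by a linear function of
    [t]. *)
Lemma powR_lipschitz K : 0 <= K -> exists2 L, 0 <= L & forall x y,
  `|x| <= K -> `|y| <= K -> `| `|x| `^ p - `|y| `^ p | <= L * `|x - y|.
Proof.
move=> K0; pose n := (Num.truncn p).+1.
have pn : p <= n%:R by rewrite ltW// truncnS_gt.
exists (n%:R * K `^ (p - 1)); first by rewrite mulr_ge0// powR_ge0.
have key a b : 0 <= b -> b <= a -> a <= K ->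
    a `^ p - b `^ p <= n%:R * K `^ (p - 1) * (a - b).
  move=> b0; rewrite le_eqVlt => /predU1P[-> _|ba aK]; first by rewrite !subrr mulr0.
  have a0 : 0 < a by exact: le_lt_trans ba.
  pose t := b / a; have bE : b = t * a by rewrite /t divfK// gt_eqF.
  have t0 : 0 <= t by rewrite divr_ge0// ltW.
  have t1 : t <= 1 by rewrite ler_pdivrMr// mul1r ltW.
  have tp : 1 - n%:R * (1 - t) <= t `^ p.
    apply: le_trans (bernoulli_le n t0 t1) _.
    rewrite -powR_mulrn//; move: t0; rewrite le_eqVlt => /predU1P[<-|t0].
      by rewrite !powR0// gt_eqF// ltr0n.
    by apply: ger_powR => //; rewrite t0.
  have aP : 0 <= a `^ p by exact: powR_ge0.
  have -> : a - b = a * (1 - t) by rewrite mulrBr mulr1 mulrC -bE.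
  rewrite {1}bE powRM// ?(ltW a0)//.
  apply: (@le_trans _ _ (n%:R * a `^ p * (1 - t))).
    have : a `^ p * (1 - n%:R * (1 - t)) <= a `^ p * t `^ p by rewrite ler_wpM2l.
    by rewrite [t `^ p * _]mulrC; lra.
  rewrite -(mulr_powRB1 (ltW a0) p0) [a * _]mulrC !mulrA -mulrA -[leRHS]mulrA.
  apply: ler_wpM2r; first by rewrite mulr_ge0 ?(ltW a0)// subr_ge0.
  apply: ler_wpM2l => //.
  by apply: ge0_ler_powR; rewrite ?nnegrE ?subr_ge0// ltW.
move=> x y xK yK; have [yx|/ltW xy] := leP `|y| `|x|.
  rewrite ger0_norm ?subr_ge0 ?ler_powR_base//.
  apply: le_trans (key _ _ _ yx xK) _ => //; apply: ler_wpM2l.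
    by rewrite mulr_ge0// powR_ge0.
  by rewrite lerBlDr -[x in leLHS](subrK y) ler_normD.
rewrite distrC ger0_norm ?subr_ge0 ?ler_powR_base// distrC.
apply: le_trans (key _ _ _ xy yK) _ => //; apply: ler_wpM2l.
  by rewrite mulr_ge0// powR_ge0.
by rewrite lerBlDr -[y in leLHS](subrK x) ler_normD.
Qed.

Lemma powR_right_continuous r e : 0 <= r -> 0 < e ->
  exists2 d, 0 < d & (r + d) `^ p <= r `^ p + e.
Proof.
move=> r0 e0; have K0 : 0 <= r + 1 by rewrite addr_ge0.
have [L L0 LP] := powR_lipschitz K0.
have L1 : 0 < L + 1 by rewrite ltr_wpDl.
pose d := Num.min 1 (e / (L + 1)).
have d0 : 0 < d by rewrite lt_min ltr01 divr_gt0.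
have rd0 : 0 <= r + d by rewrite addr_ge0// ltW.
exists d => //; rewrite -lerBlDl (le_trans (ler_norm _))//.
have dE : r + d - r = d by ring.
have := LP (r + d) r; rewrite dE (ger0_norm rd0) (ger0_norm r0).
rewrite (ger0_norm (ltW d0)) lerD2l lerDl ler01 ge_min lexx => /(_ isT isT).
move=> /le_trans; apply.
apply: (@le_trans _ _ (L * (e / (L + 1)))).
  by rewrite ler_wpM2l// ge_min lexx orbT.
by rewrite mulrCA ger_pMr// ler_pdivrMr// mul1r lerDl.
Qed.

End Powers.

(** * Pseudonorms defined by upper means of truncations *)

Section TruncatedNorm.
Variable R : realType.
Implicit Types (f g h k : posnat -> R) (a b c d e p r s x y K M : R) (E F : set posnat).

(** For nonnegative measurable functions this bounds the integral. Upper means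
    of the function itself may be larger, since they depend on its values on
    null sets. *)
Definition trunc_le f c : Prop :=
  forall M, 0 <= M -> umean_le (fun n => Num.min (f n) M) c.

Lemma le_minl x y M : x <= y -> Num.min x M <= Num.min y M.
Proof. by move=> xy; rewrite le_min !ge_min xy lexx orbT. Qed.

Lemma min_ge0 x M : 0 <= x -> 0 <= M -> 0 <= Num.min x M.
Proof. by move=> x0 M0; rewrite le_min x0. Qed.

Lemma trunc_le_trans f g c d : (forall n, f n <= g n) -> c <= d ->
  trunc_le g c -> trunc_le f d.
Proof.
move=> fg cd gc M M0; apply: umean_le_trans cd (gc M M0) => n.
by rewrite le_minl.
Qed.

Lemma umean_trunc_le f c : umean_le f c -> trunc_le f c.
Proof.
by move=> fc M M0; apply: umean_le_trans fc => // n; rewrite ge_min lexx.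
Qed.

(** If one of the truncations on the right is effective, then already its term
    is at least [M]. *)
Lemma min_split a b x y M : 0 < a -> 0 < b -> 0 <= x -> 0 <= y -> 0 <= M ->
  Num.min (a * x + b * y) M <= a * Num.min x (M / a) + b * Num.min y (M / b).
Proof.
move=> a0 b0 x0 y0 M0.
have [ax|ax] := leP x (M / a); last first.
  rewrite [a * (M / a)]mulrC divfK ?gt_eqF//.
  rewrite ge_min; apply/orP; right; rewrite lerDl mulr_ge0 ?(ltW b0)//.
  by rewrite min_ge0// divr_ge0// ltW.
have [by'|by'] := leP y (M / b); last first.
  rewrite [b * (M / b)]mulrC divfK ?gt_eqF//.
  by rewrite ge_min; apply/orP; right; rewrite lerDr mulr_ge0// ltW.
by rewrite ge_min lexx.
Qed.

Lemma trunc_leD2 f g c d a b : 0 < a -> 0 < b ->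
  (forall n, 0 <= f n) -> (forall n, 0 <= g n) ->
  trunc_le f c -> trunc_le g d ->
  trunc_le (fun n => a * f n + b * g n) (a * c + b * d).
Proof.
move=> a0 b0 f0 g0 fc gd M M0.
have Ma : 0 <= M / a by rewrite divr_ge0// ltW.
have Mb : 0 <= M / b by rewrite divr_ge0// ltW.
have := umean_leD (umean_leZ (ltW a0) (fc _ Ma)) (umean_leZ (ltW b0) (gd _ Mb)).
by apply: umean_le_trans => // n; exact: min_split.
Qed.

Lemma trunc_le_closed f c : (forall e, 0 < e -> trunc_le f (c + e)) -> trunc_le f c.
Proof. by move=> fc M M0; apply: umean_le_closed => e e0; exact: fc. Qed.

(** Being at most [r] in the pseudonorm of exponent [p], or for [p = 0] in the
    pseudometric of hazy convergence, with upper density in the place of outer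
    density and upper means of truncations in the place of the integral. No
    field of sets enters. *)
Definition pnorm_le p h r : Prop := 0 <= r /\
  if p == 0 then
    forall r', r < r' -> exists2 e, 0 < e & dens_le [set n | e < `|h n|] (r' - e)
  else trunc_le (abs_pow p h) (r `^ p).

Lemma pnorm0P h r : pnorm_le 0 h r <-> 0 <= r /\
  forall r', r < r' -> exists2 e, 0 < e & dens_le [set n | e < `|h n|] (r' - e).
Proof. by rewrite /pnorm_le eqxx. Qed.

Lemma pnorm1P p h r : 1 <= p ->
  pnorm_le p h r <-> 0 <= r /\ trunc_le (abs_pow p h) (r `^ p).
Proof. by move=> p1; rewrite /pnorm_le gt_eqF// (lt_le_trans ltr01). Qed.

Lemma abs_pow_ge0 p h n : 0 <= abs_pow p h n.
Proof. exact: powR_ge0. Qed.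

Section Exponent.
Variable p : R.
Hypothesis hp : p = 0 \/ 1 <= p.

Lemma pnorm_le_ge0 h r : pnorm_le p h r -> 0 <= r.
Proof. by case. Qed.

Lemma pnorm_le_trans h k r s : (forall n, `|h n| <= `|k n|) -> r <= s ->
  pnorm_le p k r -> pnorm_le p h s.
Proof.
move=> hk rs; case: hp => [->|p1].
  move=> /pnorm0P[r0 kr]; apply/pnorm0P; split=> [|r' sr']; first exact: le_trans rs.
  have [e e0 ke] := kr r' (le_lt_trans rs sr').
  by exists e => //; apply: dens_le_sub ke => // n /= /lt_le_trans; apply.
move=> /(pnorm1P _ _ p1)[r0 kr]; apply/pnorm1P => //.
split; first exact: le_trans rs.
apply: trunc_le_trans kr => [n|]; first exact: ler_powR_base.
exact: ler_powR_base.
Qed.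

Lemma pnorm_leW h r s : r <= s -> pnorm_le p h r -> pnorm_le p h s.
Proof. by move=> rs; exact: pnorm_le_trans. Qed.

Lemma pnorm_le_closed h r : 0 <= r ->
  (forall e, 0 < e -> pnorm_le p h (r + e)) -> pnorm_le p h r.
Proof.
move=> r0; case: hp => [->|p1] hr.
  apply/pnorm0P; split=> // r' rr'.
  have d0 : 0 < (r' - r) / 2 by rewrite divr_gt0// subr_gt0.
  have /pnorm0P[_] := hr _ d0; apply; rewrite -ltrBrDl.
  by rewrite ltr_pdivrMr// ltr_pMr ?subr_gt0// ltr1n.
apply/pnorm1P => //; split=> //; apply: trunc_le_closed => e e0.
have [d d0 rd] := powR_right_continuous p1 r0 e0.
by have /(pnorm1P _ _ p1)[_] := hr _ d0; exact: trunc_le_trans.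
Qed.

Lemma dens_le_gtr_split h k a b c d :
  dens_le [set n | a < `|h n|] c -> dens_le [set n | b < `|k n|] d ->
  dens_le [set n | a + b < `|h n + k n|] (c + d).
Proof.
move=> hc kd; apply: dens_le_sub (dens_leU hc kd) => // n /=.
rewrite -[k n]opprK => /(@ltr_distD_split _ _ 0).
by rewrite subr0 sub0r !opprK.
Qed.

(** The inequality of Minkowski. Its convexity argument divides by [r] and
    [s], which are made positive by an arbitrarily small change. The weight is
    chosen so that [r / t] and [s / (1 - t)] both equal [r + s]. *)
Lemma pnorm_leD h k r s : pnorm_le p h r -> pnorm_le p k s ->
  pnorm_le p (fun n => h n + k n) (r + s).
Proof.
case: hp => [->|p1].
  move=> /pnorm0P[r0 hr] /pnorm0P[s0 ks]; apply/pnorm0P; split=> [|r' rr'].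
    exact: addr_ge0.
  pose d := (r' - (r + s)) / 2.
  have d0 : 0 < d by rewrite divr_gt0// subr_gt0.
  have [|a a0 ha] := hr (r + d); first by rewrite ltrDl.
  have [|b b0 kb] := ks (s + d); first by rewrite ltrDl.
  exists (a + b); first exact: addr_gt0.
  have := dens_le_gtr_split ha kb; apply: dens_leW.
  by rewrite /d; lra.
move=> hr ks; have r0 := pnorm_le_ge0 hr; have s0 := pnorm_le_ge0 ks.
apply: pnorm_le_closed => [|e e0]; first exact: addr_ge0.
have e20 : 0 < e / 2 by rewrite divr_gt0.
have {}hr : pnorm_le p h (r + e / 2) by apply: pnorm_leW hr; rewrite lerDl ltW.
have {}ks : pnorm_le p k (s + e / 2) by apply: pnorm_leW ks; rewrite lerDl ltW.
rewrite [e]splitr addrACA.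
move: (r + e / 2) (s + e / 2) (ltr_wpDl r0 e20) (ltr_wpDl s0 e20) hr ks => {r0 s0}r {}s.
move=> r0 s0 /(pnorm1P _ _ p1)[_ hr] /(pnorm1P _ _ p1)[_ ks].
apply/pnorm1P => //; have rs0 : 0 < r + s by exact: addr_gt0.
split; first exact: ltW.
have [t [t0 t1 rE sE]] : exists t,
    [/\ 0 < t, t < 1, r / t = r + s & s / (1 - t) = r + s].
  exists (r / (r + s)); split; first exact: divr_gt0.
  - by rewrite ltr_pdivrMr// mul1r ltrDl.
  - by rewrite invf_div mulrCA mulfV ?mulr1// gt_eqF.
  - have -> : 1 - r / (r + s) = s / (r + s) by field; rewrite gt_eqF.
    by rewrite invf_div mulrCA mulfV ?mulr1// gt_eqF.
have t'0 : 0 < 1 - t by rewrite subr_gt0.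
pose a := t * t^-1 `^ p; pose b := (1 - t) * (1 - t)^-1 `^ p.
have a0 : 0 < a by rewrite mulr_gt0// powR_gt0// invr_gt0.
have b0 : 0 < b by rewrite mulr_gt0// powR_gt0// invr_gt0.
have -> : (r + s) `^ p = a * r `^ p + b * s `^ p.
  rewrite /a /b -!mulrA -!powRM ?invr_ge0 ?(ltW t0) ?(ltW t'0) ?(ltW r0) ?(ltW s0)//.
  by rewrite [t^-1 * _]mulrC [(1 - t)^-1 * _]mulrC rE sE -mulrDl [t + _]addrC subrK mul1r.
have := trunc_leD2 a0 b0 (abs_pow_ge0 p h) (abs_pow_ge0 p k) hr ks.
apply: trunc_le_trans => // n; rewrite /abs_pow.
apply: (@le_trans _ _ ((`|h n| + `|k n|) `^ p)).
  by apply: ler_powR_base => //; exact: ler_normD.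
apply: le_trans (powR_split p1 _ _ t0 t1) _ => //.
rewrite /a /b -!mulrA -!powRM ?invr_ge0 ?(ltW t0) ?(ltW t'0)//.
by rewrite [t^-1 * _]mulrC [(1 - t)^-1 * _]mulrC.
Qed.

Lemma pnorm_leN h r : pnorm_le p h r -> pnorm_le p (fun n => - h n) r.
Proof. by apply: pnorm_le_trans => // n; rewrite normrN. Qed.

(** For positive exponent, the inequality of Markov applied to a truncation of
    the power of [h]. *)
Lemma pnorm_le_small e : 0 < e -> exists2 d, 0 < d & forall h,
  pnorm_le p h d -> dens_le [set n | e < `|h n|] e.
Proof.
move=> e0; case: hp => [->|p1].
  exists (e / 2); first by rewrite divr_gt0.
  move=> h /pnorm0P[_ /(_ e)]; case=> [|d d0 hd].
    by rewrite ltr_pdivrMr// ltr_pMr// ltr1n.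
  have de : d <= e by rewrite -subr_ge0; exact: dens_le_ge0 hd.
  apply: dens_le_sub hd => [n /=|]; first exact: le_lt_trans.
  by rewrite gerBl ltW.
have ep0 : 0 < e `^ p by exact: powR_gt0.
have q0 : 0 < e * e `^ p by rewrite mulr_gt0.
exists ((e * (e `^ p)) `^ p^-1); first exact: powR_gt0.
move=> h /(pnorm1P _ _ p1)[_]; rewrite (powR_root p1) ?(ltW q0)// => hd.
have ep : 0 <= e `^ p + 1 by rewrite addr_ge0// ltW.
have m0 n : 0 <= Num.min (abs_pow p h n) (e `^ p + 1) by rewrite min_ge0 ?abs_pow_ge0.
have := dens_le_markov m0 ep0 (hd _ ep); rewrite mulfK ?gt_eqF//.
apply: dens_le_sub => // n /= eh; rewrite lt_min ltrDl ltr01 andbT.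
by apply: ltr_powR_base => //; exact: ltW.
Qed.

(** Conversely, for functions with a common bound, smallness in upper density
    is smallness in norm. *)
Lemma pnorm_le_bounded K e : 0 <= K -> 0 < e -> exists2 d, 0 < d & forall h,
  (forall n, `|h n| <= K) -> dens_le [set n | d < `|h n|] d -> pnorm_le p h e.
Proof.
move=> K0 e0; case: hp => [->|p1].
  exists (e / 2); first by rewrite divr_gt0.
  move=> h _ he; apply/pnorm0P; split=> [|r' er']; first exact: ltW.
  exists (e / 2); first by rewrite divr_gt0.
  by apply: dens_leW he; lra.
have ep0 : 0 < e `^ p by exact: powR_gt0.
have L0 : 0 < 1 + K `^ p by rewrite ltr_pwDl// powR_ge0.
(* The bound off the small set and the bound on it, weighted by its density,
   add up to the power of [e]. *)
pose t := e `^ p / (1 + K `^ p).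
have t0 : 0 < t by rewrite divr_gt0.
pose d := Num.min (t `^ p^-1) t.
have d0 : 0 < d by rewrite lt_min t0 powR_gt0.
exists d => // h hK hd; apply/pnorm1P => //; split; first exact: ltW.
apply: umean_trunc_le.
have tK : t + K `^ p * t = e `^ p.
  by rewrite -{1}[t]mul1r -mulrDl mulrC divfK// gt_eqF.
have ht : dens_le [set n | d < `|h n|] t by apply: dens_leW hd; rewrite ge_min lexx orbT.
rewrite -tK; apply: umean_le_split ht; first exact: ltW.
- exact: powR_ge0.
- move=> n /= /negP; rewrite -leNgt => hn; rewrite -[t](powR_root p1) ?(ltW t0)//.
  by apply: ler_powR_base => //; rewrite (le_trans hn)// ge_min lexx.
- by move=> n _; exact: ler_powR_base.
Qed.

(** This is why all spaces have the same classes, whatever the exponent. *)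
Lemma pnorm_le0P h : pnorm_le p h 0 <-> negl h.
Proof.
split=> [h0 e e0|h0].
  apply: dens_le_eq0 => d d0.
  have q0 : 0 < Num.min d e by rewrite lt_min d0.
  have [c c0 hc] := pnorm_le_small q0.
  have := hc h (pnorm_leW (ltW c0) h0).
  apply: dens_le_sub => [n/=|]; last by rewrite ge_min lexx.
  by apply: le_lt_trans; rewrite ge_min lexx orbT.
case: hp => [->|p1].
  apply/pnorm0P; split=> // r' r0; exists (r' / 2); first by rewrite divr_gt0.
  by apply: dens_leW (h0 _ _); lra.
have p_gt0 : 0 < p by exact: lt_le_trans p1.
apply/pnorm1P => //; split=> //; rewrite powR0 ?gt_eqF// => M M0.
apply: umean_le_closed => e e0.
have d0 : 0 < e `^ p^-1 by exact: powR_gt0.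
rewrite add0r -[e]addr0 -[X in _ + X](mulr0 M).
apply: umean_le_split (h0 _ d0) => //; first exact: ltW.
  move=> n /= /negP; rewrite -leNgt => hn; rewrite ge_min; apply/orP; left.
  by rewrite -[e](powR_root p1) ?(ltW e0)//; exact: ler_powR_base.
by move=> n _; rewrite ge_min lexx orbT.
Qed.

Lemma negl_pnorm_le h k r : negl (fun n => h n - k n) -> pnorm_le p k r ->
  pnorm_le p h r.
Proof.
move=> /pnorm_le0P hk kr; rewrite -[r]add0r; have := pnorm_leD hk kr.
by apply: pnorm_le_trans => // n; rewrite subrK.
Qed.

Lemma pnorm_leZ a h r : pnorm_le p h r -> exists s, pnorm_le p (fun n => a * h n) s.
Proof.
case: hp => [->|p1].
  move=> _; exists 1; apply/pnorm0P; split=> // r' r1.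
  exists (r' - 1); first by rewrite subr_gt0.
  by have -> : r' - (r' - 1) = 1; [ring|exact: dens_le1].
move=> /(pnorm1P _ _ p1)[r0 hr]; exists (`|a| * r); apply/pnorm1P => //.
split; first exact: mulr_ge0.
have [->|a0] := eqVneq a 0.
  have pn0 : p != 0 by rewrite gt_eqF// (lt_le_trans _ p1).
  rewrite normr0 mul0r powR0//; apply: umean_trunc_le.
  apply: umean_le_trans (umean_le_cst 0) => // n.
  by rewrite /abs_pow mul0r normr0 powR0.
have ap : 0 < `|a| `^ p by rewrite powR_gt0// normr_gt0.
rewrite powRM// => M M0; have Ma : 0 <= M / `|a| `^ p by rewrite divr_ge0// ltW.
apply: umean_le_trans (umean_leZ (ltW ap) (hr _ Ma)) => // n.
rewrite /abs_pow normrM powRM//.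
have [hM|hM] := leP (`|h n| `^ p) (M / `|a| `^ p); first by rewrite ge_min lexx.
by rewrite [leRHS]mulrC divfK ?gt_eqF// ge_min lexx orbT.
Qed.

(** The lemma of Fatou for limits in upper density: truncated at a fixed
    level, the error of the approximation is bounded, hence small in norm. *)
Lemma pnorm_le_fatou h r : 0 <= r -> (forall e, 0 < e -> exists2 k,
  dens_le [set n | e < `|h n - k n|] e & pnorm_le p k r) -> pnorm_le p h r.
Proof.
move=> r0; case: hp => [->|p1] hk.
  apply/pnorm0P; split=> // r' rr'.
  pose d := (r' - r) / 3; have d0 : 0 < d by rewrite divr_gt0// subr_gt0.
  have [k hkd /pnorm0P[_ kr]] := hk _ d0.
  have [|e e0 ke] := kr (r + d); first by rewrite ltrDl.
  exists (d + e); first exact: addr_gt0.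
  have := dens_le_gtr_split hkd ke; apply: dens_le_sub.
    by move=> n /=; rewrite subrK.
  by rewrite /d; lra.
apply/pnorm1P => //; split=> // M M0.
apply: umean_le_closed => e e0.
have [d d0 rd] := powR_right_continuous p1 r0 e0.
pose K := M `^ p^-1; have K0 : 0 <= K by exact: powR_ge0.
have [c c0 cP] := pnorm_le_bounded K0 d0.
have [k hkc kr] := hk _ c0.
have mhk : pnorm_le p (fun n => Num.min `|h n - k n| K) d.
  apply: cP => [n|]; first by rewrite ger0_norm ?min_ge0// ge_min lexx orbT.
  apply: dens_le_sub hkc => // n /=; rewrite ger0_norm ?min_ge0//.
  by rewrite lt_min => /andP[].
have kr' : pnorm_le p (fun n => `|k n|) r.
  by apply: pnorm_le_trans kr => // n; rewrite normr_id.
have /(pnorm1P _ _ p1)[_ /(_ M M0)] := pnorm_leD kr' mhk.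
apply: umean_le_trans => // n; rewrite le_min.
apply/andP; split; last by rewrite ge_min lexx orbT.
rewrite /abs_pow [X in _ <= X `^ p]ger0_norm ?addr_ge0 ?min_ge0//.
have [hK|hK] := leP `|h n - k n| K.
  rewrite ge_min; apply/orP; left; apply: ler_powR_base => //.
  by rewrite addrC -[X in `|X| <= _](subrK (k n)) ler_normD.
rewrite ge_min; apply/orP; right; rewrite -[leLHS](powR_root p1) -/K//.
by rewrite ler_powR_base// lerDr.
Qed.

End Exponent.
End TruncatedNorm.

(** * Measurable functions *)

Section Measurability.
Variables (R : realType) (A : set (set posnat)).
Hypotheses (fA : set_field A) (AF : A `<=` densF R).
Implicit Types (f g h s : posnat -> R) (a b c d e K x y : R) (E F : set posnat).

Let AU E F : A E -> A F -> A (E `|` F). Proof. by case: fA => _ _; exact. Qed.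

Lemma fmeas_fsimple s : fsimple A s -> fmeas A s.
Proof.
move=> ss e e0; exists s, set0; split => //; first by case: fA.
  by apply: dens_leW (ltW e0) _; exact/null_dens/nullN0.
by move=> k _; rewrite subrr normr0 ltW.
Qed.

Lemma fmeas_indic E : A E -> fmeas A (\1_E : posnat -> R).
Proof. by move=> AE; apply: fmeas_fsimple; exact: fsimple_indic. Qed.

Lemma fmeasD f g : fmeas A f -> fmeas A g -> fmeas A (fun k => f k + g k).
Proof.
move=> fa ga e e0; have e20 : 0 < e / 2 by rewrite divr_gt0.
have [s [C [ss AC Ce fs]]] := fa _ e20; have [t [D [st AD De gt]]] := ga _ e20.
exists (fun k => s k + t k), (C `|` D); split.
- exact: (fsimple_comp2 fA +%R).
- exact: AU.
- by rewrite [e]splitr; exact: dens_leU.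
- move=> k CDk; rewrite opprD addrACA [e]splitr (le_trans (ler_normD _ _))//.
  by apply: lerD; [apply: fs => ?|apply: gt => ?]; apply: CDk; [left|right].
Qed.

(** Simple functions are bounded. *)
Lemma fmeas_tight f e : fmeas A f -> 0 < e ->
  exists K C, [/\ 0 <= K, A C, dens_le C e & forall k, ~ C k -> `|f k| <= K].
Proof.
move=> fa e0; have [s [C [ss AC Ce fs]]] := fa _ e0.
have [K K0 sK] := fsimple_bounded ss; exists (e + K), C; split => //.
  by rewrite addr_ge0// ltW.
move=> k /fs fsk; rewrite -[f k](subrK (s k)) (le_trans (ler_normD _ _))//.
exact: lerD.
Qed.

(** Uniform continuity on bounded sets is enough, since [f] is bounded off a
    small set. *)
Lemma fmeas_comp (phi : R -> R) f :
  (forall K e, 0 <= K -> 0 < e -> exists2 d, 0 < d & forall x y, `|x| <= K ->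
     `|y| <= K -> `|x - y| <= d -> `|phi x - phi y| <= e) ->
  fmeas A f -> fmeas A (fun k => phi (f k)).
Proof.
move=> phic fa e e0; have e20 : 0 < e / 2 by rewrite divr_gt0.
have [K [C [K0 AC Ce fK]]] := fmeas_tight fa e20.
have K1 : 0 <= K + 1 by rewrite addr_ge0.
have [d d0 dP] := phic _ _ K1 e0.
have q0 : 0 < Num.min (e / 2) (Num.min d 1) by rewrite !lt_min e20 d0 ltr01.
have [s [D [ss AD De fs]]] := fa _ q0.
exists (fun k => phi (s k)), (C `|` D); split.
- exact: fsimple_comp.
- exact: AU.
- rewrite [e]splitr; apply: dens_leU => //; apply: dens_leW De.
  by rewrite ge_min lexx.
- move=> k CDk; have /fK fk : ~ C k by move=> ?; apply: CDk; left.
  have /fs : ~ D k by move=> ?; apply: CDk; right.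
  rewrite !le_min => /and3P[_ fsd fs1]; apply: dP => //.
    by rewrite (le_trans fk)// lerDl.
  rewrite -[s k](subrK (f k)) (le_trans (ler_normD _ _))// addrC lerD//.
  by rewrite distrC.
Qed.

Lemma fmeas_lipschitz (phi : R -> R) f : (exists2 L, 0 <= L &
  forall x y, `|phi x - phi y| <= L * `|x - y|) ->
  fmeas A f -> fmeas A (fun k => phi (f k)).
Proof.
move=> [L L0 LP]; apply: fmeas_comp => K e K0 e0.
have L1 : 0 < L + 1 by rewrite ltr_wpDl.
exists (e / (L + 1)); first by rewrite divr_gt0.
move=> x y _ _ xy; apply: le_trans (LP x y) _.
apply: le_trans (ler_wpM2l L0 xy) _.
by rewrite mulrCA ger_pMr// ler_pdivrMr// mul1r lerDl.
Qed.

Lemma fmeasZ a f : fmeas A f -> fmeas A (fun k => a * f k).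
Proof.
apply: (fmeas_lipschitz (phi := *%R a)); exists `|a| => // x y.
by rewrite -mulrBr normrM.
Qed.

Lemma fmeasB f g : fmeas A f -> fmeas A g -> fmeas A (fun k => f k - g k).
Proof.
move=> fa ga; rewrite (_ : (fun k => _) = (fun k => f k + (-1) * g k)).
  by apply: fmeasD => //; exact: fmeasZ.
by apply/funext => k; rewrite mulN1r.
Qed.

Lemma min_lipschitz K x y : `|Num.min x K - Num.min y K| <= 1 * `|x - y|.
Proof.
rewrite mul1r ler_norml; have := ler_norm (x - y).
have := ler_norm (y - x); rewrite distrC; move: `|x - y| => z.
by case: (leP x K) => xK; case: (leP y K) => yK; lra.
Qed.

Lemma fmeas_min f K : fmeas A f -> fmeas A (fun k => Num.min (f k) K).
Proof.
apply: (fmeas_lipschitz (phi := fun x => Num.min x K)).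
by exists 1 => // x y; exact: min_lipschitz.
Qed.

Lemma fmeas_abs_pow p f : 1 <= p -> fmeas A f -> fmeas A (abs_pow p f).
Proof.
move=> p1; apply: (@fmeas_comp (fun x => `|x| `^ p)) => K e K0 e0.
have [L L0 LP] := powR_lipschitz p1 K0.
have L1 : 0 < L + 1 by rewrite ltr_wpDl.
exists (e / (L + 1)); first by rewrite divr_gt0.
move=> x y xK yK xy; apply: le_trans (LP x y xK yK) _.
apply: le_trans (ler_wpM2l L0 xy) _.
by rewrite mulrCA ger_pMr// ler_pdivrMr// mul1r lerDl.
Qed.

Definition clamp K x := Num.max (- K) (Num.min x K).

Lemma clamp_lipschitz K x y : 0 <= K -> `|clamp K x - clamp K y| <= `|x - y|.
Proof.
move=> K0; rewrite ler_norml; have := ler_norm (x - y).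
have := ler_norm (y - x); rewrite distrC; move: `|x - y| => z; rewrite /clamp.
case: (leP x K) => xK; case: (leP y K) => yK; case: (leP (- K) x) => ?;
case: (leP (- K) y) => ?; case: (leP (- K) K) => ?; lra.
Qed.

Lemma clamp_le K x : 0 <= K -> `|clamp K x| <= K.
Proof.
move=> K0; rewrite ler_norml /clamp.
by case: (leP x K) => ?; case: (leP (- K) x) => ?; case: (leP (- K) K) => ?; lra.
Qed.

Lemma clamp_id K x : `|x| <= K -> clamp K x = x.
Proof.
rewrite ler_norml /clamp => ?.
by case: (leP x K) => ?; case: (leP (- K) x) => ?; case: (leP (- K) K) => ?; lra.
Qed.

Lemma normr_clamp K x : 0 <= K -> `|clamp K x| = Num.min `|x| K.
Proof.
move=> K0; have [xK|xK] := leP `|x| K; first by rewrite clamp_id.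
have [x0|x0] := leP 0 x.
  rewrite ger0_norm// in xK.
  by rewrite /clamp; case: (leP x K) => ?; case: (leP (- K) K) => ?; rewrite ?ger0_norm//; lra.
rewrite ltr0_norm// in xK.
rewrite /clamp; case: (leP x K) => ?; case: (leP (- K) x) => ?;
  by rewrite ?normrN ?ger0_norm//; lra.
Qed.

(** Outside a small set the function is close to a simple function, whose mean
    exists, and on that set both are bounded. *)
Lemma fmeas_bounded_cvgn f K : (forall k, `|f k| <= K) -> fmeas A f ->
  cvgn (fun N => nuN N f).
Proof.
move=> fK fa; have K0 : 0 <= K by rewrite (le_trans _ (fK (pos_succ 0))).
apply: cvgn_nu_closed => e e0.
have L0 : 0 < 1 + (K + K) by rewrite ltr_pwDl// addr_ge0.
have [s [C [ss AC Ce fs]]] := fa _ (divr_gt0 e0 L0).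
exists (fun k => clamp K (s k)); first exact/(fsimple_cvgn fA AF)/fsimple_comp.
have -> : e = e / (1 + (K + K)) + (K + K) * (e / (1 + (K + K))).
  by field; rewrite gt_eqF.
apply: umean_le_split Ce; [by rewrite divr_ge0// ltW|exact: addr_ge0| |].
- move=> k /fs; rewrite -{2}(@clamp_id K (f k))//; apply: le_trans.
  exact: clamp_lipschitz.
- move=> k _; rewrite (le_trans (ler_normB _ _))// lerD//; exact: clamp_le.
Qed.

(** The set where the two functions differ substantially is null, and can be
    added to the exceptional set when the field contains it. *)
Lemma fmeas_null f g : nullN R `<=` A -> fmeas A f -> negl (fun k => f k - g k) ->
  fmeas A g.
Proof.
move=> NA fa fg e e0; have e20 : 0 < e / 2 by rewrite divr_gt0.
have [s [C [ss AC Ce fs]]] := fa _ e20.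
have fg0 := fg _ e20.
exists s, (C `|` [set k | e / 2 < `|f k - g k|]); split => //.
- by apply: AU => //; exact/NA/null_dens.
- rewrite [X in dens_le _ X]splitr; apply: dens_leU => //.
  exact: dens_leW (ltW e20) fg0.
- move=> k CDk; rewrite -[g k](subrK (f k)) -addrA [e]splitr.
  rewrite (le_trans (ler_normD _ _))// lerD//.
    by rewrite distrC leNgt; apply/negP => h; apply: CDk; right.
  by apply: fs => ?; apply: CDk; left.
Qed.

End Measurability.

Lemma fsimpleS (R : realType) (A B : set (set posnat)) (s : posnat -> R) :
  A `<=` B -> fsimple A s -> fsimple B s.
Proof. by move=> AB [fs sA]; split => // S; exact: AB. Qed.

Lemma fmeasS (R : realType) (A B : set (set posnat)) (f : posnat -> R) :
  A `<=` B -> fmeas A f -> fmeas B f.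
Proof.
move=> AB fa e /fa[s [C [ss AC Ce fs]]]; exists s, C; split => //.
  exact: fsimpleS ss.
exact: AB.
Qed.

(** * The integral as a bound on upper means *)

Section Integral.
Variables (R : realType) (A : set (set posnat)).
Hypotheses (fA : set_field A) (AF : A `<=` densF R).
Implicit Types (f g h s : posnat -> R) (a b c d e K M x y : R) (E F : set posnat).
Implicit Types u : nat -> posnat -> R.

Lemma hazily_kyfan_cvg u f : hazily A u f -> kyfan_cvg u f.
Proof.
move=> uf e e0; have /cvgrPdist_le/(_ _ e0)[M _ MP] := uf e e0.
exists M => n /MP; rewrite /= sub0r normrN ger0_norm ?nu_out_ge0//.
exact: nu_out_dens_le.
Qed.

Lemma kyfan_cvg_hazily u f : fmeas A f -> (forall n, fmeas A (u n)) -> kyfan_cvg u f ->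
  hazily A u f.
Proof.
move=> fa ua uf e e0; apply/cvgrPdist_le => d d0.
have q0 : 0 < Num.min d (e / 2) by rewrite lt_min d0 divr_gt0.
have [M MP] := uf _ q0; exists M => // n Mn /=.
rewrite sub0r normrN ger0_norm ?nu_out_ge0//.
apply: (@nu_out_fmeas _ _ fA AF (fun k => u n k - f k) (Num.min d (e / 2))).
- by rewrite gt_min; apply/orP; right; rewrite ltr_pdivrMr// ltr_pMr// ltr1n.
- exact: fmeasB.
- by apply: dens_leW (MP _ Mn); rewrite ge_min lexx.
Qed.

Lemma fsimple_dist f g : fsimple A f -> fsimple A g -> fsimple A (fun k => `|f k - g k|).
Proof. exact: (fsimple_comp2 fA (fun x y => `|x - y|)). Qed.

Lemma fsimple_nu f : fsimple A f -> (fun N => nuN N f) @ \oo --> nu f.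
Proof. by move=> sf; exact: (fsimple_cvgn fA AF sf). Qed.

(** Integrals of simple functions are means, so the Cauchy condition can be
    stated with upper means. *)
Lemma determiningP u f : determining A u f <->
  [/\ forall n, fsimple A (u n), hazily A u f &
   forall e, 0 < e -> exists M : nat, forall n m, (M <= n)%N -> (M <= m)%N ->
     umean_le (fun k => `|u n k - u m k|) e].
Proof.
split=> [[us uf uc]|[us uf uc]].
  have su n : fsimple A (u n) by apply/simpleP.
  split => // e /uc[M MP]; exists M => n m Mn Mm.
  have := MP _ _ Mn Mm; rewrite (simple_intE fA AF); last exact: fsimple_dist.
  move=> /(le_lt_trans (ler_norm _))/ltW h.
  by apply/(umean_leP _ (fsimple_nu (fsimple_dist (su n) (su m)))).
split => // [n|e e0]; first exact/simpleP.
have e20 : 0 < e / 2 by rewrite divr_gt0.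
have [M MP] := uc _ e20; exists M => n m Mn Mm.
have sd := fsimple_dist (us n) (us m); rewrite (simple_intE fA AF)//.
have le : nu (fun k => `|u n k - u m k|) <= e / 2.
  by apply/(umean_leP _ (fsimple_nu sd)); exact: MP.
rewrite ger0_norm.
  by apply: le_lt_trans le _; rewrite ltr_pdivrMr// ltr_pMr// ltr1n.
by apply: (@umean_le_ge0 _ (fun k => `|u n k - u m k|)) => //; exact/umean_cvg/fsimple_nu.
Qed.

(** Truncated at a fixed level, a sequence small in upper density is small in
    upper mean. *)
Lemma kyfan_cvg_trunc u f K e : 0 <= K -> kyfan_cvg u f -> 0 < e -> exists M : nat,
  forall n, (M <= n)%N -> umean_le (fun k => Num.min `|u n k - f k| K) e.
Proof.
move=> K0 uf e0; have L0 : 0 < 1 + K by rewrite ltr_pwDl.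
have d0 : 0 < e / (1 + K) by rewrite divr_gt0.
have [M MP] := uf _ d0; exists M => n /MP he.
have -> : e = e / (1 + K) + K * (e / (1 + K)) by field; rewrite gt_eqF.
apply: umean_le_split he => //; first exact: ltW.
  by move=> k /= /negP; rewrite -leNgt => h; rewrite ge_min h.
by move=> k _; rewrite ge_min lexx orbT.
Qed.

Section Determining.
Variables (u : nat -> posnat -> R) (f : posnat -> R).
Hypotheses (f0 : forall k, 0 <= f k) (uf : determining A u f).

Let us n : fsimple A (u n). Proof. by have /determiningP[] := uf. Qed.
Let uh : kyfan_cvg u f. Proof. by have /determiningP[_ /hazily_kyfan_cvg] := uf. Qed.
Let uc e : 0 < e -> exists M : nat, forall n m, (M <= n)%N -> (M <= m)%N ->
  umean_le (fun k => `|u n k - u m k|) e.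
Proof. by have /determiningP[_ _] := uf; apply. Qed.

Lemma determining_cvgn : cvgn (fun n => nu (u n)).
Proof.
apply/cauchy_cvgP/cauchy_exP => e e0; have e20 : 0 < e / 2 by rewrite divr_gt0.
have [M MP] := uc e20; exists (nu (u M)); exists M => // n /= Mn.
rewrite /ball/=; apply: (@le_lt_trans _ _ (e / 2)); last first.
  by rewrite ltr_pdivrMr// ltr_pMr// ltr1n.
have key i j : (M <= i)%N -> (M <= j)%N -> nu (u i) - nu (u j) <= e / 2.
  move=> Mn' Mm; have := cvg_nuD (fsimple_nu (us i)) (cvg_nuZ (c := -1) (fsimple_nu (us j))).
  rewrite mulN1r => /cvg_le_umean; apply.
  apply: umean_le_trans (MP _ _ Mn' Mm) => // k.
  by rewrite mulN1r ler_norm.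
by rewrite ler_norml key// andbT lerNl opprB key.
Qed.

(** The negative part of [u n] is at most its distance to the nonnegative
    limit, and this distance is estimated through a later term, truncated at
    the bound of [u n]. *)
Lemma determining_neg e : 0 < e -> exists M : nat, forall n, (M <= n)%N ->
  umean_le (fun k => Num.max (- u n k) 0) e.
Proof.
move=> /uc[M MP]; exists M => n Mn; apply: umean_le_closed => d d0.
have [K K0 uK] := fsimple_bounded (us n).
have [M' MP'] := kyfan_cvg_trunc K0 uh d0.
have := umean_leD (MP _ (maxn M M') Mn (leq_maxl _ _)) (MP' _ (leq_maxr M M')).
apply: umean_le_trans => // k.
have := uK k; rewrite ler_norml => /andP[uK1 uK2].
move: (maxn M M') => m.
have h1 : u m k - u n k <= `|u n k - u m k| by rewrite distrC ler_norm.
have h2 : f k - u m k <= `|u m k - f k| by rewrite distrC ler_norm.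
have := normr_ge0 (u n k - u m k); have := normr_ge0 (u m k - f k); have := f0 k.
by case: (leP (- u n k)) => ?; case: (leP `|u m k - f k|) => ?; lra.
Qed.

(** Both inequalities compare [u n] with a truncation of [f]; the passage
    through a later term of the sequence is needed because the mean of the
    distance from [u n] to [f] itself may be infinite. *)
Lemma determining_intP I c : (fun n => nu (u n)) @ \oo --> I ->
  I <= c <-> trunc_le f c.
Proof.
move=> uI; split=> [Ic|fc]; last first.
  apply/ler_addgt0Pr => e e0; have e20 : 0 < e / 2 by rewrite divr_gt0.
  have [M MP] := uc e20.
  apply: (cvgr_to_le uI); exists M => // n /= Mn.
  have [K K0 uK] := fsimple_bounded (us n).
  have [M' MP'] := kyfan_cvg_trunc K0 uh e20.
  apply: (cvg_le_umean (fsimple_nu (us n))).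
  have := umean_leD (umean_leD (fc _ K0) (MP _ (maxn M M') Mn (leq_maxl _ _)))
    (MP' _ (leq_maxr M M')).
  apply: umean_le_trans => [k|]; last by lra.
  have := uK k; rewrite ler_norml => /andP[uK1 uK2].
  move: (maxn M M') => m.
  have h1 : u n k - u m k <= `|u n k - u m k| by rewrite ler_norm.
  have h2 : u m k - f k <= `|u m k - f k| by rewrite ler_norm.
  have := normr_ge0 (u n k - u m k); have := normr_ge0 (u m k - f k); have := f0 k.
  by case: (leP (f k)) => ?; case: (leP `|u m k - f k|) => ?; lra.
move=> M M0; apply: (@umean_le_closed _ _ c) => e e0.
have e40 : 0 < e / 4 by rewrite divr_gt0.
have [n1 nP1] := determining_neg e40.
have [n2 nP2] := kyfan_cvg_trunc M0 uh e40.
have /cvgrPdist_le/(_ _ e40)[n3 _ nP3] := uI.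
pose n := maxn n1 (maxn n2 n3).
have n1n : (n1 <= n)%N by rewrite leq_maxl.
have n2n : (n2 <= n)%N by rewrite leq_max leq_maxl orbT.
have n3n : (n3 <= n)%N by rewrite leq_max leq_maxr orbT.
have un : umean_le (u n) (c + e / 4).
  apply/(umean_leP _ (fsimple_nu (us n))).
  have := nP3 _ n3n; rewrite /= distrC => /(le_trans (ler_norm _)).
  by rewrite lerBlDr => /le_trans; apply; rewrite addrC lerD2r.
have := umean_leD (umean_leD un (umean_leD (nP1 _ n1n) (nP1 _ n1n))) (nP2 _ n2n).
apply: umean_le_trans => [k|]; last by lra.
have h1 : f k - u n k <= `|u n k - f k| by rewrite distrC ler_norm.
have := normr_ge0 (u n k - f k); have := f0 k.
by case: (leP (f k)) => ?; case: (leP (- u n k)) => ?; case: (leP `|u n k - f k|) => ?; lra.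
Qed.

End Determining.

(** In particular all determining sequences give the same integral. *)
Lemma fa_integralP f c : (forall k, 0 <= f k) -> fa_integrable A f ->
  fa_integral A f <= c <-> trunc_le f c.
Proof.
move=> f0 [u uf]; rewrite /fa_integral; set S := (X in get X).
have us v : determining A v f -> (fun n => simple_int A (v n)) = (fun n => nu (v n)).
  move=> /determiningP[vs _ _]; apply/funext => n; exact: simple_intE.
have [v vf] : S (get S).
  apply: getPex; exists (limn (fun n => nu (u n))), u => //.
  by rewrite us//; exact: determining_cvgn uf.
by rewrite us// => vI; exact: determining_intP vI.
Qed.

Lemma fa_integral_ge0 f : (forall k, 0 <= f k) -> fa_integrable A f ->
  0 <= fa_integral A f.
Proof.
move=> f0 fi; have := lexx (fa_integral A f); move=> /(fa_integralP _ f0 fi).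
move=> /(_ 0 (lexx _)); apply: umean_le_ge0 => k.
by rewrite le_min f0 lexx.
Qed.

End Integral.

(** * The spaces L_p *)

Section Integrability.
Variables (R : realType) (A : set (set posnat)).
Hypotheses (fA : set_field A) (AF : A `<=` densF R).
Implicit Types (f g h s : posnat -> R) (a b c d e K M p r x y : R) (E F : set posnat).

(** Clipping an approximant to the range of the truncated function does not
    increase the error. *)
Lemma clip_dist x y K : 0 <= x -> 0 <= K ->
  `|Num.max 0 (Num.min y K) - Num.min x K| <= `|x - y| /\
  `|Num.max 0 (Num.min y K) - Num.min x K| <= K.
Proof.
move=> x0 K0; have h1 : x - y <= `|x - y| by rewrite ler_norm.
have h2 : y - x <= `|x - y| by rewrite distrC ler_norm.
rewrite !ler_norml; case: (leP y K) => ?; case: (leP x K) => ?;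
  case: (leP 0 y) => ?; case: (leP 0 K) => ?; split; lra.
Qed.

(** Truncations at the integer levels have increasing bounded means, so they
    are Cauchy in mean. Each is approximated by a simple function with values
    in the same range; the error [q n * q n] compensates for that range. *)
Lemma fa_integrable_trunc f c : (forall k, 0 <= f k) -> fmeas A f ->
  trunc_le f c -> fa_integrable A f.
Proof.
move=> f0 fa fc; pose q (n : nat) : R := n.+1%:R^-1.
have q0 n : 0 < q n by rewrite invr_gt0.
have q1 n : q n <= 1 by rewrite invf_le1// ler1n.
pose t (n : nat) k := Num.min (f k) n%:R.
have t0 n k : 0 <= t n k by rewrite min_ge0.
have /choice[s sP] : forall n, exists s, fsimple A s /\ exists C,
    [/\ A C, dens_le C (q n * q n) & forall k, ~ C k -> `|f k - s k| <= q n * q n].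
  by move=> n; have [s [C [? ? ? ?]]] := fa _ (mulr_gt0 (q0 n) (q0 n));
    exists s; split=> //; exists C.
pose u n k := Num.max 0 (Num.min (s n k) n%:R).
have us n : fsimple A (u n).
  by apply: (fsimple_comp fA (fun x => Num.max 0 (Num.min x n%:R))); have [] := sP n.
have ut n : umean_le (fun k => `|u n k - t n k|) (q n).
  have [_ [C [AC Ce fs]]] := sP n.
  have -> : q n = q n * q n + n%:R * (q n * q n).
    rewrite -{1}[q n * q n]mul1r -mulrDl addrC natr1 mulrA.
    by rewrite /q divff ?mul1r// pnatr_eq0.
  apply: umean_le_split Ce => //; first by rewrite mulr_ge0// ltW.
    move=> k /fs; apply: le_trans.
    by have [] := @clip_dist (f k) (s n k) n%:R (f0 k) (ler0n _ _).
  by move=> k _; have [] := @clip_dist (f k) (s n k) n%:R (f0 k) (ler0n _ _).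
have tc n : cvgn (fun N => nuN N (t n)).
  apply: (@fmeas_bounded_cvgn _ _ fA AF _ n%:R); last exact: fmeas_min.
  by move=> k; rewrite ger0_norm// ge_min lexx orbT.
have tmono n m : (n <= m)%N -> umean_le (fun k => `|t n k - t m k|) (nu (t m) - nu (t n)).
  move=> nm; have := umean_leD (umean_cvg (tc m)) (umean_cvg (cvg_nuZ (c := -1) (tc n))).
  rewrite mulN1r; apply: umean_le_trans => // k.
  rewrite mulN1r distrC ger0_norm// subr_ge0 le_min !ge_min lexx/= ler_nat nm orbT.
  by [].
have nut : cvgn (fun n => nu (t n)).
  apply: nondecreasing_is_cvgn.
    move=> n m nm; rewrite -subr_ge0; apply: umean_le_ge0 (tmono _ _ nm) => k.
    exact: normr_ge0.
  exists c => _ [n _ <-]; apply/(umean_leP _ (tc n)); exact: fc.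
have uf : kyfan_cvg u f.
  move=> e e0; have e20 : 0 < e / 2 by rewrite divr_gt0.
  have [K [C [K0 AC Ce fK]]] := fmeas_tight fa e20.
  have [M _ MP] : \forall n \near \oo, K <= n%:R /\ q n < e / 2.
    by near=> n; split; near: n; [exact: nbhs_infty_ger|
      exact: (near_infty_natSinv_lt (PosNum e20))].
  exists M => n /MP[Kn qn]; have [_ [D [AD De fs]]] := sP n.
  have qq : q n * q n <= e / 2.
    by apply: le_trans (ltW qn); rewrite ler_piMr// ltW.
  rewrite /kyfan [X in dens_le _ X]splitr.
  apply: dens_le_sub (dens_leU (dens_leW qq De) Ce) => // k /= ek.
  apply: contrapT => nDC; move: ek; apply/negP; rewrite -leNgt.
  have /fs fsk : ~ D k by move=> ?; apply: nDC; left.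
  have /fK fk : ~ C k by move=> ?; apply: nDC; right.
  have tk : t n k = f k.
    by rewrite /t min_l// (le_trans _ Kn)// (le_trans _ fk)// ler_norm.
  have [h _] := @clip_dist (f k) (s n k) n%:R (f0 k) (ler0n _ _).
  rewrite -{1}tk; apply: le_trans h _; apply: le_trans fsk _.
  by rewrite (le_trans qq)// ler_pdivrMr// ler_pMr// ler1n.
exists u; apply/determiningP => //; split => //.
  by apply: kyfan_cvg_hazily => // n; exact: fmeas_fsimple.
move=> e e0; have e40 : 0 < e / 4 by rewrite divr_gt0.
have [M _ MP] : \forall n \near \oo, `|limn (fun n => nu (t n)) - nu (t n)| <= e / 4 /\
    q n < e / 4.
  near=> n; split; near: n; first exact: cvgr_dist_le.
  exact: (near_infty_natSinv_lt (PosNum e40)).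
exists M => n m /MP[nl qn] /MP[ml qm].
have tnm : umean_le (fun k => `|t n k - t m k|) (e / 4 + e / 4).
  have le : `|nu (t n) - nu (t m)| <= e / 4 + e / 4.
    rewrite -[nu (t n)](subrK (limn (fun n => nu (t n)))) -addrA.
    by rewrite (le_trans (ler_normD _ _))// lerD// distrC.
  have /orP[nm|mn] := leq_total n m.
    apply: umean_le_trans (tmono _ _ nm) => //.
    by apply: le_trans le; rewrite distrC ler_norm.
  apply: umean_le_trans (tmono _ _ mn) => [k|]; first by rewrite distrC.
  by apply: le_trans le; rewrite ler_norm.
have := umean_leD (umean_leD (ut n) (ut m)) tnm.
apply: umean_le_trans => [k|]; last by lra.
have := ler_normD (u n k - t n k) (t n k - t m k).
have := ler_normD (u n k - t n k + (t n k - t m k)) (t m k - u m k).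
rewrite (distrC (t m k) (u m k)).
have -> : u n k - t n k + (t n k - t m k) + (t m k - u m k) = u n k - u m k by ring.
by lra.
Unshelve. all: by end_near. Qed.

Lemma abs_powB p f g : abs_pow p (f - g) = abs_pow p (fun k => f k - g k).
Proof. by []. Qed.

Section LpSpace.
Variable p : R.
Hypothesis hp : p = 0 \/ 1 <= p.

(** Together with [eq_aeP] and [fdist_LpP] this expresses the space by
    measurability and by [pnorm_le]; the field occurs only in the former. *)
Lemma fcar_LpP f :
  fcar (Lp_space A p) f <-> fmeas A f /\ exists r, pnorm_le p f r.
Proof.
rewrite /Lp_space; case: hp => [p0|p1].
  rewrite p0 eqxx /=; split=> [/(T1P fA AF) fa|[/(T1P fA AF)]//].
  split => //; exists 1; apply/pnorm0P; split=> // r' r1.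
  exists (r' - 1); first by rewrite subr_gt0.
  by have -> : r' - (r' - 1) = 1; [ring|exact: dens_le1].
have pgt : 0 < p by exact: lt_le_trans p1.
rewrite gt_eqF//=; split=> [[/(T1P fA AF) fa fi]|[fa [r /(pnorm1P _ _ p1)[r0 fr]]]].
  split => //; exists (fa_integral A (abs_pow p f) `^ p^-1).
  have I0 := fa_integral_ge0 fA AF (abs_pow_ge0 p f) fi.
  apply/pnorm1P => //; split; first exact: powR_ge0.
  by rewrite powR_root//; apply/(fa_integralP fA AF _ (abs_pow_ge0 p f) fi).
split; first exact/(T1P fA AF).
apply: fa_integrable_trunc fr; first exact: abs_pow_ge0.
exact: fmeas_abs_pow.
Qed.

Lemma eq_aeP f g : fmeas A f -> fmeas A g ->
  eq_ae A f g <-> pnorm_le p (fun k => f k - g k) 0.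
Proof.
move=> fa ga; rewrite (pnorm_le0P hp); split=> fg e e0.
  by apply: (nu_out_dens_le fA AF); rewrite fg.
apply/eqP; rewrite eq_le nu_out_ge0// andbT.
have e20 : 0 < e / 2 by rewrite divr_gt0.
apply: (nu_out_fmeas fA AF _ (fmeasB fA fa ga) (fg _ e20)).
by rewrite ltr_pdivrMr// ltr_pMr// ltr1n.
Qed.

Lemma feqv_LpP f g : fmeas A f -> fmeas A g ->
  feqv (Lp_space A p) f g <-> pnorm_le p (fun k => f k - g k) 0.
Proof.
have -> : feqv (Lp_space A p) f g = eq_ae A f g by rewrite /Lp_space; case: ifP.
exact: eq_aeP.
Qed.

Lemma L0_distP f g r : fmeas A f -> fmeas A g -> 0 <= r ->
  L0_dist A f g <= r <-> pnorm_le 0 (fun k => f k - g k) r.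
Proof.
move=> fa ga r0; rewrite /L0_dist; set S := (X in inf X).
have S1 : S !=set0 by eexists; exists 1; first exact: ltr01.
have Slb : has_lbound S.
  exists 0 => _ [e /= e0 <-]; rewrite addr_ge0 ?(ltW e0)//; exact: nu_out_ge0.
split=> [Sr|/pnorm0P[_ fgr]].
  apply/pnorm0P; split=> // r' rr'.
  have [_ [e /= e0 <-] er'] := inf_lt S1 (le_lt_trans Sr rr').
  exists e => //; apply: (nu_out_dens_le fA AF).
  by rewrite lerBrDr addrC ltW.
apply/ler_addgt0Pr => d d0; have d20 : 0 < d / 2 by rewrite divr_gt0.
have [|e e0 fge] := fgr (r + d / 2); first by rewrite ltrDl.
have ee : e < e + d / 2 by rewrite ltrDl.
have := nu_out_fmeas fA AF ee (fmeasB fA fa ga) fge => le.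
apply: (@le_trans _ _ (e + d / 2 + nu_out R A [set k | e + d / 2 < `|f k - g k|])).
  by apply: ge_inf => //; exists (e + d / 2) => //=; exact: addr_gt0.
by move: le; lra.
Qed.

Lemma fdist_LpP f g r : fcar (Lp_space A p) f -> fcar (Lp_space A p) g -> 0 <= r ->
  fdist (Lp_space A p) f g <= r <-> pnorm_le p (fun k => f k - g k) r.
Proof.
move=> /fcar_LpP[fa [a fp]] /fcar_LpP[ga [b gp]] r0.
have fgp := pnorm_leD hp fp (pnorm_leN hp gp).
rewrite /Lp_space; case: hp => [p0|p1]; first by rewrite p0 eqxx; exact: L0_distP.
have pgt : 0 < p by exact: lt_le_trans p1.
rewrite gt_eqF//= abs_powB pnorm1P//.
have h0 := abs_pow_ge0 p (fun k => f k - g k).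
have fi : fa_integrable A (abs_pow p (fun k => f k - g k)).
  have /(pnorm1P _ _ p1)[_] := fgp; apply: fa_integrable_trunc => //.
  by apply: fmeas_abs_pow => //; exact: fmeasB.
rewrite root_le_powR//; last exact: fa_integral_ge0.
by rewrite (fa_integralP fA AF _ h0 fi); split => [|[]].
Qed.

Lemma fdist_Lp_ge0 f g : fcar (Lp_space A p) f -> fcar (Lp_space A p) g ->
  0 <= fdist (Lp_space A p) f g.
Proof.
move=> /fcar_LpP[fa [a fp]] /fcar_LpP[ga [b gp]].
rewrite /Lp_space; case: ifP => _ /=; last exact: powR_ge0.
apply: lb_le_inf; first by eexists; exists 1; first exact: ltr01.
by move=> _ [e /= e0 <-]; rewrite addr_ge0 ?(ltW e0)//; exact: nu_out_ge0.
Qed.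

End LpSpace.
End Integrability.

(** * Quotients of function spaces *)

Section FunctionSpaces.
Variables (R : realType) (p : R).
Hypothesis hp : p = 0 \/ 1 <= p.
Implicit Types (f g h : posnat -> R) (a e r s x y : R) (X Y : fspace R).
Implicit Types (c : set (posnat -> R)).

Definition pdist_le f g r : Prop := pnorm_le p (fun k => f k - g k) r.

Lemma pdist_le_refl f r : 0 <= r -> pdist_le f f r.
Proof.
move=> r0; apply: (pnorm_leW hp r0); apply/(pnorm_le0P hp) => e e0.
apply: (@dens_le_sub _ _ set0 0) => //; last exact/null_dens/nullN0.
by move=> k /=; rewrite subrr normr0 ltNge ltW.
Qed.

Lemma pdist_le_sym f g r : pdist_le f g r -> pdist_le g f r.
Proof.
by move=> /(pnorm_leN hp); apply: pnorm_le_trans => // k; rewrite opprB.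
Qed.

Lemma pdist_le_trans f g h r s :
  pdist_le f g r -> pdist_le g h s -> pdist_le f h (r + s).
Proof.
move=> fg gh; have := pnorm_leD hp fg gh; apply: pnorm_le_trans => // k.
by rewrite addrA subrK.
Qed.

Lemma pdist_le_trans0 f g h r : pdist_le f g 0 -> pdist_le g h r -> pdist_le f h r.
Proof. by move=> fg gh; rewrite -[r]add0r; exact: pdist_le_trans gh. Qed.

Lemma pdist_le_transr0 f g h r : pdist_le f g r -> pdist_le g h 0 -> pdist_le f h r.
Proof. by move=> fg gh; rewrite -[r]addr0; exact: pdist_le_trans gh. Qed.

(** Distances do not depend on representatives. *)
Lemma pdist_le_congr f f' g g' r : pdist_le f f' 0 -> pdist_le g g' 0 ->
  pdist_le f g r <-> pdist_le f' g' r.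
Proof.
move=> ff' gg'; split=> fg.
  by apply: pdist_le_trans0 (pdist_le_sym ff') _; exact: pdist_le_transr0 gg'.
by apply: (pdist_le_trans0 ff'); apply: pdist_le_transr0 fg (pdist_le_sym gg').
Qed.

Lemma pdist0D f f' g g' : pdist_le f f' 0 -> pdist_le g g' 0 ->
  pdist_le (f + g) (f' + g') 0.
Proof.
move=> ff' gg'; have := pnorm_leD hp ff' gg'; rewrite addr0.
by apply: pnorm_le_trans => // k; rewrite opprD addrACA.
Qed.

Lemma negl_scale a f : negl f -> negl (fun k => a * f k).
Proof.
move=> f0 e e0; have a1 : 0 < `|a| + 1 by rewrite ltr_wpDl.
apply: dens_le_sub (f0 _ (divr_gt0 e0 a1)) => // k /=.
rewrite normrM ltr_pdivrMr// => h; apply: lt_le_trans h _.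
by rewrite mulrC ler_wpM2l// lerDl.
Qed.

Lemma pdist0Z a f f' : pdist_le f f' 0 -> pdist_le (a *: f) (a *: f') 0.
Proof.
move=> /(pnorm_le0P hp)/(negl_scale a)/(pnorm_le0P hp).
by apply: pnorm_le_trans => // k; rewrite mulrBr.
Qed.

(** The structure and the distance of [X] are those induced from all functions
    by the common pseudometric. *)
Definition pnormed X : Prop :=
  [/\ fcar X 0, forall f g, fcar X f -> fcar X g -> fcar X (f + g),
      forall a f, fcar X f -> fcar X (a *: f)
    & forall f g, fcar X f -> fcar X g ->
        [/\ feqv X f g <-> pdist_le f g 0, 0 <= fdist X f g
          & forall r, 0 <= r -> fdist X f g <= r <-> pdist_le f g r]].

(** Distances are known through their upper bounds only. *)
Lemma eq_by_bounds x y : 0 <= x -> 0 <= y ->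
  (forall r, 0 <= r -> x <= r <-> y <= r) -> x = y.
Proof.
move=> x0 y0 xy; apply/eqP; rewrite eq_le; apply/andP; split.
  by apply/(xy y y0).
by apply/(xy x x0).
Qed.

Section OneSpace.
Variable X : fspace R.
Hypothesis nX : pnormed X.

Let X0 : fcar X 0. Proof. by case: nX. Qed.
Let XD f g : fcar X f -> fcar X g -> fcar X (f + g). Proof. by case: nX => _ + _ _; apply. Qed.
Let XZ a f : fcar X f -> fcar X (a *: f). Proof. by case: nX => _ _ + _; apply. Qed.
Let Xeqv f g : fcar X f -> fcar X g -> feqv X f g <-> pdist_le f g 0.
Proof. by case: nX => _ _ _ XP Xf Xg; have [] := XP f g Xf Xg. Qed.

Lemma fclassP f g : fcar X f -> fclass X f g <-> fcar X g /\ pdist_le f g 0.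
Proof. by move=> Xf; split=> -[Xg /(Xeqv Xf Xg)]. Qed.

Lemma fclass_eq f g : fcar X f -> fcar X g ->
  fclass X f = fclass X g <-> pdist_le f g 0.
Proof.
move=> Xf Xg; split=> [fg|fg].
  have : fclass X g g.
    by apply/(fclassP _ Xg); split; [exact: Xg|exact: pdist_le_refl].
  by rewrite -fg => /(fclassP _ Xf)[].
apply/seteqP; split=> h.
  move=> /(fclassP _ Xf)[Xh fh]; apply/(fclassP _ Xg); split; first exact: Xh.
  exact: pdist_le_trans0 (pdist_le_sym fg) fh.
move=> /(fclassP _ Xg)[Xh gh]; apply/(fclassP _ Xf); split; first exact: Xh.
exact: pdist_le_trans0 fg gh.
Qed.

(** The representative that the operations on classes use is at distance zero. *)
Lemma get_fclass f : fcar X f ->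
  fcar X (get (fclass X f)) /\ pdist_le f (get (fclass X f)) 0.
Proof.
move=> Xf; apply/fclassP => //; apply: getPex; exists f; apply/fclassP => //.
by split => //; exact: pdist_le_refl.
Qed.

Lemma qaddE f g : fcar X f -> fcar X g ->
  qadd X (fclass X f) (fclass X g) = fclass X (f + g).
Proof.
move=> Xf Xg; have [Xf' ff'] := get_fclass Xf; have [Xg' gg'] := get_fclass Xg.
apply/fclass_eq; [exact: XD|exact: XD|].
by apply: pdist0D; exact: pdist_le_sym.
Qed.

Lemma qscaleE a f : fcar X f -> qscale X a (fclass X f) = fclass X (a *: f).
Proof.
move=> Xf; have [Xf' ff'] := get_fclass Xf.
apply/fclass_eq; [exact: XZ|exact: XZ|].
by apply: pdist0Z; exact: pdist_le_sym.
Qed.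

Lemma qdist_ge0 f g : fcar X f -> fcar X g -> 0 <= qdist X (fclass X f) (fclass X g).
Proof.
move=> Xf Xg; have [Xf' _] := get_fclass Xf; have [Xg' _] := get_fclass Xg.
by case: nX => _ _ _ /(_ _ _ Xf' Xg')[].
Qed.

Lemma qdistP f g r : fcar X f -> fcar X g -> 0 <= r ->
  qdist X (fclass X f) (fclass X g) <= r <-> pdist_le f g r.
Proof.
move=> Xf Xg r0; have [Xf' ff'] := get_fclass Xf; have [Xg' gg'] := get_fclass Xg.
rewrite (pdist_le_congr r ff' gg').
by case: nX => _ _ _ /(_ _ _ Xf' Xg')[_ _]; apply.
Qed.

Definition pcauchy (u : nat -> posnat -> R) : Prop :=
  forall e, 0 < e -> exists M : nat, forall n m, (M <= n)%N -> (M <= m)%N ->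
    pdist_le (u n) (u m) e.

Definition pcvg (u : nat -> posnat -> R) f : Prop :=
  forall e, 0 < e -> exists M : nat, forall n, (M <= n)%N -> pdist_le (u n) f e.

Lemma qcompleteP : qcomplete X <->
  forall u, (forall n, fcar X (u n)) -> pcauchy u -> exists2 f, fcar X f & pcvg u f.
Proof.
split=> [cX u uX uc|cX v vX vc].
  have [n|e e0|_ [f Xf <-] uf] := cX (fun n => fclass X (u n)).
  - by exists (u n).
  - have e20 : 0 < e / 2 by rewrite divr_gt0.
    have [M MP] := uc _ e20; exists M => n m Mn Mm.
    apply: (@le_lt_trans _ _ (e / 2)); first by apply/qdistP; rewrite ?(ltW e20)//; exact: MP.
    by rewrite ltr_pdivrMr// ltr_pMr// ltr1n.
  - exists f => // e e0; have /cvgrPdist_le/(_ _ e0)[M _ MP] := uf.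
    exists M => n /MP /=; rewrite sub0r normrN ger0_norm ?qdist_ge0// => h.
    by apply/qdistP => //; exact: ltW.
have /choice[u uP] : forall n, exists f, fcar X f /\ fclass X f = v n.
  by move=> n; have [f Xf <-] := vX n; exists f.
have uX n : fcar X (u n) by have [] := uP n.
have uv n : fclass X (u n) = v n by have [] := uP n.
have [e e0|f Xf uf] := cX u uX.
  have [M MP] := vc _ e0; exists M => n m Mn Mm.
  by apply/qdistP; rewrite ?(ltW e0)// !uv; apply/ltW; exact: MP.
exists (fclass X f); first by exists f.
apply/cvgrPdist_le => e e0; have [M MP] := uf _ e0; exists M => // n /MP h.
rewrite /= sub0r normrN -uv ger0_norm ?qdist_ge0//.
by apply/qdistP => //; exact: ltW.
Qed.

End OneSpace.

Definition represents X Y : Prop :=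
  forall f, fcar X f -> exists2 g, fcar Y g & pdist_le f g 0.

(** Sends a class of [X] to the class in [Y] of the functions at distance zero
    from it, so that neither space has to contain the other. *)
Definition transfer Y c : set (posnat -> R) :=
  [set g | fcar Y g /\ exists2 f, c f & pdist_le f g 0].

Section TwoSpaces.
Variables X Y : fspace R.
Hypotheses (nX : pnormed X) (nY : pnormed Y).

Let YD f g : fcar Y f -> fcar Y g -> fcar Y (f + g). Proof. by case: nY => _ + _ _; apply. Qed.
Let YZ a f : fcar Y f -> fcar Y (a *: f). Proof. by case: nY => _ _ + _; apply. Qed.
Let XD f g : fcar X f -> fcar X g -> fcar X (f + g). Proof. by case: nX => _ + _ _; apply. Qed.
Let XZ a f : fcar X f -> fcar X (a *: f). Proof. by case: nX => _ _ + _; apply. Qed.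

Lemma transferE f g : fcar X f -> fcar Y g -> pdist_le f g 0 ->
  transfer Y (fclass X f) = fclass Y g.
Proof.
move=> Xf Yg fg; apply/seteqP; split=> h.
  move=> [Yh [f' /(fclassP nX _ Xf)[Xf' ff'] f'h]].
  apply/(fclassP nY _ Yg); split; first exact: Yh.
  apply: pdist_le_trans0 (pdist_le_sym fg) _.
  exact: pdist_le_trans0 ff' f'h.
move=> /(fclassP nY _ Yg)[Yh gh]; split; [exact: Yh|exists f].
  by apply/(fclassP nX _ Xf); split; [exact: Xf|exact: pdist_le_refl].
exact: pdist_le_trans0 fg gh.
Qed.

Lemma transfer_iso : represents X Y ->
  isometric_iso X Y (transfer Y @` fquot X) (transfer Y).
Proof.
move=> rXY; split.
- split; first by move=> c Xc; exists c.
  + move=> c1 c2 /set_mem[f Xf <-] /set_mem[g Xg <-].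
    have [f' Yf' ff'] := rXY _ Xf; have [g' Yg' gg'] := rXY _ Xg.
    rewrite (transferE Xf Yf' ff') (transferE Xg Yg' gg') => /(fclass_eq nY Yf' Yg').
    move=> fg'; apply/(fclass_eq nX Xf Xg).
    by apply/(pdist_le_congr 0 ff' gg'); exact: fg'.
  + by move=> _ [c Xc <-]; exists c.
- move=> _ _ [f Xf <-] [g Xg <-].
  have [f' Yf' ff'] := rXY _ Xf; have [g' Yg' gg'] := rXY _ Xg.
  rewrite (qaddE nX)// (transferE Xf Yf' ff') (transferE Xg Yg' gg') (qaddE nY)//.
  by apply: transferE; [exact: XD|exact: YD|exact: pdist0D].
- move=> a _ [f Xf <-]; have [f' Yf' ff'] := rXY _ Xf.
  rewrite (qscaleE nX)// (transferE Xf Yf' ff') (qscaleE nY)//.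
  by apply: transferE; [exact: XZ|exact: YZ|exact: pdist0Z].
- move=> _ _ [f Xf <-] [g Xg <-].
  have [f' Yf' ff'] := rXY _ Xf; have [g' Yg' gg'] := rXY _ Xg.
  rewrite (transferE Xf Yf' ff') (transferE Xg Yg' gg').
  apply: eq_by_bounds; [exact: qdist_ge0|exact: qdist_ge0|].
  move=> r r0; rewrite (qdistP nY Yf' Yg' r0) (qdistP nX Xf Xg r0).
  exact: iff_sym (pdist_le_congr r ff' gg').
Qed.

Lemma transfer_image : represents X Y -> represents Y X ->
  transfer Y @` fquot X = fquot Y.
Proof.
move=> rXY rYX; apply/seteqP; split=> [_ [_ [f Xf <-] <-]|_ [g Yg <-]].
  by have [g Yg fg] := rXY _ Xf; exists g => //; rewrite (transferE Xf Yg fg).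
have [f Xf gf] := rYX _ Yg; exists (fclass X f); first by exists f.
exact: (transferE Xf Yg (pdist_le_sym gf)).
Qed.

Lemma represents_isometric : represents X Y -> represents Y X -> isometric X Y.
Proof.
move=> rXY rYX; exists (transfer Y); rewrite -(transfer_image rXY rYX).
exact: transfer_iso.
Qed.

Lemma represents_complete : represents X Y -> represents Y X ->
  qcomplete Y -> qcomplete X.
Proof.
move=> rXY rYX /(qcompleteP nY) cY; apply/(qcompleteP nX) => u uX uc.
have /choice[v vP] : forall n, exists g, fcar Y g /\ pdist_le (u n) g 0.
  by move=> n; have [g] := rXY _ (uX n); exists g.
have [n|e /uc[M MP]|g Yg vg] := cY v; first by have [] := vP n.
  exists M => n m Mn Mm; have [_ un] := vP n; have [_ um] := vP m.
  by apply/(pdist_le_congr e un um); exact: MP.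
have [f Xf gf] := rYX _ Yg; exists f => // e /vg[M MP]; exists M => n /MP h.
by have [_ un] := vP n; apply: (pdist_le_trans0 un); exact: pdist_le_transr0 gf.
Qed.

Section Inclusion.
Hypothesis XY : fcar X `<=` fcar Y.

Lemma sub_represents : represents X Y.
Proof. by move=> f Xf; exists f; [exact: XY|exact: pdist_le_refl]. Qed.

Lemma transfer_canonical : canonical_map X Y (transfer Y).
Proof. by move=> f Xf; apply: transferE => //; [exact: XY|exact: pdist_le_refl]. Qed.

Lemma transfer_qsubspace : qsubspace Y (transfer Y @` fquot X).
Proof.
have [bPhi PhiD PhiZ _] := transfer_iso sub_represents.
have [X0 _ _ _] := nX.
split.
- move=> _ [_ [f Xf <-] <-]; rewrite transfer_canonical//.
  by exists f => //; exact: XY.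
- by exists (fclass X 0); [exists 0|rewrite transfer_canonical].
- move=> _ _ [c1 Xc1 <-] [c2 Xc2 <-]; rewrite -PhiD//; exists (qadd X c1 c2) => //.
  have [f Xf <-] := Xc1; have [g Xg <-] := Xc2; rewrite (qaddE nX)//.
  by exists (f + g) => //; exact: XD.
- move=> a _ [c Xc <-]; rewrite -PhiZ//; exists (qscale X a c) => //.
  by have [f Xf <-] := Xc; rewrite (qscaleE nX)//; exists (a *: f) => //; exact: XZ.
Qed.

Definition pdense : Prop := forall f e, fcar Y f -> 0 < e ->
  exists2 g, fcar X g & pdist_le f g e.

Lemma transfer_qdense : pdense -> qdense Y (transfer Y @` fquot X).
Proof.
move=> XYd _ [f Yf <-] e e0; have e20 : 0 < e / 2 by rewrite divr_gt0.
have [g Xg fg] := XYd _ _ Yf e20.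
exists (fclass Y g).
  by exists (fclass X g); [exists g|rewrite transfer_canonical].
apply: (@le_lt_trans _ _ (e / 2)).
  by apply/(qdistP nY) => //; [exact: XY|exact: ltW].
by rewrite ltr_pdivrMr// ltr_pMr// ltr1n.
Qed.

(** Approximants in the dense complete subspace form a Cauchy sequence, and
    their limit there is at distance zero from the given function. *)
Lemma complete_dense_represents : pdense -> qcomplete X -> represents Y X.
Proof.
move=> XYd /(qcompleteP nX) cX f Yf.
have /choice[u uP] : forall n : nat, exists g, fcar X g /\ pdist_le f g n.+1%:R^-1.
  by move=> n; have [|g] := XYd f n.+1%:R^-1 Yf; [rewrite invr_gt0|exists g].
have near_small e : 0 < e -> exists M : nat, forall n, (M <= n)%N -> pdist_le f (u n) e.
  move=> e0; have [M _ MP] := near_infty_natSinv_lt (PosNum e0).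
  by exists M => n /MP /= /ltW ne; have [_] := uP n; exact: pnorm_leW.
have [n|e e0|g Xg ug] := cX u; first by have [] := uP n.
  have e20 : 0 < e / 2 by rewrite divr_gt0.
  have [M MP] := near_small _ e20; exists M => n m /MP Mn /MP Mm.
  by rewrite [e]splitr; exact: pdist_le_trans (pdist_le_sym Mn) Mm.
exists g => //; apply: (pnorm_le_closed hp) => // e e0; rewrite add0r.
have e20 : 0 < e / 2 by rewrite divr_gt0.
have [M MP] := near_small _ e20; have [M' MP'] := ug _ e20.
rewrite [e]splitr; apply: pdist_le_trans (MP _ (leq_maxl M M')) _.
exact: MP' (leq_maxr M M').
Qed.

(** The map that keeps representatives is always an isometry, so only
    surjectivity is at stake. *)
Lemma canonical_isoP : (exists2 Phi, canonical_map X Y Phi &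
  isometric_iso X Y (fquot Y) Phi) <-> represents Y X.
Proof.
split=> [[Phi PhiC [[_ _ sPhi] _ _ _]] g Yg|rYX].
  have [_ [f Xf <-]] : (Phi @` fquot X) (fclass Y g) by apply: sPhi; exists g.
  rewrite PhiC// => /(fclass_eq nY (XY Xf) Yg) fg.
  by exists f => //; exact: pdist_le_sym.
exists (transfer Y); first exact: transfer_canonical.
by rewrite -(transfer_image sub_represents rYX); exact/transfer_iso/sub_represents.
Qed.

End Inclusion.
End TwoSpaces.
End FunctionSpaces.

(** * Approximation by simple functions *)

Section LebesgueSpaces.
Variables (R : realType) (A : set (set posnat)).
Hypotheses (fA : set_field A) (AF : A `<=` densF R).
Implicit Types (f g h s : posnat -> R) (a b c d e K M p r x y : R) (E F : set posnat).
Implicit Types u : nat -> posnat -> R.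

Lemma Lp_pnormed p : p = 0 \/ 1 <= p -> pnormed p (Lp_space A p).
Proof.
move=> hp; split.
- apply/(fcar_LpP fA AF hp); split; first exact/fmeas_fsimple/fsimple_cst.
  exists 0; apply: (pnorm_le_trans hp _ (lexx 0) (pdist_le_refl hp 0 (lexx 0))) => k.
  by rewrite subrr.
- move=> f g /(fcar_LpP fA AF hp)[fa [a fp]] /(fcar_LpP fA AF hp)[ga [b gp]].
  apply/(fcar_LpP fA AF hp); split; first exact: fmeasD.
  by exists (a + b); exact: pnorm_leD.
- move=> a f /(fcar_LpP fA AF hp)[fa [r fp]].
  apply/(fcar_LpP fA AF hp); split; first exact: fmeasZ.
  exact: (pnorm_leZ hp a fp).
- move=> f g Xf Xg; have [fa _] := iffLR (fcar_LpP fA AF hp _) Xf.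
  have [ga _] := iffLR (fcar_LpP fA AF hp _) Xg.
  split; [exact: feqv_LpP|exact: fdist_Lp_ge0|].
  by move=> r r0; exact: fdist_LpP.
Qed.

(** The finite unions increase and converge in upper density; the tail of the
    geometric series bounds the density of the limit. *)
Lemma null_union (D : nat -> set posnat) (m : nat) : (forall j, A (D j)) ->
  (forall j, dens_le (D j) ((2^-1 : R) ^+ j)) ->
  exists E, [/\ dens_cl R A E, dens_le E (4 * (2^-1 : R) ^+ m) &
    forall j, (m <= j)%N -> dens_le (D j `\` E) (0 : R)].
Proof.
move=> AD Dj; pose U k := \bigcup_(j in [set j | (m <= j < m + k)%N]) D j.
have US k : U k.+1 = U k `|` D (m + k)%N.
  apply/seteqP; split=> x.
    move=> [j /= /andP[mj]]; rewrite addnS ltnS leq_eqVlt => /predU1P[->|jk]; first by right.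
    by move=> Dx; left; exists j => //=; rewrite mj.
  move=> [[j /= /andP[mj jk] Dx]|Dx].
    by exists j => //=; rewrite mj addnS ltnS ltnW.
  by exists (m + k)%N => //=; rewrite leq_addr addnS ltnS leqnn.
have [A0 AC AU] := fA.
have U0 : U 0%N = set0.
  by rewrite -subset0 => x [j /= /andP[mj]]; rewrite addn0 ltnNge mj.
have UA k : A (U k).
  by elim: k => [|k IH]; [rewrite U0|rewrite US; exact: AU].
have Ud k : dens_le (U k) (2 * (2^-1 : R) ^+ m).
  suff : dens_le (U k) (\sum_(m <= j < m + k) (2^-1 : R) ^+ j).
    by apply: dens_leW; exact: sum_geometric_half_le.
  elim: k => [|k IH].
    by rewrite U0 addn0 big_geq//; exact/null_dens/nullN0.
  by rewrite addnS big_nat_recr ?leq_addr//= US; exact: dens_leU.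
have Ui : nondecreasing_seq (fun k => xi R (U k)).
  apply/nondecreasing_seqP => k; apply/xi_dens_le.
  rewrite US (_ : _ `\` _ = set0); first exact/null_dens/nullN0.
  by apply/seteqP; split=> x //= [Dx nDx]; apply: nDx; left.
have [E UE] := nondecreasing_dens_cvg (fun k => AF (UA k)) Ui.
exists E; split.
- by apply: dens_cl_dens_cvg UE => k; exact: sub_dens_cl.
- have m0 : 0 < 2 * (2^-1 : R) ^+ m by rewrite mulr_gt0// exprn_gt0.
  have [k /(_ k (leqnn k)) UkE] := UE _ m0.
  have -> : 4 * (2^-1 : R) ^+ m = 2 * 2^-1 ^+ m + 2 * 2^-1 ^+ m by ring.
  apply: dens_le_sub (dens_leU (Ud k) UkE) => // x; rewrite setY_def /= => Ex.
  by have := pselect (U k x); tauto.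
- move=> j mj; apply: (dens_cvg_lb (n := (j - m).+1) UE) => k jk.
  rewrite (_ : _ `\` _ = set0); first exact/null_dens/nullN0.
  rewrite -subset0 => x [Dx]; apply; exists j => //=.
  by rewrite mj/= -ltn_subLR.
Qed.

(** Replacing each level set by an approximation changes the function only on
    the union of the differences. The exceptional sets are kept in a class
    [G], which is the whole power set for the density closure and the field
    itself for the completion. *)
Lemma fsimple_approx (B G : set (set posnat)) s e :
  set_field B -> G set0 -> setU_closed G ->
  (forall E (d : R), B E -> 0 < d -> exists F X,
     [/\ A F, G X, dens_le X d & E `+` F `<=` X]) ->
  fsimple B s -> 0 < e ->
  exists t X, [/\ fsimple A t, G X, dens_le X e & forall k, ~ X k -> s k = t k].
Proof.
move=> fB G0 GU BA /(simpleP fB)[n [c [F [BF _ ->]]]].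
elim: n c F BF e => [|n IH] c F BF e e0.
  exists (fun=> 0), set0; split => //; first exact: fsimple_cst.
    by apply: dens_leW (ltW e0) _; exact/null_dens/nullN0.
  by move=> k _; rewrite big_ord0.
have e20 : 0 < e / 2 by rewrite divr_gt0.
have [|t [X [st GX Xe sX]]] := IH (fun i => c (widen_ord (leqnSn n) i))
  (fun i => F (widen_ord (leqnSn n) i)) _ _ e20; first by move=> k; exact: BF.
have [E [Y [AE GY Ye FEY]]] := BA _ _ (BF ord_max) e20.
exists (fun k => t k + c ord_max * \1_E k), (X `|` Y); split.
- apply: (fsimple_comp2 fA +%R) => //; apply: (fsimple_comp fA ( *%R (c ord_max))).
  exact: fsimple_indic.
- exact: GU.
- by rewrite [e]splitr; exact: dens_leU.
- move=> k nXY; rewrite big_ord_recr/=; congr (_ + _ * _).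
    by apply: sX => ?; apply: nXY; left.
  have : k \notin F ord_max `+` E.
    by apply/negbT/memNset => /FEY ?; apply: nXY; right.
  by rewrite in_setY !indicE; case: (k \in F _); case: (k \in E).
Qed.

Lemma fsimple_dens_cl_approx s e : fsimple (dens_cl R A) s -> 0 < e ->
  exists2 t, fsimple A t & dens_le [set k | s k != t k] e.
Proof.
move=> ss e0.
have cover E (d : R) : dens_cl R A E -> 0 < d -> exists F X,
    [/\ A F, [set: set posnat] X, dens_le X d & E `+` F `<=` X].
  by move=> clE /clE[B AB EB]; exists B, (E `+` B); split => //; exact: subset_refl.
have [//|//|t [X [st _ Xe sX]]] := fsimple_approx (dens_cl_field R fA) _ _ cover ss e0.
exists t => //; apply: dens_le_sub Xe => // k /= /eqP; apply: contra_notP.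
exact: sX.
Qed.

(** Sets of the completion are enclosed between sets of the field, so both the
    simple functions and the exceptional sets can be taken over the field. *)
Lemma fmeas_PJ_completion f : fmeas (PJ_completion R A) f -> fmeas A f.
Proof.
move=> fa e e0; have e40 : 0 < e / 4 by rewrite divr_gt0.
have fPJ := PJ_completion_field fA AF.
have [A0 _ AU] := fA.
have [s [C [ss PC Ce fs]]] := fa _ e40.
have cover E (d : R) : PJ_completion R A E -> 0 < d -> exists F X,
    [/\ A F, A X, dens_le X d & E `+` F `<=` X].
  move=> /(PJ_completionP _ fA AF) PE /PE[B [D [AB AD BE ED DB]]].
  exists B, (D `\` B); split => //; first exact: field_setD.
  move=> k; rewrite setY_def => -[[/ED Dk nBk]|[/BE Ek nEk]]; first by split.
  by case: nEk.
have [t [X [st AX Xe sX]]] := fsimple_approx fPJ A0 AU cover ss e40.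
have [B [D [AB AD BC CD DB]]] := iffLR (PJ_completionP _ fA AF) PC _ e40.
exists t, (D `|` X); split => //; first exact: AU.
  have := dens_leU (dens_leU Ce DB) Xe; apply: dens_le_sub => [k [Dk|]|]; last by lra.
    by have [/BC Ck|nBk] := pselect (B k); left; [left|right].
  by right.
move=> k nDX; rewrite -sX; last by move=> ?; apply: nDX; right.
have /fs/le_trans : ~ C k by move=> /CD ?; apply: nDX; left.
by apply; rewrite ler_pdivrMr// ler_pMr// ler1n.
Qed.

Lemma fmeas_dens_cl_kyfan f e : fmeas (dens_cl R A) f -> 0 < e ->
  exists2 s, fsimple A s & kyfan e f s.
Proof.
move=> fa e0; have e20 : 0 < e / 2 by rewrite divr_gt0.
have [s [C [ss AC Ce fs]]] := fa _ e20.
have [t st te] := fsimple_dens_cl_approx ss e20.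
exists t => //; rewrite /kyfan [X in dens_le _ X]splitr.
apply: dens_le_sub (dens_leU Ce te) => // k /= h.
apply: contrapT => nU; have /fs : ~ C k by move=> ?; apply: nU; left.
have -> : s k = t k.
  by apply/eqP; rewrite -[_ == _]negbK; apply/negP => h'; apply: nU; right.
by apply/negP; rewrite -ltNge (lt_trans _ h)// ltr_pdivrMr// ltr_pMr// ltr1n.
Qed.

End LebesgueSpaces.

(** * Completeness over the density closure *)

Section Completeness.
Variables (R : realType) (A : set (set posnat)).
Hypotheses (fA : set_field A) (AF : A `<=` densF R).
Implicit Types (f g h s : posnat -> R) (a b c d e K M r x y : R) (E F : set posnat).
Implicit Types u : nat -> posnat -> R.

Let clf : set_field (dens_cl R A). Proof. exact: dens_cl_field. Qed.
Let clF : dens_cl R A `<=` densF R. Proof. exact: dens_cl_densF. Qed.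
Let Acl : A `<=` dens_cl R A. Proof. exact: sub_dens_cl. Qed.

(** Consecutive approximants are close to each other when both are close to
    [f]. *)
Lemma fast_fsimple f : (forall e, 0 < e -> exists2 s, fsimple A s & kyfan e f s) ->
  exists s : nat -> posnat -> R, [/\ forall j, fsimple A (s j),
    forall j, kyfan (2^-1 ^+ j) f (s j) &
    forall j, dens_le [set k | 2^-1 ^+ j < `|s j k - s j.+1 k|] ((2^-1 : R) ^+ j)].
Proof.
move=> fs.
have /choice[s sP] : forall j, exists s, fsimple A s /\ kyfan (2^-1 ^+ j.+1) f s.
  by move=> j; have [|s] := fs (2^-1 ^+ j.+1); [rewrite exprn_gt0|exists s].
exists s; split=> j; first by have [] := sP j.
  by have [_] := sP j; apply: kyfanW; rewrite exprS ler_piMl ?exprn_ge0// invf_le1// ler1n.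
have [_ /kyfan_sym sj] := sP j; have [_ sj1] := sP j.+1.
apply: kyfanW (kyfan_trans sj sj1).
have : 0 <= (2^-1 : R) ^+ j by rewrite exprn_ge0.
by rewrite !exprS; lra.
Qed.

(** The places where [f] is far from [s m] lie in the union of the supports of
    the later jumps, up to a null set; that union exists in the closure,
    modulo null sets, and the closure contains all null sets. *)
Lemma kyfan_fmeas_dens_cl f : (forall e, 0 < e -> exists2 s, fsimple A s & kyfan e f s) ->
  fmeas (dens_cl R A) f.
Proof.
move=> /fast_fsimple[s [ss fs sD]] e e0.
pose D j := [set k | 2^-1 ^+ j < `|s j k - s j.+1 k|].
have AD j : A (D j).
  exact: (fsimple_comp2 fA (fun x y => `|x - y|) (ss j) (ss j.+1)).2 [set x | 2^-1 ^+ j < x].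
have [m me] := exists_half_pow_le 4 e0.
have [E [clE Em DE]] := null_union fA AF m AD sD.
pose Z := [set k | e < `|f k - s m k|] `\` E.
have Z0 : dens_le Z (0 : R).
  apply: dens_le_eq0 => d d0.
  have q0 : 0 < Num.min d (2 * 2^-1 ^+ m) by rewrite lt_min d0 mulr_gt0// exprn_gt0.
  have [n' nd] := exists_half_pow_le 1 q0; rewrite mul1r in nd.
  pose n := maxn m n'.
  have n2 : (2^-1 : R) ^+ n <= 2^-1 ^+ n'.
    by rewrite ler_wiXn2l// ?invr_ge0// ?invf_le1// ?ler1n// leq_maxr.
  have DnE : dens_le (\bigcup_(j in [set j | (m <= j < n)%N]) (D j `\` E)) (0 : R).
    move: (n) => l; elim: l => [|l IH].
      rewrite (_ : bigcup _ _ = set0); first exact/null_dens/nullN0.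
      by rewrite -subset0 => x [j /= /andP[_]].
    have [ml|lm] := leqP m l.
      rewrite -[0](addr0 0); apply: dens_le_sub (dens_leU IH (DE _ ml)) => //.
      move=> x [j /= /andP[mj]]; rewrite ltnS leq_eqVlt => /predU1P[->|jl] Dx; first by right.
      by left; exists j => //=; rewrite mj.
    rewrite (_ : bigcup _ _ = set0); first exact/null_dens/nullN0.
    rewrite -subset0 => x [j /= /andP[mj]]; rewrite ltnS => jl.
    by have := leq_trans mj jl; rewrite leqNgt lm.
  have dn : kyfan (Num.min d (2 * 2^-1 ^+ m)) f (s n).
    by apply: kyfanW (fs n); exact: le_trans nd.
  rewrite -[d]addr0; have := dens_leU dn DnE.
  apply: dens_le_sub => [k [/= ek nEk]|]; last by rewrite lerD2r ge_min lexx.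
  have e4 : 2 * 2^-1 ^+ m + 2 * 2^-1 ^+ m < `|s m k - f k|.
    by rewrite distrC; apply: le_lt_trans ek; apply: le_trans me; lra.
  have [h|h] := ltr_distD_split (s n k) e4.
    right; have [j mjn Dj] := dist_gt_chain (leq_maxl m n') h.
    by exists j.
  by left; rewrite /= distrC; apply: le_lt_trans h; rewrite ge_min lexx orbT.
have clZ : dens_cl R A Z.
  by apply: (@dens_cl_null _ _ _ set0); rewrite ?setY0//; have [] := clf.
exists (s m), (E `|` Z); split.
- exact: fsimpleS (ss m).
- by have [_ _] := clf; apply.
- by have := dens_leU Em Z0; rewrite addr0; exact: dens_leW.
- move=> k nk; rewrite leNgt; apply/negP => h; apply: nk.
  by have [|nE] := pselect (E k); [left|right].
Qed.

Lemma kyfan_cvg_fmeas_dens_cl u f : (forall n, fmeas (dens_cl R A) (u n)) -> kyfan_cvg u f ->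
  fmeas (dens_cl R A) f.
Proof.
move=> ua uf; apply: kyfan_fmeas_dens_cl => e e0.
have e20 : 0 < e / 2 by rewrite divr_gt0.
have [n /(_ n (leqnn n))/kyfan_sym fn] := uf _ e20.
have [s ss ns] := fmeas_dens_cl_kyfan fA (ua n) e20.
by exists s => //; rewrite [e]splitr; exact: kyfan_trans fn ns.
Qed.

Section TruncationTail.
Variables (f : posnat -> R) (c : R).
Hypotheses (f0 : forall k, 0 <= f k) (fa : fmeas A f) (fc : trunc_le f c).

Lemma cvgn_min M : 0 <= M -> cvgn (fun N => nuN N (fun k => Num.min (f k) M)).
Proof.
move=> M0; apply: (@fmeas_bounded_cvgn _ _ fA AF _ M); last exact: fmeas_min.
by move=> k; rewrite ger0_norm ?min_ge0// ge_min lexx orbT.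
Qed.

(** The means of the truncations have a supremum, which is nearly attained at
    some level [M]. *)
Lemma trunc_tail e : 0 < e -> exists2 M, 0 <= M & forall M', 0 <= M' ->
  umean_le (fun k => Num.min (f k) M' - Num.min (f k) M) e.
Proof.
move=> e0; pose q M := nu (fun k => Num.min (f k) M).
have qP M : 0 <= M -> (fun N => nuN N (fun k => Num.min (f k) M)) @ \oo --> q M.
  exact: cvgn_min.
pose S := q @` [set M : R | 0 <= M].
have Ssup : has_sup S.
  split; first by exists (q 0), 0 => /=.
  by exists c => _ [M /= M0 <-]; apply/(umean_leP _ (qP _ M0)); exact: fc.
have [_ [M /= M0 <-] SM] := sup_adherent e0 Ssup.
exists M => // M' M'0.
have := umean_leD (umean_cvg (qP _ M'0)) (umean_cvg (cvg_nuZ (c := -1) (qP _ M0))).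
apply: umean_le_trans => [k|]; first by rewrite mulN1r.
have : q M' <= sup S by apply: ub_le_sup; [have [] := Ssup|exists M'].
by move: SM; lra.
Qed.

End TruncationTail.

Section Exponent.
Variable p : R.
Hypothesis hp : p = 0 \/ 1 <= p.

Lemma normr_sub_clamp K x : 0 <= K -> `|x - clamp K x| = `|x| - Num.min `|x| K.
Proof.
move=> K0; have [xK|xK] := leP `|x| K.
  by rewrite clamp_id// !subrr normr0.
have [x0|x0] := leP 0 x.
  move: xK; rewrite ger0_norm// /clamp => xK; rewrite min_r ?(ltW xK)// max_r; last lra.
  by rewrite ger0_norm// subr_ge0 ltW.
move: xK; rewrite ltr0_norm// /clamp => xK; rewrite min_l; last lra.
by rewrite max_l; last lra; rewrite ltr0_norm; lra.
Qed.

(** Truncating an excess over [M] at [M'] amounts to truncating at [M + M']. *)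
Lemma min_sub_min x M M' : 0 <= x -> 0 <= M -> 0 <= M' ->
  Num.min (x - Num.min x M) M' <= Num.min x (M + M') - Num.min x M.
Proof.
move=> x0 M0 M'0; case: (leP x M) => ?; case: (leP x (M + M')) => ?.
- by rewrite ge_min subrr lexx.
- by rewrite ge_min; apply/orP; left; lra.
- by rewrite ge_min lexx.
- by rewrite ge_min; apply/orP; right; lra.
Qed.

Lemma min_powR x K : 0 <= x -> 0 <= K -> 1 <= p ->
  Num.min x K `^ p = Num.min (x `^ p) (K `^ p).
Proof.
move=> x0 K0 p1; have [xK|Kx] := leP x K.
  by rewrite min_l// ler_powR_base.
by rewrite min_r// ler_powR_base// ltW.
Qed.

(** By superadditivity, the power of the excess is at most the excess of the
    power. *)
Lemma abs_pow_sub_clamp K x : 0 <= K -> 1 <= p ->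
  `|x - clamp K x| `^ p <= `|x| `^ p - Num.min (`|x| `^ p) (K `^ p).
Proof.
move=> K0 p1; rewrite normr_sub_clamp// -min_powR// lerBrDr.
apply: le_trans (powR_superadd p1 _ _) _; [|exact: min_ge0|by rewrite subrK].
by rewrite subr_ge0 ge_min lexx.
Qed.

(** Truncations converge in norm: for positive exponent by [trunc_tail], and
    for [p = 0] because the function is bounded off a small set. *)
Lemma pnorm_clamp f r e : fmeas A f -> pnorm_le p f r -> 0 < e ->
  exists2 K, 0 <= K & pnorm_le p (fun k => f k - clamp K (f k)) e.
Proof.
move=> fa fr e0; case: hp => [p0|p1].
  have e20 : 0 < e / 2 by rewrite divr_gt0.
  have [K [C [K0 AC Ce fK]]] := fmeas_tight fa e20.
  exists K => //; rewrite p0; apply/pnorm0P; split=> [|r' er']; first exact: ltW.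
  exists (e / 2) => //; apply: (@dens_le_sub _ _ C (e / 2)) => //; last by lra.
  move=> k /= h; apply: contrapT => /fK fk; move: h.
  by rewrite clamp_id// subrr normr0 ltNge ltW.
have p0 : 0 < p by exact: lt_le_trans p1.
move: fr => /(pnorm1P _ _ p1)[r0 fr].
have ep0 : 0 < e `^ p by exact: powR_gt0.
have [M M0 MP] := trunc_tail (abs_pow_ge0 p f) (fmeas_abs_pow fA p1 fa) fr ep0.
exists (M `^ p^-1); first exact: powR_ge0.
apply/pnorm1P => //; split; first exact: ltW.
move=> M' M'0; apply: umean_le_trans (MP _ (addr_ge0 M0 M'0)) => // k.
apply: le_trans (min_sub_min _ M0 M'0); last exact: abs_pow_ge0.
apply: le_minl; rewrite -{2}[M](powR_root p1)//; apply: abs_pow_sub_clamp => //.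
exact: powR_ge0.
Qed.

Lemma bounded_pnorm h K : (forall k, `|h k| <= K) -> exists r, pnorm_le p h r.
Proof.
move=> hK; have K0 : 0 <= K by rewrite (le_trans _ (hK (pos_succ 0))).
case: hp => [->|p1].
  exists 1; apply/pnorm0P; split=> // r' r1.
  exists (r' - 1); first by rewrite subr_gt0.
  by have -> : r' - (r' - 1) = 1; [ring|exact: dens_le1].
exists K; apply/pnorm1P => //; split=> //; apply: umean_trunc_le.
by apply: umean_le_trans (umean_le_cst _) => // k; exact: ler_powR_base.
Qed.

Lemma Lp_incl (B : set (set posnat)) : set_field B -> B `<=` densF R -> A `<=` B ->
  fcar (Lp_space A p) `<=` fcar (Lp_space B p).
Proof.
move=> fB BF AB f /(fcar_LpP fA AF hp)[fa fp]; apply/(fcar_LpP fB BF hp).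
by split => //; exact: fmeasS fa.
Qed.

(** Norm-Cauchy sequences are Cauchy for upper density. Their limit there is
    measurable over the closure, and by [pnorm_le_fatou] it is the limit in
    norm. *)
Lemma Lp_dens_cl_complete : qcomplete (Lp_space (dens_cl R A) p).
Proof.
have nX := Lp_pnormed clf clF hp.
apply/(qcompleteP hp nX) => u uX uc.
have uh : kyfan_cauchy u.
  move=> e e0; have [d d0 dP] := pnorm_le_small hp e0; have [M MP] := uc _ d0.
  by exists M => n m Mn Mm; apply: dP; exact: MP.
have [f uf] := kyfan_cauchy_cvg uh.
have ua n : fmeas (dens_cl R A) (u n) by have /(fcar_LpP clf clF hp)[] := uX n.
have upf : pcvg p u f.
  move=> e e0; have [M MP] := uc _ e0; exists M => n Mn.
  apply: (pnorm_le_fatou hp (ltW e0)) => d d0; have [M' MP'] := uf _ d0.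
  exists (fun k => u n k - u (maxn M M') k); last by apply: MP => //; exact: leq_maxl.
  apply: dens_le_sub (MP' _ (leq_maxr M M')) => // k /=.
  by have -> : u n k - f k - (u n k - u (maxn M M') k) = u (maxn M M') k - f k by ring.
exists f => //; apply/(fcar_LpP clf clF hp); split; first exact: kyfan_cvg_fmeas_dens_cl uf.
have [M /(_ M (leqnn M)) Mf] := upf _ ltr01.
have /(fcar_LpP clf clF hp)[_ [r ur]] := uX M.
exists (r + 1); have := pnorm_leD hp ur (pnorm_leN hp Mf).
by apply: pnorm_le_trans => // k; rewrite subKr.
Qed.

End Exponent.
End Completeness.

(** * Representatives over the original field *)

Section Representation.
Variables (R : realType) (A : set (set posnat)).
Hypotheses (fA : set_field A) (AF : A `<=` densF R).
Variable p : R.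
Hypothesis hp : p = 0 \/ 1 <= p.
Implicit Types (f g h s : posnat -> R) (a b c d e K M r : R) (E F : set posnat).
Implicit Types u : nat -> posnat -> R.

Let clf : set_field (dens_cl R A). Proof. exact: dens_cl_field. Qed.
Let clF : dens_cl R A `<=` densF R. Proof. exact: dens_cl_densF. Qed.

(** Truncate, approximate by a simple function over the original field in
    upper density, and truncate that one at the same level. *)
Lemma Lp_dense : pdense p (Lp_space A p) (Lp_space (dens_cl R A) p).
Proof.
move=> f e /(fcar_LpP clf clF hp)[fa [r fr]] e0.
have e20 : 0 < e / 2 by rewrite divr_gt0.
have [K K0 fK] := pnorm_clamp clf clF hp fa fr e20.
have K2 : 0 <= K + K by exact: addr_ge0.
have [d d0 dP] := pnorm_le_bounded hp K2 e20.
have [s ss fs] := fmeas_dens_cl_kyfan fA fa d0.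
exists (fun k => clamp K (s k)).
  apply/(fcar_LpP fA AF hp); split; first exact/fmeas_fsimple/fsimple_comp.
  by apply: (bounded_pnorm hp (K := K)) => k; exact: clamp_le.
rewrite [e]splitr; apply: (pdist_le_trans hp fK); apply: dP => [k|].
  by rewrite (le_trans (ler_normB _ _))// lerD//; exact: clamp_le.
apply: dens_le_sub fs => // k /= /lt_le_trans; apply.
exact: clamp_lipschitz.
Qed.

(** The representative [g] of an indicator takes values near 0 or 1 off a null
    set, so approximations of [g] determine the level set at [1 / 2] up to
    sets of small density. *)
Lemma represents_sets : represents p (Lp_space (dens_cl R A) p) (Lp_space A p) ->
  dens_cl R A `<=` null_mod R (PJ_completion R A).
Proof.
move=> rep E clE.
have [|g /(fcar_LpP fA AF hp)[ga _] /(pnorm_le0P hp) Eg] := rep (\1_E).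
  apply/(fcar_LpP clf clF hp); split; first exact: fmeas_indic.
  by apply: (bounded_pnorm hp (K := 1)) => k; rewrite ger0_norm ?indic_ge0// indic_le1.
have q0 : 0 < 4^-1 :> R by rewrite invr_gt0.
have o0 : 0 < 8^-1 :> R by rewrite invr_gt0.
exists [set k | 2^-1 < g k]; last first.
  apply: dens_le_sub (Eg _ q0) => // k; rewrite setY_def /= indicE.
  move=> [[Ek /negP]|[gk Ek]].
    rewrite -leNgt mem_set//= => gk; rewrite (lt_le_trans _ (ler_norm _))//; lra.
  by rewrite memNset//= sub0r normrN (lt_le_trans _ (ler_norm _))//; lra.
apply/PJ_completionP => // e e0.
have m0 : 0 < Num.min e 8^-1 by rewrite lt_min e0.
have [s [C [[_ sS] AC Ce gs]]] := ga _ m0.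
have [_ _ AU] := fA.
have gs' k : ~ C k -> - 8^-1 <= g k - s k <= 8^-1.
  by move=> /gs; rewrite le_min => /andP[_]; rewrite ler_norml.
exists (s @^-1` [set x | 5 / 8 < x] `\` C), (s @^-1` [set x | 3 / 8 < x] `|` C).
split.
- exact: field_setD.
- exact: AU.
- by move=> k [/= sk /gs' /andP[? ?]]; lra.
- move=> k /= gk; have [|/gs'/andP[? ?]] := pselect (C k); [by right|left; lra].
- have Ce' : dens_le C e by apply: dens_leW Ce; rewrite ge_min lexx.
  rewrite -[e]addr0; apply: dens_le_sub (dens_leU Ce' (Eg _ o0)) => // k /= [sCk nsk].
  have [|nC] := pselect (C k); [by left|right].
  have [sk|//] := sCk.
  have sk' : s k <= 5 / 8 by rewrite leNgt; apply/negP => h; apply: nsk.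
  have /andP[? ?] := gs' _ nC.
  rewrite indicE; case: (k \in E) => /=.
    by rewrite (lt_le_trans _ (ler_norm _))//; lra.
  by rewrite sub0r normrN (lt_le_trans _ (ler_norm _))//; lra.
Qed.

(** The estimate on pairs of terms passes to the limit. *)
Lemma cvg_dist_le (x : nat -> R) (m : nat) :
  (forall j n, (m <= j)%N -> (j <= n)%N -> `|x j - x n| <= 2 * 2^-1 ^+ j) ->
  forall j, (m <= j)%N -> `|x j - limn x| <= 2 * 2^-1 ^+ j.
Proof.
move=> xm.
have cx : cvgn x.
  apply/cauchy_cvgP/cauchy_exP => e e0; have e20 : 0 < e / 2 by rewrite divr_gt0.
  have [m' m'e] := exists_half_pow_le 2 e20.
  pose j := maxn m m'; exists (x j), j => // n /= jn.
  rewrite /ball/=; apply: (@le_lt_trans _ _ (e / 2)); last first.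
    by rewrite ltr_pdivrMr// ltr_pMr// ltr1n.
  apply: le_trans (xm j n (leq_maxl _ _) jn) _; apply: le_trans m'e.
  by rewrite ler_wpM2l// ler_wiXn2l// ?invr_ge0// ?invf_le1// ?ler1n// leq_maxr.
move=> j mj.
have xj : (fun n => `|x j - x n|) @ \oo --> `|x j - limn x|.
  by apply: cvg_norm; apply: cvgB => //; exact: cvg_cst.
by apply: (cvgr_to_le xj); exists j => // n /= jn; exact: xm.
Qed.

(** The exceptional null sets are removed one jump at a time: jump number [k]
    is suppressed on the part [Z k] of its support lying outside one of the
    covers [C m], [m <= k]. Each [Z k] is a null set of the field, so that the
    corrected simple functions [t k] still represent the same limit, and they
    now converge uniformly off every cover. *)
Lemma sets_represent : dens_cl R A `<=` null_mod R (PJ_completion R A) ->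
  represents p (Lp_space (dens_cl R A) p) (Lp_space A p).
Proof.
move=> hc f /(fcar_LpP clf clF hp)[fa [r fr]].
have [s [ss fs sD]] := fast_fsimple (fun e => @fmeas_dens_cl_kyfan R A fA f e fa).
pose D j := [set k | 2^-1 ^+ j < `|s j k - s j.+1 k|].
have AD j : A (D j).
  exact: (fsimple_comp2 fA (fun x y => `|x - y|) (ss j) (ss j.+1)).2 [set x | 2^-1 ^+ j < x].
have [A0 AC AU] := fA.
have /choice[C CP] : forall m : nat, exists C, [/\ A C, dens_le C (5 * (2^-1 : R) ^+ m) &
    forall j, (m <= j)%N -> dens_le (D j `\` C) (0 : R)].
  move=> m; have [E [clE Em DE]] := null_union fA AF m AD sD.
  have [B PB EB] := hc _ clE.
  have m0 : 0 < (2^-1 : R) ^+ m by rewrite exprn_gt0.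
  have /(PJ_completionP _ fA AF)/(_ _ m0)[B' [C [AB' AC' B'B BC CB']]] := PB.
  exists C; split => //.
    have := dens_leU (dens_leU Em EB) CB'; apply: dens_le_sub => [k Ck|]; last by lra.
    have [/B'B Bk|] := pselect (B' k); last by right.
    by left; have [|] := pselect (E k); [left|right; rewrite setY_def; right].
  move=> j mj; have := dens_leU (DE j mj) EB; rewrite addr0; apply: dens_le_sub => // k.
  move=> [Dk nCk]; have [Ek|] := pselect (E k); last by left.
  by right; rewrite setY_def; left; split => // /BC.
pose Z k := \bigcup_(m in [set m | (m <= k)%N]) (D k `\` C m).
have AZ k : A (Z k).
  apply: field_bigcup => //; first by apply: sub_finite_set (finite_II k.+1) => m.
  by move=> m _; apply: field_setD => //; have [] := CP m.
have Z0 k : dens_le (Z k) (0 : R).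
  suff h : forall n, (n <= k.+1)%N ->
      dens_le (\bigcup_(m in [set m | (m < n)%N]) (D k `\` C m)) (0 : R).
    by apply: dens_le_sub (h _ (leqnn k.+1)).
  elim=> [_|n IH nk].
    rewrite (_ : bigcup _ _ = set0); first exact/null_dens/nullN0.
    by rewrite -subset0 => x [].
  have [_ _ Cn] := CP n; have := dens_leU (IH (ltnW nk)) (Cn k nk); rewrite addr0.
  apply: dens_le_sub => // x [m /=]; rewrite ltnS leq_eqVlt => /predU1P[->|mn] Dx.
    by right.
  by left; exists m.
(* The corrected sequence drops the jump number [j] on [Z j]. *)
pose t := fix t k := if k is j.+1
  then fun x => t j x + (s j.+1 x - s j x) * \1_(~` Z j) x else s 0%N.
have ts k : fsimple A (t k).
  elim: k => [|k IH]; first exact: ss.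
  apply: (fsimple_comp2 fA +%R) => //; apply: (fsimple_comp2 fA *%R).
    exact: (fsimple_comp2 fA (fun x y => x - y)).
  by apply: fsimple_indic => //; exact: AC.
have tsn k : dens_le [set x | t k x != s k x] (0 : R).
  elim: k => [|k IH].
    rewrite (_ : mkset _ = set0); first exact/null_dens/nullN0.
    by rewrite -subset0 => x /=; rewrite eqxx.
  rewrite -[0](addr0 0); apply: dens_le_sub (dens_leU IH (Z0 k)) => // x /= tx.
  apply: contrapT => nU; move/negP: tx; apply; apply/eqP.
  rewrite indicE mem_set/=; last by move=> Zx; apply: nU; right.
  have -> : t k x = s k x.
    by apply/eqP; rewrite -[_ == _]negbK; apply/negP => h; apply: nU; left.
  by rewrite mulr1 addrC subrK.
have tC m j n x : (m <= j)%N -> (j <= n)%N -> ~ C m x ->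
    `|t j x - t n x| <= 2 * 2^-1 ^+ j.
  move=> mj jn nCx; rewrite leNgt; apply/negP => /(dist_gt_chain jn)[i /andP[ji _]].
  apply/negP; rewrite -leNgt /= opprD addNKr normrN normrM.
  rewrite indicE; case: (asboolP (Z i x)) => Zx.
    by rewrite memNset ?normr0 ?mulr0 ?exprn_ge0//=; apply.
  rewrite mem_set//= normr1 mulr1 distrC leNgt; apply/negP => Dx.
  by apply: Zx; exists m => //=; exact: leq_trans ji.
pose g x := limn (fun k => t k x).
have tg m x : ~ C m x -> `|t m x - g x| <= 2 * 2^-1 ^+ m.
  move=> nCx; apply: (@cvg_dist_le (fun k => t k x) m) => // j n mj jn.
  exact: tC nCx.
have ga : fmeas A g.
  move=> e e0; have [m me] := exists_half_pow_le 5 e0.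
  have [ACm Cm _] := CP m; exists (t m), (C m); split => //.
    exact: dens_leW me Cm.
  move=> k /tg; rewrite distrC => /le_trans; apply; apply: le_trans me.
  by rewrite ler_wpM2r ?exprn_ge0// ler_nat.
have fg : pdist_le p f g 0.
  apply/(pnorm_le0P hp)/kyfan_negl => e e0; have [m me] := exists_half_pow_le 6 e0.
  have tm : kyfan 0 (s m) (t m).
    apply: dens_le_sub (tsn m) => // x /=; rewrite normr_gt0 subr_eq0 eq_sym.
    by [].
  have tgm : kyfan (5 * 2^-1 ^+ m) (t m) g.
    have [_ Cm _] := CP m; apply: dens_le_sub Cm => // x /= h.
    apply: contrapT => /tg h'; have := lt_le_trans h h'.
    by apply/negP; rewrite -leNgt ler_wpM2r ?exprn_ge0// ler_nat.
  by have := kyfan_trans (kyfan_trans (fs m) tm) tgm; apply: kyfanW; lra.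
exists g => //; apply/(fcar_LpP fA AF hp); split => //; exists r.
apply: (negl_pnorm_le hp _ fr); apply/(pnorm_le0P hp).
exact: pdist_le_sym.
Qed.

Lemma represents_setsP : represents p (Lp_space (dens_cl R A) p) (Lp_space A p) <->
  PJ_completion R (dens_cl R A) = null_mod R (PJ_completion R A).
Proof.
rewrite PJ_completion_dens_cl//; split=> [/represents_sets h|clE].
  apply/seteqP; split => //; apply: subset_trans (@null_mod_sub_dens_cl R _) _.
  move=> E EP; apply: dens_cl_approx => e /EP[B PB EB]; exists B => //.
  exact: PJ_completion_sub_dens_cl.
by apply: sets_represent; rewrite clE.
Qed.

End Representation.

(** * Upper level sets of measurable functions *)

Section LevelSets.
Variables (R : realType) (A : set (set posnat)).
Hypotheses (fA : set_field A) (AF : A `<=` densF R).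
Implicit Types (f g h s : posnat -> R) (a b c d e K M r x y z : R) (E F : set posnat).

(** A countable set has Lebesgue measure zero. *)
Lemma countable_avoid (C : set R) a b : countable C -> a < b ->
  exists y, [/\ a < y, y < b & ~ C y].
Proof.
move=> Cc ab; apply: contrapT => nC.
have : (lebesgue_measure `]a, b[%classic <= lebesgue_measure C)%E.
  apply: le_outer_measure => y /=; rewrite in_itv/= => /andP[ay yb].
  by apply: contrapT => nCy; apply: nC; exists y.
rewrite (countable_lebesgue_measure0 Cc) lebesgue_measure_itv/= lte_fin ab.
by rewrite -EFinD lee_fin subr_le0 leNgt ab.
Qed.

(** Where it is bounded, the function is uniformly close to a staircase that
    jumps at admissible levels, which can be chosen as close together as
    desired. *)
Lemma level_sets_fmeas f (C : set R) : countable C ->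
  (forall y, ~ C y -> PJ_completion R A (f @^-1` `]y, +oo[%classic)) ->
  (forall e, 0 < e -> exists2 y, 0 <= y & dens_le [set k | y < `|f k|] e) ->
  fmeas A f.
Proof.
move=> Cc fC ft; apply: (fmeas_PJ_completion fA AF) => e e0.
have fPJ := PJ_completion_field fA AF; have [PJ0 PJC PJU] := fPJ.
have [Y Y0 fY] := ft _ e0.
(* One admissible level is chosen in each interval of length [d], so that
   consecutive ones are at distance at most [2 * d = e]. *)
pose d := e / 2; have d0 : 0 < d by rewrite divr_gt0.
pose a (i : nat) : R := - Y - d + i%:R * d.
have aS i : a i.+1 = a i + d by rewrite /a -natr1 mulrDl mul1r addrA.
have /choice[z zP] : forall i, exists y, [/\ a i < y, y < a i.+1 & ~ C y].
  by move=> i; apply: countable_avoid => //; rewrite aS ltrDl.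
have zS i : z i < z i.+1 /\ z i.+1 <= z i + e.
  have [z1 z2 _] := zP i; have [z3 z4 _] := zP i.+1; split; first exact: lt_trans z3.
  have -> : e = d + d by rewrite /d -splitr.
  by move: z4; rewrite !aS; lra.
pose s := fix s n := if n is i.+1 then
  fun k => s i k + (z i.+1 - z i) * \1_(f @^-1` `]z i, +oo[%classic) k
  else fun=> z 0%N.
have PJz i : PJ_completion R A (f @^-1` `]z i, +oo[%classic).
  by apply: fC; have [] := zP i.
have ss n : fsimple (PJ_completion R A) (s n).
  elim: n => [|n IH]; first exact: fsimple_cst.
  apply: (fsimple_comp2 fPJ +%R) => //; apply: (fsimple_comp fPJ ( *%R (z n.+1 - z n))).
  exact: fsimple_indic.
have sP n k : (z n < f k -> s n k = z n) /\
    (z 0%N < f k -> f k <= z n -> `|f k - s n k| <= e).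
  elim: n => [|n [IH1 IH2]]; first by split=> // h1 h2; have := lt_le_trans h1 h2; rewrite ltxx.
  have [zn zn1] := zS n; rewrite /= indicE.
  have [zf|fz] := ltP (z n) (f k).
    rewrite mem_set /= ?in_itv/= ?andbT// mulr1 IH1// addrC subrK.
    by split => // _ h; rewrite ler_norml; apply/andP; split; lra.
  rewrite memNset; last first.
    by rewrite /= in_itv/= andbT => h; have := lt_le_trans h fz; rewrite ltxx.
  rewrite mulr0 addr0.
  split; first by move=> h; have := lt_le_trans (lt_trans zn h) fz; rewrite ltxx.
  by move=> h _; exact: IH2.
have [n Yn] : exists n, Y < z n.
  exists (Num.truncn ((Y + Y + d) / d)).+1.
  have [h _ _] := zP (Num.truncn ((Y + Y + d) / d)).+1; apply: lt_trans h.
  have := truncnS_gt ((Y + Y + d) / d).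
  by rewrite ltr_pdivrMr// /a; lra.
pose E := (~` (f @^-1` `]z 0%N, +oo[%classic)) `|` (f @^-1` `]z n, +oo[%classic).
exists (s n), E; split => //.
- by apply: PJU => //; exact: PJC.
- have z0Y : z 0%N < - Y by have [_] := zP 0%N; rewrite aS /a mul0r addr0 subrK.
  apply: dens_le_sub fY => // k [/=|/=]; rewrite in_itv/= andbT.
    move=> /negP; rewrite -leNgt => fz.
    by rewrite -normrN (lt_le_trans _ (ler_norm _))//; lra.
  by move=> h; rewrite (lt_le_trans _ (ler_norm _))//; lra.
- move=> k nE; have [_] := sP n k; apply.
    by apply: contrapT => h; apply: nE; left; rewrite /= in_itv/= andbT.
  by rewrite leNgt; apply/negP => h; apply: nE; right; rewrite /= in_itv/= andbT.
Qed.

(** The least bound turns the relation [dens_le] into a monotone function of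
    the level, whose jumps can be counted. *)
Definition tail_dens f y : R := inf [set c : R | dens_le [set k | y < f k] c].

Lemma tail_dens_has_inf f y : has_inf [set c : R | dens_le [set k | y < f k] c].
Proof.
split; first by exists 1; exact: dens_le1.
by exists 0 => c; exact: dens_le_ge0.
Qed.

Lemma tail_dens_dens f y : dens_le [set k | y < f k] (tail_dens f y).
Proof.
apply: umean_le_closed => e e0; have [c cP ce] := inf_adherent e0 (tail_dens_has_inf f y).
by apply: dens_leW cP; rewrite ltW.
Qed.

Lemma tail_dens_le f y c : dens_le [set k | y < f k] c -> tail_dens f y <= c.
Proof. by move=> h; apply: ge_inf => //; have [] := tail_dens_has_inf f y. Qed.

Lemma tail_dens_mono f y z : y <= z -> tail_dens f z <= tail_dens f y.
Proof.
move=> yz; apply: tail_dens_le; apply: dens_le_sub (tail_dens_dens f y) => // k /=.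
exact: le_lt_trans.
Qed.

(** Level sets of an approximating simple function at slightly different
    levels enclose the given one, and continuity at the level makes the
    difference of their densities small. *)
Lemma level_set_PJ f y : fmeas A f ->
  (forall e, 0 < e -> exists2 d, 0 < d & tail_dens f (y - d) - tail_dens f (y + d) <= e) ->
  PJ_completion R A (f @^-1` `]y, +oo[%classic).
Proof.
move=> fa fy; apply/PJ_completionP => // e e0.
have e40 : 0 < e / 4 by rewrite divr_gt0.
have [d d0 fd] := fy _ e40.
have q0 : 0 < Num.min (e / 4) (d / 2) by rewrite lt_min e40 divr_gt0.
have [s [C [[_ sS] AC Ce fs]]] := fa _ q0; have [_ _ AU] := fA.
have fs' k : ~ C k -> - (d / 2) <= f k - s k <= d / 2.
  by move=> /fs; rewrite le_min => /andP[_]; rewrite ler_norml.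
pose L := s @^-1` [set x | y + d / 2 < x] `\` C.
pose U := s @^-1` [set x | y - d / 2 < x] `|` C.
have AL : A L by exact: field_setD.
have AUU : A U by exact: AU.
have Lf : L `<=` f @^-1` `]y, +oo[%classic.
  by move=> k [/= sk /fs' /andP[? ?]]; rewrite in_itv/= andbT; lra.
have fU : f @^-1` `]y, +oo[%classic `<=` U.
  move=> k /=; rewrite in_itv/= andbT => gk.
  have [|/fs'/andP[? ?]] := pselect (C k); [by right|left; rewrite /=; lra].
exists L, U; split => //.
have LU0 : dens_le (L `\` U) (0 : R).
  rewrite (_ : _ `\` _ = set0); first exact/null_dens/nullN0.
  by rewrite -subset0 => k [/Lf/fU].
apply: dens_leW (dens_le_diff (AF AL) (AF AUU) LU0).
have Ce' : dens_le C (e / 4) by apply: dens_leW Ce; rewrite ge_min lexx.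
have hU : nu_set R U <= tail_dens f (y - d) + e / 4.
  apply/(dens_leP _ (AF AUU)); apply: dens_le_sub (dens_leU (tail_dens_dens f (y - d)) Ce') => //.
  move=> k [/= sk|]; last by right.
  by have [|/fs'/andP[? ?]] := pselect (C k); [right|left; rewrite /=; lra].
have hL : tail_dens f (y + d) <= nu_set R L + e / 4.
  apply: tail_dens_le; have LL : dens_le L (nu_set R L) by apply/(dens_leP _ (AF AL)).
  apply: dens_le_sub (dens_leU LL Ce') => // k /= fk.
  by have [|nC] := pselect (C k); [right|left; split=> //=; have /andP[? ?] := fs' _ nC; lra].
by lra.
Qed.

(** The exceptional levels are jumps of the monotone function [tail_dens f]; a
    rational number inside each jump enumerates them. *)
Lemma fmeas_level_sets f : fmeas A f -> exists2 C : set R, countable C &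
  forall y, ~ C y -> PJ_completion R A (f @^-1` `]y, +oo[%classic).
Proof.
move=> fa; exists [set y | ~ PJ_completion R A (f @^-1` `]y, +oo[%classic)]; last first.
  by move=> y /contrapT.
set C := mkset _.
have /choice[q qP] : forall y, exists q : rat, C y ->
    (forall z, y < z -> tail_dens f z < ratr q) /\ (forall z, z < y -> ratr q < tail_dens f z).
  move=> y; have [Cy|nCy] := pselect (C y); last by exists 0.
  have [e e0 ey] : exists2 e, 0 < e &
      forall d, 0 < d -> e < tail_dens f (y - d) - tail_dens f (y + d).
    apply: contrapT => h; apply: Cy; apply: level_set_PJ => // e e0.
    apply: contrapT => h'; apply: h; exists e => // d d0; rewrite ltNge.
    by apply/negP => hd; apply: h'; exists d.
  pose S := tail_dens f @` [set z | y < z].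
  have S0 : S !=set0 by exists (tail_dens f (y + 1)), (y + 1) => //=; rewrite ltrDl.
  have key z z' : z < y -> y < z' -> tail_dens f z' + e <= tail_dens f z.
    move=> zy yz'; pose d := Num.min (y - z) (z' - y).
    have d0 : 0 < d by rewrite lt_min !subr_gt0 zy.
    have h1 : tail_dens f (y - d) <= tail_dens f z.
      by apply: tail_dens_mono; rewrite lerBrDr addrC -lerBrDr ge_min lexx.
    have h2 : tail_dens f z' <= tail_dens f (y + d).
      by apply: tail_dens_mono; rewrite addrC -lerBrDr ge_min lexx orbT.
    by have := ey _ d0; lra.
  have y1 : y - 1 < y by rewrite ltrBlDr ltrDl.
  have Sub : has_ubound S.
    by exists (tail_dens f (y - 1) - e) => _ [z /= yz <-]; rewrite lerBrDr key.
  have be : sup S < sup S + e by rewrite ltrDl.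
  have [r] := rat_in_itvoo be; rewrite in_itv/= => /andP[br re]; exists r => _.
  split=> z yz.
    by apply: le_lt_trans br; apply: ub_le_sup => //; exists z.
  apply: lt_le_trans re _; rewrite -lerBrDr; apply: ge_sup => // _ [z' /= yz' <-].
  by rewrite lerBrDr key.
apply/countable_injP; exists (fun y => choice.pickle (q y)) => y y' /set_mem Cy /set_mem Cy'.
move=> /(pcan_inj (@choice.pickleK _)) qq.
have aux u v : C u -> C v -> q u = q v -> u < v -> False.
  move=> Cu Cv quv uv; have [um mv] := midf_lt uv.
  have [/(_ _ um) h1 _] := qP _ Cu; have [_ /(_ _ mv) h2] := qP _ Cv.
  by rewrite quv in h1; have := lt_trans h2 h1; rewrite ltxx.
apply: contrapT => /eqP; rewrite neq_lt => /orP[|].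
  exact: aux Cy Cy' qq.
exact: aux Cy' Cy (esym qq).
Qed.

End LevelSets.

(** * The spaces K_p *)

Section UpperIntegrability.
Variable R : realType.
Implicit Types (f g h : posnat -> R) (c d e y : R).

Lemma nu_sup_lt_umean f c : (nu_sup f < c%:E)%E -> umean_le f c.
Proof.
rewrite /nu_sup /limn_esup limf_esupE => /ereal_inf_lt[_ [V Voo <-]] Vc e e0.
apply: filterS Voo => N VN; have : ((nuN N f)%:E < c%:E)%E.
  by apply: le_lt_trans Vc; apply: ereal_sup_ubound; exists N.
by rewrite lte_fin => /ltW /le_trans; apply; rewrite lerDl ltW.
Qed.

Lemma umean_lt_nu_sup f c d : umean_le f c -> c < d -> (nu_sup f < d%:E)%E.
Proof.
move=> fc cd; have e0 : 0 < (d - c) / 2 by rewrite divr_gt0// subr_gt0.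
rewrite /nu_sup /limn_esup limf_esupE.
apply: (@le_lt_trans _ _ (c + (d - c) / 2)%:E); last by rewrite lte_fin; lra.
apply: ge_ereal_inf; exists (ereal_sup ((fun N => (nuN N f)%:E) @`
    [set N | nuN N f <= c + (d - c) / 2])).
  by exists [set N | nuN N f <= c + (d - c) / 2] => //; exact: fc.
by apply: ge_ereal_sup => _ [N /= NV <-]; rewrite lee_fin.
Qed.

(** Uniform smallness of the upper tails. Unlike [trunc_le], it concerns the
    values on null sets as well. *)
Definition upper_integrable p f : Prop := forall e, 0 < e -> exists2 y, 0 < y &
  umean_le (fun n => abs_pow p f n * \1_[set k | y < `|f k|] n) e.

End UpperIntegrability.

Section KpSpace.
Variables (R : realType) (A : set (set posnat)) (p : R).
Hypotheses (fA : set_field A) (AF : A `<=` densF R) (p1 : 1 <= p).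
Implicit Types (f g h s : posnat -> R) (a b c d e K M r x y z : R) (E F : set posnat).

Let hp : p = 0 \/ 1 <= p. Proof. by right. Qed.
Let pgt0 : 0 < p. Proof. exact: lt_le_trans p1. Qed.

Lemma abs_pow_tail f y : 0 < y ->
  (abs_pow p f) @^-1` `](y `^ p), +oo[%classic = [set k | y < `|f k|].
Proof.
move=> y0; apply/seteqP; split=> k /=; rewrite in_itv/= andbT /abs_pow.
  move=> h; rewrite ltNge; apply/negP => fy.
  by have := lt_le_trans h (ler_powR_base p1 (normr_ge0 _) fy); rewrite ltxx.
by apply: ltr_powR_base => //; exact: ltW.
Qed.

Lemma upper_integrable_dens f e : upper_integrable p f -> 0 < e ->
  exists2 y, 0 < y & dens_le [set k | y < `|f k|] e.
Proof.
move=> fu e0; have [y y0 fy] := fu _ e0; exists (Num.max y 1).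
  by rewrite lt_max y0.
apply: umean_le_trans fy => // k; rewrite !indicE.
case: (asboolP (Num.max y 1 < `|f k|)) => fk; last first.
  by rewrite memNset// mulr_ge0 ?abs_pow_ge0.
have := fk; rewrite gt_max => /andP[yk k1].
have one : (1 : R) = 1 `^ p by rewrite powR1.
rewrite !mem_set// mulr1 /abs_pow {1}one.
by apply: ler_powR_base => //; exact: ltW.
Qed.

(** The two parts correspond to the two conditions in the definition: level
    sets to measurability, by [level_sets_fmeas] and [fmeas_level_sets], and
    the tails to each other. *)
Lemma KpP f : Kp A p f <-> fmeas A f /\ upper_integrable p f.
Proof.
split=> [[[C Cc fC] fu]|[fa fu]].
  have fu' : upper_integrable p f.
    move=> e /fu[y y0 fy]; exists y => //.
    by have := nu_sup_lt_umean fy; rewrite abs_pow_tail.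
  split => //; apply: (level_sets_fmeas fA AF Cc fC) => e e0.
  by have [y y0 fy] := upper_integrable_dens fu' e0; exists y => //; exact: ltW.
split; first exact: fmeas_level_sets.
move=> e e0; have e20 : 0 < e / 2 by rewrite divr_gt0.
have [y y0 fy] := fu _ e20; exists y => //; rewrite /= abs_pow_tail//.
apply: (umean_lt_nu_sup fy).
by rewrite ltr_pdivrMr// ltr_pMr// ltr1n.
Qed.

(** At each point the larger of the two functions controls the sum up to a
    factor 2, and it exceeds the larger of the two levels when the sum exceeds
    twice that level. *)
Lemma upper_integrableD f g : upper_integrable p f -> upper_integrable p g ->
  upper_integrable p (fun k => f k + g k).
Proof.
move=> fu gu e e0; have p20 : 0 < (2 : R) `^ p by exact: powR_gt0.
have e'0 : 0 < e / 2 / 2 `^ p by rewrite !divr_gt0.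
have [y y0 fy] := fu _ e'0; have [z z0 gz] := gu _ e'0.
exists (2 * Num.max y z); first by rewrite mulr_gt0// lt_max y0.
have := umean_leZ (ltW p20) (umean_leD fy gz).
apply: umean_le_trans => [k|]; last first.
  by rewrite -mulrDl -splitr mulrC divfK// gt_eqF.
have h0 f' (E : set posnat) : 0 <= abs_pow p f' k * \1_E k.
  by rewrite mulr_ge0 ?abs_pow_ge0 ?indic_ge0.
rewrite {1}indicE; case: (asboolP (2 * Num.max y z < `|f k + g k|)) => fgk; last first.
  by rewrite memNset// mulr0 mulr_ge0 ?(ltW p20)// addr_ge0.
rewrite mem_set// mulr1.
have fg : `|f k + g k| <= `|f k| + `|g k| by exact: ler_normD.
have [ym zm] : y <= Num.max y z /\ z <= Num.max y z by rewrite !le_max !lexx orbT.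
have [gf|/ltW fg'] := leP `|g k| `|f k|.
  rewrite mulrDr -[leLHS]addr0 lerD//; last by rewrite mulr_ge0// ltW.
  rewrite indicE mem_set/=; last by lra.
  by rewrite mulr1 /abs_pow -powRM// ler_powR_base//; lra.
rewrite mulrDr -[leLHS]add0r lerD//; first by rewrite mulr_ge0// ltW.
rewrite indicE mem_set/=; last by lra.
by rewrite mulr1 /abs_pow -powRM// ler_powR_base//; lra.
Qed.

Lemma upper_integrableZ a f : upper_integrable p f ->
  upper_integrable p (fun k => a * f k).
Proof.
move=> fu e e0; have [->|a0] := eqVneq a 0.
  exists 1 => //; apply: umean_le_trans (umean_le_cst e) => // k.
  by rewrite /abs_pow mul0r normr0 powR0 ?gt_eqF// mul0r ltW.
have aa : 0 < `|a| by rewrite normr_gt0.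
have ap : 0 < `|a| `^ p by exact: powR_gt0.
have [y y0 fy] := fu _ (divr_gt0 e0 ap); exists (`|a| * y); first exact: mulr_gt0.
have := umean_leZ (ltW ap) fy; apply: umean_le_trans => [k|]; last first.
  by rewrite mulrC divfK// gt_eqF.
rewrite mulrA /abs_pow normrM powRM// ler_wpM2l ?mulr_ge0 ?powR_ge0//.
by apply: indic_sub; rewrite /= normrM ltr_pM2l.
Qed.

Lemma le_min_tail f y k : 0 < y -> abs_pow p f k <=
  Num.min (abs_pow p f k) (y `^ p) + abs_pow p f k * \1_[set k | y < `|f k|] k.
Proof.
move=> y0; have h0 := abs_pow_ge0 p f k; have yp : 0 <= y `^ p by exact: powR_ge0.
rewrite indicE; case: (asboolP (y < `|f k|)) => fk.
  by rewrite mem_set// mulr1 lerDr min_ge0.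
rewrite memNset// mulr0 addr0 min_l// /abs_pow ler_powR_base//.
by rewrite leNgt; exact/negP.
Qed.

(** Under uniform smallness of the tails, truncation does not matter. *)
Lemma upper_integrable_umean f c : upper_integrable p f ->
  umean_le (abs_pow p f) c <-> trunc_le (abs_pow p f) c.
Proof.
move=> fu; split=> [|fc]; first exact: umean_trunc_le.
apply: umean_le_closed => e /fu[y y0 fy].
have := umean_leD (fc _ (powR_ge0 y p)) fy; apply: umean_le_trans => // k.
exact: le_min_tail.
Qed.

Lemma Kp_cvgn f : fmeas A f -> upper_integrable p f ->
  cvgn (fun N => nuN N (abs_pow p f)).
Proof.
move=> fa fu; apply: cvgn_nu_closed => e /fu[y y0 fy].
exists (fun k => Num.min (abs_pow p f k) (y `^ p)).
  apply: (cvgn_min fA AF (abs_pow_ge0 p f)); first exact: fmeas_abs_pow.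
  exact: powR_ge0.
apply: umean_le_trans fy => // k.
rewrite ger0_norm ?subr_ge0 ?ge_min ?lexx// lerBlDl.
exact: le_min_tail.
Qed.

Lemma upper_integrable_pnorm f : upper_integrable p f -> exists r, pnorm_le p f r.
Proof.
move=> /(_ _ ltr01)[y y0 fy]; have y1 : 0 <= y `^ p + 1 by rewrite addr_ge0 ?powR_ge0.
exists ((y `^ p + 1) `^ p^-1); apply/pnorm1P => //; split; first exact: powR_ge0.
rewrite powR_root//; apply: umean_trunc_le.
have := umean_leD (umean_le_cst (y `^ p)) fy; apply: umean_le_trans => // k.
by rewrite (le_trans (le_min_tail _ _ y0))// lerD2r ge_min lexx orbT.
Qed.

Lemma Kp_pnormed : pnormed p (Kp_space A p).
Proof.
split.
- apply/KpP; split; first exact/fmeas_fsimple/fsimple_cst.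
  move=> e e0; exists 1 => //; apply: umean_le_trans (umean_le_cst e) => // k.
  by rewrite /abs_pow normr0 powR0 ?gt_eqF// mul0r ltW.
- move=> f g /KpP[fa fu] /KpP[ga gu]; apply/KpP; split; first exact: fmeasD.
  exact: upper_integrableD.
- move=> a f /KpP[fa fu]; apply/KpP; split; first exact: fmeasZ.
  exact: upper_integrableZ.
- move=> f g /KpP[fa fu] /KpP[ga gu]; split.
  + exact: (eq_aeP fA AF hp).
  + exact: powR_ge0.
  + move=> r r0; rewrite /= abs_powB.
    have ha := fmeasB fA fa ga.
    have hu : upper_integrable p (fun k => f k - g k).
      have := upper_integrableD fu (upper_integrableZ (-1) gu).
      by under eq_fun do rewrite mulN1r.
    have hc := Kp_cvgn ha hu.
    rewrite root_le_powR//; last first.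
      by apply: (umean_le_ge0 (abs_pow_ge0 p _) (umean_cvg hc)).
    rewrite /pdist_le pnorm1P// -(upper_integrable_umean _ hu) (umean_leP _ hc).
    by split => [|[]].
Qed.

Lemma Kp_represents_Lp : represents p (Kp_space A p) (Lp_space A p).
Proof.
move=> f /KpP[fa fu]; exists f; last exact: pdist_le_refl.
by apply/(fcar_LpP fA AF hp); split => //; exact: upper_integrable_pnorm.
Qed.

(** A representative with uniformly small upper tails is glued from the
    truncations of the given function, at levels which grow slowly: its excess
    over a fixed level is a sum of increments [w j] as in [block_gluing]. *)
Lemma Lp_represents_Kp : nullN R `<=` A ->
  represents p (Lp_space A p) (Kp_space A p).
Proof.
move=> NA f /(fcar_LpP fA AF hp)[fa [r /(pnorm1P _ _ p1)[r0 fr]]].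
have f0 := abs_pow_ge0 p f; have fpa := fmeas_abs_pow fA p1 fa.
have /choice[M MP] : forall j, exists M, 0 <= M /\ forall M', 0 <= M' ->
    umean_le (fun k => Num.min (abs_pow p f k) M' - Num.min (abs_pow p f k) M)
      (2^-1 ^+ j).
  move=> j; have [|M M0 MP] := trunc_tail fA AF f0 fpa fr (e := 2^-1 ^+ j).
    by rewrite exprn_gt0.
  by exists M.
(* The levels must increase, tend to infinity, and stay above the [M j]; all
   three hold for this sum because the [M j] are nonnegative. *)
pose L (j : nat) : R := j%:R + \sum_(i < j.+1) M i.
have M0 j : 0 <= M j by have [] := MP j.
have LS j : L j <= L j.+1.
  by rewrite /L -natr1 [X in _ <= _ + X]big_ord_recr/=; have := M0 j.+1; lra.
have ML j : M j <= L j.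
  by rewrite /L big_ord_recr/= addrA lerDr addr_ge0// sumr_ge0.
have jL j : j%:R <= L j by rewrite /L lerDl sumr_ge0.
have L0 j : 0 <= L j by exact: le_trans (ler0n _ _) (jL j).
pose w j k := Num.min (abs_pow p f k) (L j.+1) - Num.min (abs_pow p f k) (L j).
have w0 j k : 0 <= w j k.
  rewrite subr_ge0 le_min !ge_min lexx/=; apply/orP; right; exact: LS.
have wj j : umean_le (w j) (2^-1 ^+ j).
  have [_ /(_ _ (L0 j.+1))] := MP j; apply: umean_le_trans => // k.
  rewrite lerD2l lerN2 le_min !ge_min lexx/=; apply/orP; right; exact: ML.
have [i [ioo isum]] := block_gluing w0 wj.
pose h k := clamp (L (i k) `^ p^-1) (f k).
have hE k : abs_pow p h k = Num.min (abs_pow p f k) (L (i k)).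
  rewrite /abs_pow normr_clamp ?powR_ge0// (min_powR _ _ p1) ?powR_ge0//.
  by rewrite powR_root.
have hw m k : (m <= i k)%N ->
    abs_pow p h k - Num.min (abs_pow p f k) (L m) = \sum_(m <= j < i k) w j k.
  move=> mi; rewrite hE.
  by rewrite (telescope_sumr (fun j => Num.min (abs_pow p f k) (L j))).
have fh : negl (fun k => f k - h k).
  move=> e e0; apply: dens_le_eq0 => d d0.
  have [K [C [K0 AC Ce fK]]] := fmeas_tight fa d0.
  have [m _ mK] : \forall m \near \oo, K `^ p <= m%:R by exact: nbhs_infty_ger.
  have [N NP] := ioo m.
  apply: (umean_le_tail (K := N) _ Ce) => k /NP mi; apply: indic_sub => /= efh.
  apply: contrapT => /fK fk; move: efh; rewrite /h clamp_id.
    by rewrite subrr normr0 ltNge ltW.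
  apply: (le_trans fk); rewrite -[K](root_powR p1)//; apply: ge0_ler_powR.
  - by rewrite invr_ge0 ltW.
  - by rewrite nnegrE powR_ge0.
  - by rewrite nnegrE.
  - by apply: le_trans (jL _); exact: mK.
exists h; last exact/(pnorm_le0P hp).
apply/KpP; split; first exact: fmeas_null fh.
move=> e e0; have [m me] := exists_half_pow_le 8 e0.
(* Above this level the power of [h] is at least twice [L m], hence at most
   twice its excess over [L m]. *)
exists ((2 * L m + 1) `^ p^-1); first by rewrite powR_gt0// ltr_wpDl// mulr_ge0.
have [N NP] := ioo m.
have := umean_leZ (ler0n _ 2) (isum m) => h2.
have h2' : umean_le (fun k => 2 * \sum_(m <= j < i k) w j k) e.
  by apply: umean_le_trans h2 => //; lra.
apply: (umean_le_tail (K := N) _ h2') => k /NP mi.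
have sum0 : 0 <= \sum_(m <= j < i k) w j k by apply: sumr_ge0.
rewrite indicE; case: (asboolP ((2 * L m + 1) `^ p^-1 < `|h k|)) => hk; last first.
  by rewrite memNset// mulr0 mulr_ge0.
rewrite mem_set// mulr1 -hw//.
have : 2 * L m + 1 <= abs_pow p h k.
  have Lm0 : 0 <= 2 * L m + 1 by rewrite addr_ge0// mulr_ge0.
  rewrite -[2 * L m + 1](powR_root p1)// /abs_pow ler_powR_base ?powR_ge0//.
  exact: ltW.
have : Num.min (abs_pow p f k) (L m) <= L m by rewrite ge_min lexx orbT.
by lra.
Qed.

End KpSpace.

(** * The completeness criteria *)

Section Criterion.
Variables (R : realType) (A : set (set posnat)) (p : R).
Hypotheses (fA : set_field A) (AF : A `<=` densF R) (hp : p = 0 \/ 1 <= p).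

Let clf : set_field (dens_cl R A). Proof. exact: dens_cl_field. Qed.
Let clF : dens_cl R A `<=` densF R. Proof. exact: dens_cl_densF. Qed.
Let Acl : A `<=` dens_cl R A. Proof. exact: sub_dens_cl. Qed.

(** The space over the closure is complete and contains [L_p(A)] as a dense
    subspace. *)
Lemma Lp_complete_represents : qcomplete (Lp_space A p) <->
  represents p (Lp_space (dens_cl R A) p) (Lp_space A p).
Proof.
have nA := Lp_pnormed fA AF hp; have ncl := Lp_pnormed clf clF hp.
split=> [cA|rep].
  by apply: (complete_dense_represents hp nA _ cA); exact: Lp_dense.
apply: (represents_complete hp nA ncl _ rep); last exact: Lp_dens_cl_complete.
by apply: (sub_represents hp); exact: Lp_incl.
Qed.

Lemma Lp_completeP : qcomplete (Lp_space A p) <->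
  PJ_completion R (dens_cl R A) = null_mod R (PJ_completion R A).
Proof.
exact: iff_trans Lp_complete_represents (represents_setsP fA AF hp).
Qed.

End Criterion.

Theorem theorem9p2 (R : realType) (A : set (set posnat)) (p : R)
    (fieldA : set_field A) (AF : A `<=` densF R) (hp : p = 0 \/ 1 <= p) :
  let LA := Lp_space A p in
  let Ll := Lp_space (lambda R A) p in
  let AN := field_gen (A `|` nullN R) in
  let La := Lp_space AN p in
  let Ka := Kp_space AN p in
  let barAN := field_gen (PJ_completion R A `|` nullN R) in
  let a := qcomplete LA in
  let b := exists2 Phi, canonical_map LA Ll Phi &
                        isometric_iso LA Ll (fquot Ll) Phi in
  let c := PJ_completion R (lambda R A) = barAN in
  let d := qcomplete Ka /\ PJ_completion R AN = barAN in
  [/\ lambda R A `<=` densF R,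
      qcomplete Ll,
      exists D Phi, [/\ qsubspace Ll D, qdense Ll D, canonical_map LA Ll Phi
                      & isometric_iso LA Ll D Phi],
      [/\ a <-> b, b <-> c & 1 <= p -> (c <-> d)]
    & [\/ a, b, c | 1 <= p /\ d] ->
        isometric LA La /\ (1 <= p -> isometric La Ka)].
Proof.
move=> LA Ll AN La Ka barAN a b c d.
have clf : set_field (dens_cl R A) by exact: dens_cl_field.
have clF : dens_cl R A `<=` densF R by exact: dens_cl_densF.
have Acl : A `<=` dens_cl R A by exact: sub_dens_cl.
have lE : lambda R A = dens_cl R A by exact: lambdaE.
have ANE : AN = null_mod R A by exact: field_gen_null.
have barE : barAN = null_mod R (PJ_completion R A).
  by apply: field_gen_null; exact: PJ_completion_field.
have NAN : nullN R `<=` AN by move=> E NE; apply: sub_gen_smallest; right.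
clearbody AN barAN.
have clAN : dens_cl R AN = dens_cl R A by rewrite ANE dens_cl_null_mod.
have fAN : set_field AN by rewrite ANE; exact: null_mod_field.
have ANcl : AN `<=` dens_cl R A by rewrite ANE; exact: null_mod_sub_dens_cl.
have ANF : AN `<=` densF R by exact: subset_trans ANcl clF.
have A_AN : A `<=` AN by rewrite ANE; exact: sub_null_mod.
have nLA : pnormed p LA by exact: Lp_pnormed.
have nLa : pnormed p La by exact: Lp_pnormed.
have LlE : Ll = Lp_space (dens_cl R A) p by rewrite /Ll lE.
have nLl : pnormed p Ll by rewrite LlE; exact: Lp_pnormed.
have LA_Ll : fcar LA `<=` fcar Ll by rewrite LlE; exact: Lp_incl.
have LA_La : fcar LA `<=` fcar La by exact: Lp_incl.
have La_Ll : fcar La `<=` fcar Ll by rewrite LlE; exact: Lp_incl.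
have dLA : pdense p LA Ll by rewrite LlE; exact: Lp_dense.
have cP : c <-> represents p Ll LA.
  by rewrite /c barE lE LlE; exact: iff_sym (represents_setsP fieldA AF hp).
have bP : b <-> represents p Ll LA by exact: (canonical_isoP hp nLA nLl LA_Ll).
have aP : a <-> represents p Ll LA by rewrite LlE; exact: Lp_complete_represents.
have KaLa : 1 <= p -> represents p Ka La /\ represents p La Ka.
  by move=> p1; split; [exact: Kp_represents_Lp|exact: Lp_represents_Kp].
have cdP : 1 <= p -> (c <-> d).
  move=> p1; have [KL LK] := KaLa p1.
  have nKa : pnormed p Ka by exact: Kp_pnormed.
  have KaP : qcomplete Ka <-> dens_cl R A = PJ_completion R AN.
    have LaP : qcomplete La <-> dens_cl R A = PJ_completion R AN.
      have := Lp_completeP fAN ANF hp; rewrite (PJ_completion_null fAN ANF NAN).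
      by rewrite clAN (PJ_completion_dens_cl fieldA AF).
    apply: iff_trans LaP; split => [cK|cL].
      by apply: (represents_complete hp nLa nKa LK KL cK).
    by apply: (represents_complete hp nKa nLa KL LK cL).
  have PJAN : PJ_completion R AN `<=` dens_cl R A.
    by rewrite -(PJ_completion_dens_cl fieldA AF); exact: PJ_completionS.
  have barPJ : barAN `<=` PJ_completion R AN.
    rewrite barE -(PJ_completion_null fAN ANF NAN) => E [B /(PJ_completionS A_AN) PB EB].
    by exists B.
  have clP : c <-> dens_cl R A = barAN.
    rewrite /c lE (PJ_completion_dens_cl fieldA AF); exact: iff_refl.
  split=> [/clP clE|[/KaP clE PJE]]; last first.
    by apply/clP; rewrite clE; exact: PJE.
  have PJE : PJ_completion R AN = barAN.
    by apply/seteqP; split; [rewrite -clE; exact: PJAN|exact: barPJ].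
  by split; [apply/KaP; rewrite PJE; exact: clE|exact: PJE].
split.
- by rewrite lE.
- by rewrite LlE; exact: Lp_dens_cl_complete.
- exists (transfer p Ll @` fquot LA), (transfer p Ll); split.
  + exact: transfer_qsubspace.
  + exact: transfer_qdense.
  + exact: transfer_canonical.
  + exact: (transfer_iso hp nLA nLl (sub_represents hp LA_Ll)).
- split; first exact: iff_trans aP (iff_sym bP).
    exact: iff_trans bP (iff_sym cP).
  exact: cdP.
- move=> abcd; have rep : represents p Ll LA.
    by case: abcd => [/aP|/bP|/cP|[p1 /(cdP p1)/cP]]; exact.
  have rLa : represents p La LA by move=> f /La_Ll; exact: rep.
  split.
    exact: (represents_isometric hp nLA nLa (sub_represents hp LA_La) rLa).
  move=> p1; have [KL LK] := KaLa p1.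
  have nKa : pnormed p Ka by exact: Kp_pnormed.
  exact: (represents_isometric hp nLa nKa LK KL).
Qed.
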